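(* Let $N\ge 3$, let $\nu:(0,\infty)\to[0,\infty)$ be a measurable function that is nonincreasing near the origin, and let $V$ be a nonnegative measurable function on $\mathbb{R}^N$. Suppose that $$\liminf_{r\to 0+} r^2\nu(r)>\frac12\, j_{\frac{N-2}{2},1}^2$$ and that $V(x)\ge \nu(|x|)$ for a.e. $x\in\mathbb{R}^N$. Then for any initial datum $u_0\in C_0(\mathbb{R}^N)$ with $u_0\ge 0$ and $u_0\not\equiv 0$, the equation $$\frac{\partial}{\partial t}u=\frac12\Delta u+Vu \ \text{ in } (0,\infty)\times\mathbb{R}^N,\qquad u(0,x)=u_0(x)\ \text{ in }\mathbb{R}^N,$$ does not have a solution; that is, $\lim_{m\to\infty}u_m(t,x)=\infty$ for all $t>0$ and $x\in\mathbb{R}^N$. (By monotone convergence this is equivalent to $E_x\left[u_0(B_t)\exp\left(\int_0^t V(B_s)\,ds\right)\right]=\infty$ for all $t>0$ and $x\in\mathbb{R}^N$.)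
   Context: ''Nonincreasing near the origin'' means that there is $r_0>0$ such that $\nu$ is nonincreasing on $(0,r_0]$. For $\mu>-1$, $j_{\mu,1}$ denotes the first positive zero of the Bessel function $J_\mu$ of the first kind with index $\mu$. $C_0(\mathbb{R}^N)$ denotes the continuous functions on $\mathbb{R}^N$ with compact support. $(\{B_t\}_{t\ge0},\{P_x\}_{x\in\mathbb{R}^N})$ is an $N$-dimensional Brownian motion ($B_0=x$ under $P_x$, generator $\frac12\Delta$), and $E_x$ is the expectation with respect to $P_x$. Nonexistence of solutions (in the sense of Baras and Goldstein): for $m\in\mathbb{N}$ set $V_m(x)=\min\{m,V(x)\}$. The equation with $V$ replaced by $V_m$ has a unique solution $u_m$, which is given by the Feynman-Kac formula $$u_m(t,x)=E_x\left[u_0(B_t)\exp\left(\int_0^t V_m(B_s)\,ds\right)\right],\quad t>0,\ x\in\mathbb{R}^N.$$ The equation (with potential $V$) is said not to have a solution if $\lim_{m\to\infty}u_m(t,x)=\infty$ for all $t>0$ and $x\in\mathbb{R}^N$. *)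

(* Defs.v *)
From HB Require Import structures.
From mathcomp Require Import all_boot all_order all_algebra.
From mathcomp Require Import all_classical all_reals all_analysis.

Set Implicit Arguments.
Unset Strict Implicit.
Unset Printing Implicit Defensive.

Import Order.TTheory GRing.Theory Num.Theory.
Import numFieldNormedType.Exports.

Local Open Scope classical_set_scope.
Local Open Scope ring_scope.

(* The library's norm `|x| on 'rV[R]_n is the sup norm; as it is equivalent to
   the Euclidean one, continuity, compactness and Borel sets are the usual
   ones. *)
Definition euclid_norm (R : realType) (n : nat) (x : 'rV[R]_n) : R :=
  Num.sqrt (\sum_(i < n) x ord0 i ^+ 2).

Section lebesgue_Rn.
Variables (R : realType) (n : nat).
Local Open Scope ereal_scope.

Definition box (p : 'rV[R]_n * 'rV[R]_n) : set 'rV[R]_n :=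
  [set x | forall i, (p.1 ord0 i < x ord0 i <= p.2 ord0 i)%R].

Definition box_vol (p : 'rV[R]_n * 'rV[R]_n) : R :=
  (\prod_(i < n) Num.max 0 (p.2 ord0 i - p.1 ord0 i))%R.

Definition countable_box_cover (A : set 'rV[R]_n) :
    set (set ('rV[R]_n * 'rV[R]_n)) :=
  [set D | countable D /\ A `<=` \bigcup_(p in D) box p].

Definition lebesgue_outer (A : set 'rV[R]_n) : \bar R :=
  ereal_inf [set \esum_(p in D) (box_vol p)%:E | D in countable_box_cover A].

Lemma box_vol_ge0 p : 0 <= (box_vol p)%:E.
Proof. by rewrite lee_fin; apply: prodr_ge0 => i _; rewrite le_max lexx. Qed.

Lemma lebesgue_outer_ge0 A : 0 <= lebesgue_outer A.
Proof.
apply: le_ereal_inf_tmp => _ [D _ <-].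
by apply: esum_ge0 => p _; exact: box_vol_ge0.
Qed.

Lemma lebesgue_outer0 : lebesgue_outer set0 = 0.
Proof.
apply/eqP; rewrite eq_le lebesgue_outer_ge0 andbT.
apply: ereal_inf_lbound; exists set0; last by rewrite esum_set0.
by split=> //; exact: countable0.
Qed.

Lemma le_lebesgue_outer :
  {homo lebesgue_outer : A B / A `<=` B >-> A <= B}.
Proof.
move=> A B AB; apply: ereal_inf_le_tmp => _ [D [cD BD] <-].
by exists D => //; split=> //; exact: subset_trans BD.
Qed.

Lemma lebesgue_outer_sigma_subadditive : sigma_subadditive lebesgue_outer.
Proof.
move=> A; have [[i ioo]|] := pselect (exists i, lebesgue_outer (A i) = +oo).
  rewrite (eseries_pinfty _ _ ioo) ?leey// => m _.
  by rewrite -ltNye (lt_le_trans _ (lebesgue_outer_ge0 _)).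
rewrite -forallNE => Aoo.
suff add2e (e : {posnum R}) : lebesgue_outer (\bigcup_m A m) <=
    \sum_(i <oo) lebesgue_outer (A i) + e%:num%:E.
  by apply/lee_addgt0Pr => _/posnumP[].
rewrite (le_trans _ (epsilon_trick _ _ _))//; last first.
  by move=> m; exact: lebesgue_outer_ge0.
have [D PD] : {D : nat -> set ('rV[R]_n * 'rV[R]_n) & forall m,
    countable_box_cover (A m) (D m) /\
    \esum_(p in D m) (box_vol p)%:E <=
      lebesgue_outer (A m) + (e%:num / (2 ^ m.+1)%:R)%:E}.
  apply: (@choice _ _ (fun m Dm => countable_box_cover (A m) Dm /\
    \esum_(p in Dm) (box_vol p)%:E <=
      lebesgue_outer (A m) + (e%:num / (2 ^ m.+1)%:R)%:E)) => m.
  have en1 : (0 < e%:num / (2 ^ m.+1)%:R)%R by [].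
  have fA : lebesgue_outer (A m) \is a fin_num.
    by rewrite ge0_fin_numE ?lebesgue_outer_ge0// ltey; apply/eqP; exact: Aoo.
  have [_ [E cE <-] lE] := lb_ereal_inf_adherent en1 fA.
  by exists E; split=> //; exact: ltW.
apply: (@le_trans _ _ (\esum_(p in \bigcup_m D m) (box_vol p)%:E)).
  apply: ereal_inf_lbound; exists (\bigcup_m D m) => //; split.
    by apply: bigcup_countable => // m _; exact: (PD m).1.1.
  move=> x [m _ /(PD m).1.2[p Dp xp]].
  by exists p => //; exists m.
rewrite seqDU_bigcup_eq nneseries_sum_bigcup; last 2 first.
- exact: trivIset_seqDU.
- exact: box_vol_ge0.
apply: lee_nneseries => m _.
  by move=> _; apply: esum_ge0 => p _; exact: box_vol_ge0.
apply: le_trans (PD m).2.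
apply: ge_ereal_sup => _ [F [fF FD] <-]; apply: ereal_sup_ubound.
by exists F => //; split=> //; exact: subset_trans FD (@subset_seqDU _ _ _).
Qed.

HB.instance Definition _ := isOuterMeasure.Build R 'rV[R]_n lebesgue_outer
  lebesgue_outer0 lebesgue_outer_ge0 le_lebesgue_outer
  lebesgue_outer_sigma_subadditive.

End lebesgue_Rn.

(* R^n with the sigma-algebra of Lebesgue (i.e. Caratheodory) measurable sets *)
Notation lebesgueRn R n := (caratheodory_type (@lebesgue_outer R n)).

Definition lebesgue_measureRn (R : realType) (n : nat) :
  set (lebesgueRn R n) -> \bar R := @lebesgue_outer R n.
Arguments lebesgue_measureRn : clear implicits.

HB.instance Definition _ (R : realType) (n : nat) :=
  isMeasure.Build _ (lebesgueRn R n) R (lebesgue_measureRn R n)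
    (@caratheodory_measure0 _ _ _) (@caratheodory_measure_ge0 _ _ _)
    (@caratheodory_measure_sigma_additive _ _ _).

Notation borelRn R n := (g_sigma_algebraType (@open 'rV[R]_n)).

(* The real line with the sigma-algebra of Lebesgue measurable sets, i.e. the
   domain of the library's completed_lebesgue_measure; the library's
   measurable sets of R are the Borel sets. *)
Notation lebesgueR R := (caratheodory_type ((@wlength R idfun)^*)%mu).

Section bessel.
Variable R : realType.

(* meaningful for 0 < s *)
Definition Gamma (s : R) : R :=
  \int[lebesgue_measure]_(t in `]0, +oo[) (t `^ (s - 1) * expR (- t)).

(* meaningful for -1 < mu and 0 < x *)
Definition besselJ (mu x : R) : R :=
  limn (series (fun k : nat =>
    (-1) ^+ k / (k`!%:R * Gamma (mu + k%:R + 1)) * (x / 2) `^ (mu + k.*2%:R))).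

Definition first_positive_zero (f : R -> R) (j : R) : Prop :=
  [/\ 0 < j, f j = 0 & forall x : R, 0 < x < j -> f x != 0].

(* j_{mu,1}; the default value 0 is not used when -1 < mu *)
Definition bessel_j1 (mu : R) : R :=
  xget 0 [set j | first_positive_zero (besselJ mu) j].

End bessel.

Section brownian.
Variables (R : realType) (N : nat).
Variables (d : measure_display) (Omega : measurableType d).
Variable P : probability Omega R.

(* Sub-families need not be considered, as A k may be the whole space. *)
Definition mutually_independent (n : nat) (X : 'I_n -> Omega -> 'rV[R]_N) :=
  forall A : 'I_n -> set (borelRn R N), (forall k, measurable (A k)) ->
  P (\bigcap_(k in [set: 'I_n]) (X k @^-1` A k)) =
  (\prod_(k < n) P (X k @^-1` A k))%E.

(* X has the law N(0, v I_N), given by its values on products of Borel sets;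
   normal_prob takes the mean and the standard deviation *)
Definition centered_gaussian (v : R) (X : Omega -> 'rV[R]_N) :=
  forall A : 'I_N -> set R, (forall i, measurable (A i)) ->
  P [set w | forall i, A i (X w ord0 i)] =
  (\prod_(i < N) normal_prob 0 (Num.sqrt v) (A i))%E.

(* B is an N-dimensional Brownian motion (with generator Delta / 2) started at
   x under P; only the times t >= 0 matter. *)
Record brownian_motion (x : 'rV[R]_N) (B : R -> Omega -> 'rV[R]_N) : Prop := {
  bm_measurable : forall t : R, 0 <= t ->
    measurable_fun [set: Omega] (B t : Omega -> borelRn R N) ;
  bm_start : {ae P, forall w, B 0 w = x} ;
  bm_independent : forall (n : nat) (t : nat -> R),
    0 <= t 0%N -> (forall k, t k <= t k.+1) ->
    mutually_independent (fun (k : 'I_n) w => B (t k.+1) w - B (t k) w) ;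
  bm_gaussian : forall s t : R, 0 <= s -> s < t ->
    centered_gaussian (t - s) (fun w => B t w - B s w) ;
  bm_continuous :
    {ae P, forall w, {within `[0, +oo[, continuous (fun t => B t w)}} }.

End brownian.

Section feynman_kac.
Variables (R : realType) (N : nat).
Variables (d : measure_display) (Omega : measurableType d).
Variables (P : 'rV[R]_N -> probability Omega R).
Variables (B : R -> Omega -> 'rV[R]_N).
Variables (V u0 : 'rV[R]_N -> R).

Definition truncated (m : nat) (x : 'rV[R]_N) : R := Num.min m%:R (V x).

(* When V is Lebesgue but not Borel measurable, the integrands below are only
   almost surely equal to measurable functions.  The library's integral of a
   nonnegative function is the supremum of the integrals of the measurable
   simple functions below it, hence agrees with the integral for the completed
   measure. *)
Definition feynman_kac (m : nat) (t : R) (x : 'rV[R]_N) : \bar R :=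
  ('E_(P x) [ (fun w => (u0 (B t w) *
    expR (\int[lebesgue_measure]_(s in `[0%R, t]) truncated m (B s w)))%R) ])%E.

(* nonexistence in the sense of Baras and Goldstein *)
Definition no_solution : Prop :=
  forall (t : R) (x : 'rV[R]_N), 0 < t ->
    feynman_kac m t x @[m --> \oo] --> +oo%E.

(* with the usual conventions exp(+oo) = +oo and 0 * +oo = 0 *)
Definition feynman_kac_full (t : R) (x : 'rV[R]_N) : \bar R :=
  (\int[P x]_w ((u0 (B t w))%:E *
    expeR (\int[lebesgue_measure]_(s in `[0%R, t]) (V (B s w))%:E)))%E.

End feynman_kac.

Definition continuous_compact_support (R : realType) (N : nat)
    (u : 'rV[R]_N -> R) : Prop :=
  continuous u /\ compact (closure [set x | u x != 0]).

Definition nonincreasing_near_origin (R : realType) (nu : R -> R) : Prop :=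
  exists2 r0 : R, 0 < r0 &
    forall r s : R, 0 < r -> r <= s -> s <= r0 -> nu s <= nu r.

(* Main.v *)
Require Import Defs.
From HB Require Import structures.
From mathcomp Require Import all_boot all_order all_algebra.
From mathcomp Require Import all_classical all_reals all_analysis.
From mathcomp Require Import measurable_realfun.
From mathcomp Require Import ring lra zify.

Set Implicit Arguments.
Unset Strict Implicit.
Unset Printing Implicit Defensive.

Import Order.TTheory GRing.Theory Num.Theory.
Import numFieldNormedType.Exports.

Local Open Scope classical_set_scope.
Local Open Scope ring_scope.

(** Near the origin the potential is at least c / |x|^2 with c > j^2 / 2, where
    j is the first zero of the Bessel function of index (N - 2) / 2, whereas
    the first Dirichlet eigenvalue of - Delta / 2 in the ball of radius r is
    j^2 / (2 r^2).  A Brownian path that stays in this ball for a time T gains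
    a factor exp (c T / r^2), and for any rho > j^2 it does so with a
    probability of order at least exp (- rho T / (2 r^2)): with rho < 2 c the
    gain wins as r tends to 0.  To make this precise, let T = t / 3 and consider
    the paths which are within a small multiple of r of the origin at time
    t / 3, stay in the ball of radius r until time 2 t / 3, and are near a
    given point where u0 is positive at time t.  As the density of the position
    at time t / 3 is bounded below, the first requirement costs only a factor
    r^N, and the last one costs a constant.  So the expectation is at least
    C r^N exp ((c - rho / 2) T / r^2), for every r small enough
    ([feynman_kac_explosion]).

    The eigenvalue enters through elementary means only.  The radial solution of
    Delta u = - u is x |-> psi (|x|^2) for an entire function psi, and psi is
    the Bessel function up to a power of |x| ([besselJ_psi]), so that j^2 is the
    first zero of psi.  A partial sum of psi plus a small constant is a
    polynomial p with L p + p / 2 >= delta > 0 on [0, rho1], where rho1 < rho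
    is a point at which p is negative and L is half of the Laplacian in the
    variable s = |x|^2 ([polynomial_subsolution]).  Let phi be the positive part
    of p, set to 0 beyond rho1 and rescaled to the ball of radius r, i.e.
    phi (y) = [cutoff p rho1] (k |y|^2) with k = rho1 / r^2.  It satisfies a
    one-sided second order Taylor inequality, with the derivatives of p
    ([radial_cutoff_taylor]): passing to the positive part can only increase
    the values.  Averaging this over a Gaussian increment of variance h, the
    strict surplus delta absorbs the third order error once h is small, so that
    killing the walk outside the ball costs at most the factor 1 - k h / 2 per
    step ([one_step_le]).  Iterating over the increments along a dyadic
    subdivision of [t / 3, 2 t / 3] ([walk_stay_prob]), and refining the
    subdivision, gives the confinement estimate for the Brownian path, by
    continuity of measures and of paths ([path_stay_prob],
    [brownian_confined]).

    The lower bound on the potential only holds off a Lebesgue null set, so one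
    also needs that almost every path spends no time in such a set
    ([occupation_null]).  This follows from Fubini's theorem, because the law
    of the position at a positive time has a bounded density. *)

(** * Integration by parts on the half line: the Gamma function and Gaussian moments *)

Section half_line.
Variable R : realType.
Notation mu := (@lebesgue_measure R).

Lemma expR_half_cvg0 (C : R) : C * expR (- (x / 2)) @[x --> +oo%R] --> (0 : R).
Proof.
rewrite -(mulr0 C); apply: cvgMr.
apply: (@cvg_comp _ _ _ (fun x : R => x / 2) (fun y => expR (- y)) _ +oo%R); last first.
  exact: cvgr_expR.
by apply: gt0_cvgMly => //; rewrite invr_gt0.
Qed.

Lemma continuous_cexpR_half (C : R) : continuous (fun x : R => C * expR (- (x / 2))).
Proof.
move=> x; apply: cvgM; first exact: cvg_cst.
apply: (cvg_comp _ expR); last exact: continuous_expR.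
apply: (@cvgN _ R^o); apply: cvgM; [exact: cvg_id|exact: cvg_cst].
Qed.

(** If F' = p - q and F vanishes at both ends, then p and q have the same
    integral.  The point is that no integrability needs to be known beforehand:
    adding an integrable exponential w >= q makes p - q + w nonnegative, so that
    the fundamental theorem of calculus for nonnegative integrands applies.  It
    yields both the recurrence of the Gamma function and that of the Gaussian
    moments. *)
Lemma half_line_ibp (C : R) (p q F : R -> R) :
  (forall x, 0 <= x -> 0 <= p x) ->
  (forall x, 0 <= x -> 0 <= q x <= C * expR (- (x / 2))) ->
  {within `[0, +oo[, continuous p} -> {within `[0, +oo[, continuous q} ->
  (forall x : R, 0 < x -> is_derive x 1 F (p x - q x)) ->
  F 0 = 0 -> F x @[x --> 0^'+] --> (0 : R) -> F x @[x --> +oo%R] --> (0 : R) ->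
  (\int[mu]_(x in `[0%R, +oo[) (p x)%:E = \int[mu]_(x in `[0%R, +oo[) (q x)%:E)%E
  /\ (\int[mu]_(x in `[0%R, +oo[) (q x)%:E < +oo)%E.
Proof.
move=> p0 q0 cp cq dF F0 F0r Fy.
pose w (x : R) := C * expR (- (x / 2)).
(* W is the primitive of w that vanishes at infinity. *)
pose W (x : R) := (- (2 * C)) * expR (- (x / 2)).
have C0 : 0 <= C.
  have /andP[] := q0 _ (lexx 0).
  by rewrite mul0r oppr0 expR0 mulr1; exact: le_trans.
have w0 x : 0 <= x -> 0 <= w x by move=> ?; rewrite mulr_ge0 ?expR_ge0.
have cw : {within `[0, +oo[, continuous w}.
  by apply: continuous_subspaceT; exact: continuous_cexpR_half.
have dW (x : R) : is_derive x 1 W (w x).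
  rewrite /W /w; apply: is_derive_eq.
  by rewrite !scaler1 ?scaler0 ?add0r ?addr0 /GRing.scale/=; field.
have cW : continuous W by exact: continuous_cexpR_half.
have W00 : W 0 = - (2 * C) by rewrite /W mul0r oppr0 expR0 mulr1.
have E1 : (\int[mu]_(x in `[0%R, +oo[) (w x)%:E = (2 * C)%:E)%E.
  rewrite (@ge0_continuous_FTC2y _ w W 0 0) //.
  - by rewrite W00 !EFinN oppeK add0e.
  - exact: expR_half_cvg0.
  - exact/cvg_at_right_filter/cW.
  - by move=> x _; rewrite derive1E; apply: derive_val.
have E2 : (\int[mu]_(x in `[0%R, +oo[) (p x - q x + w x)%:E = (2 * C)%:E)%E.
  rewrite (@ge0_continuous_FTC2y _ (fun x => p x - q x + w x) (fun x => F x + W x) 0 0) //.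
  - by rewrite -EFinB; congr EFin; rewrite W00 F0; ring.
  - move=> x x0; have /andP[_ ?] := q0 _ x0; have := p0 _ x0; rewrite /w; lra.
  - move=> x; apply: cvgD; last exact: cw.
    by apply: cvgB; [exact: cp|exact: cq].
  - by rewrite -[0 in X in _ --> X](addr0 0); apply: cvgD => //; exact: expR_half_cvg0.
  - move=> x x0; apply: derivableD; last by case: (dW x).
    by case: (dF x x0).
  - rewrite F0; apply: cvgD => //.
    exact/cvg_at_right_filter/cW.
  - move=> x; rewrite in_itv/= andbT => x0; rewrite derive1E.
    have := dF x x0; have := dW x => h1 h2.
    by have := is_deriveD h2 h1 => h3; rewrite (@derive_val _ _ _ _ _ _ _ h3).
have mI : measurable (`[0, +oo[%classic : set R) by [].
have mp := subspace_continuous_measurable_fun mI cp.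
have mq := subspace_continuous_measurable_fun mI cq.
have mw := subspace_continuous_measurable_fun mI cw.
have E3 : (\int[mu]_(x in `[0%R, +oo[) (p x - q x + w x)%:E
    + \int[mu]_(x in `[0%R, +oo[) (q x)%:E
    = \int[mu]_(x in `[0%R, +oo[) (p x)%:E + \int[mu]_(x in `[0%R, +oo[) (w x)%:E)%E.
  rewrite -!ge0_integralD//=.
  - by apply: eq_integral => x _; rewrite -!EFinD; congr EFin; ring.
  - by move=> x; rewrite in_itv/= andbT lee_fin => /p0.
  - exact/measurable_EFinP.
  - by move=> x; rewrite in_itv/= andbT lee_fin => /w0.
  - exact/measurable_EFinP.
  - move=> x; rewrite in_itv/= andbT lee_fin => x0.
    by have /andP[_ ?] := q0 _ x0; have := p0 _ x0; rewrite /w; lra.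
  - apply/measurable_EFinP; apply: measurable_funD => //.
    exact: measurable_funB.
  - by move=> x; rewrite in_itv/= andbT lee_fin => /q0/andP[].
  - exact/measurable_EFinP.
rewrite E1 E2 in E3; split.
  by have := congr1 (fun z => z - (2 * C)%:E)%E E3; rewrite [(_%:E + _)%E]addeC !addeK// => ->.
apply: (@le_lt_trans _ _ (2 * C)%:E); last exact: ltry.
rewrite -E1; apply: ge0_le_integral => //=.
- by move=> x; rewrite in_itv/= andbT lee_fin => /q0/andP[].
- exact/measurable_EFinP.
- exact/measurable_EFinP.
- by move=> x; rewrite in_itv/= andbT lee_fin => /q0/andP[].
Qed.

Lemma exprn_le_expR (n : nat) (x : R) : 0 <= x ->
  x ^+ n <= 2 ^+ n * n`!%:R * expR (x / 2).
Proof.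
move=> x0; case: n => [|n].
  rewrite !expr0 fact0 !mul1r -expR0 ler_expR.
  by rewrite divr_ge0.
have h : 0 <= x / 2 by lra.
have := expR_ge1Dxn n h; rewrite exprMn exprVn.
have f0 : 0 < n.+1`!%:R :> R by rewrite ltr0n fact_gt0.
have t0 : 0 < 2 ^+ n.+1 :> R by rewrite exprn_gt0.
move=> H.
have : x ^+ n.+1 / 2 ^+ n.+1 / n.+1`!%:R <= expR (x / 2).
  by apply: le_trans H; rewrite lerDr.
rewrite ler_pdivrMr// ler_pdivrMr//.
by rewrite [X in _ <= X -> _](_ : _ = 2 ^+ n.+1 * n.+1`!%:R * expR (x / 2))//; ring.
Qed.

End half_line.

Section gamma_function.
Variable R : realType.
Notation mu := (@lebesgue_measure R).

Let g (a t : R) := t `^ a * expR (- t).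

Let g_ge0 a t : 0 <= g a t.
Proof. by rewrite mulr_ge0 ?powR_ge0 ?expR_ge0. Qed.

Let g0 a : 0 < a -> g a 0 = 0.
Proof. by move=> a0; rewrite /g powR0 ?mul0r// gt_eqF. Qed.

Let g_cvg0 a : 0 < a -> g a t @[t --> 0^'+] --> (0 : R).
Proof.
move=> a0; rewrite -[X in _ --> X](mul0r (expR (- 0))); apply: cvgM.
  exact: powR_cvg0.
apply: cvg_at_right_filter; apply: (cvg_comp _ expR); last exact: continuous_expR.
exact: (@cvgN _ R^o).
Qed.

Let g_derive (a t : R) : 0 < t -> is_derive t 1 (g a) (a * g (a - 1) t - g a t).
Proof.
move=> t0; rewrite /g; have h := is_derive1_powR a t0.
apply: is_derive_eq; rewrite /GRing.scale/=; ring.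
Qed.

Let g_continuous a : 0 < a -> {within `[0, +oo[, continuous (g a)}.
Proof.
move=> a0; apply/continuous_within_itvcyP; split; last by rewrite g0//; exact: g_cvg0.
move=> x; rewrite in_itv/= andbT => x0.
apply/differentiable_continuous/derivable1_diffP.
by have [] := g_derive a x0.
Qed.

Let g_ub a (n : nat) t : 0 < a -> a <= n%:R -> 0 <= t ->
  g a t <= (1 + 2 ^+ n * n`!%:R) * expR (- (t / 2)).
Proof.
move=> a0 an t0.
have e1 : 1 <= expR (t / 2) by rewrite -expR0 ler_expR divr_ge0.
have h : t `^ a <= 1 + t ^+ n.
  have [t1|t1] := leP t 1.
    apply: (@le_trans _ _ 1); last by rewrite lerDl exprn_ge0.
    by have := @ge0_ler_powR R a (ltW a0) t 1; rewrite !nnegrE powR1; exact.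
  apply: (@le_trans _ _ (t ^+ n)); last by rewrite lerDr.
  by rewrite -powR_mulrn//; apply: ler_powR => //; exact: ltW.
have h2 : t `^ a <= (1 + 2 ^+ n * n`!%:R) * expR (t / 2).
  by apply: (le_trans h); rewrite mulrDl mul1r lerD//; exact: exprn_le_expR.
have -> : expR (- (t / 2)) = expR (t / 2) * expR (- t).
  by rewrite -expRD; congr expR; field.
by rewrite mulrA /g ler_wpM2r ?expR_ge0.
Qed.

Let g_cvgy a : 0 < a -> g a t @[t --> +oo%R] --> (0 : R).
Proof.
move=> a0; pose n := (Num.truncn a).+1.
have an : a <= n%:R by apply/ltW; rewrite /n truncnS_gt.
apply: (@squeeze_cvgr _ _ _ _ (fun=> 0) (fun t => (1 + 2 ^+ n * n`!%:R) * expR (- (t / 2)))).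
- near=> t; rewrite g_ge0/=; apply: g_ub => //.
- exact: cvg_cst.
- exact: expR_half_cvg0.
Unshelve. all: by end_near. Qed.

Let I (a : R) : \bar R := (\int[mu]_(t in `]0%R, +oo[) (g a t)%:E)%E.

Let mg a : measurable_fun setT (g a).
Proof.
rewrite /g; apply: measurable_funM; first exact: measurable_powR.
by apply: measurableT_comp.
Qed.

Let I_ge0 a : (0 <= I a)%E.
Proof. by apply: integral_ge0 => t _; rewrite lee_fin. Qed.

Let I_rec a : 1 < a -> (I a = a%:E * I (a - 1))%E /\ (I a < +oo)%E.
Proof.
move=> a1; have a0 : 0 < a by lra.
have am0 : 0 < a - 1 by lra.
pose n := (Num.truncn a).+1.
have an : a <= n%:R by apply/ltW; rewrite /n truncnS_gt.
have [] := @half_line_ibp R (1 + 2 ^+ n * n`!%:R) (fun t => a * g (a - 1) t) (g a) (g a).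
- by move=> x _; rewrite mulr_ge0// ltW.
- by move=> x x0; rewrite g_ge0/= g_ub.
- by move=> x; apply: cvgM; [exact: cvg_cst|exact: g_continuous].
- exact: g_continuous.
- by move=> x x0; exact: g_derive.
- by rewrite g0.
- exact: g_cvg0.
- exact: g_cvgy.
have mgE b : measurable_fun (`]0, +oo[ : set R) (EFin \o g b).
  by apply/measurable_EFinP; apply: measurable_funTS; exact: mg.
rewrite -integral_itv_obnd_cbnd; last first.
  by apply/measurable_EFinP/measurable_funTS/measurable_funM => //; exact: mg.
rewrite -integral_itv_obnd_cbnd; last exact: mgE.
move=> h1 h2.
split => //; rewrite /I -h1.
under eq_integral do rewrite EFinM.
rewrite ge0_integralZl//.
- exact: mgE.
- by move=> x _; rewrite lee_fin.
- by rewrite lee_fin ltW.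
Qed.

Let I_fin a : 0 < a -> (I a < +oo)%E.
Proof.
move=> a0; have [] := @I_rec (a + 1); first by lra.
rewrite addrK => -> h; rewrite ltey; apply: contraTneq h => ->.
by rewrite gt0_muley ?ltxx// lte_fin; lra.
Qed.

Let I_gt0 a : 0 < a -> (0 < I a)%E.
Proof.
move=> a0; apply: (@lt_le_trans _ _ (\int[mu]_(t in `[1%R, 2%R]) (expR (- 2))%:E)%E).
  rewrite integral_cst//= lebesgue_measure_itv/= lte_fin ltr1n -EFinD -EFinM lte_fin.
  by rewrite mulr_gt0 ?expR_gt0//; lra.
apply: (@le_trans _ _ (\int[mu]_(t in `[1%R, 2%R]) (g a t)%:E)%E).
  apply: ge0_le_integral => //.
  - by apply/measurable_EFinP; apply: measurable_funTS; exact: mg.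
  - move=> x; rewrite /= in_itv/= => /andP[x1 x2]; rewrite lee_fin /g.
    rewrite -[leLHS]mul1r; apply: ler_pM => //.
      have := @ge0_ler_powR R a (ltW a0) 1 x; rewrite !nnegrE powR1 => h.
      by apply: h; lra.
    by rewrite ler_expR lerN2.
apply: ge0_subset_integral => //.
- by apply/measurable_EFinP; apply: measurable_funTS; exact: mg.
- by move=> x _; rewrite lee_fin.
- by move=> x; rewrite /= !in_itv/= => /andP[x1 x2]; rewrite andbT; lra.
Qed.

Lemma Gamma_gt0 (s : R) : 1 < s -> 0 < Gamma s.
Proof.
move=> s1; have s0 : 0 < s - 1 by lra.
rewrite /Gamma /Rintegral; apply: fine_gt0.
by apply/andP; split; [exact: I_gt0|exact: I_fin].
Qed.

(** The restriction to s > 1 keeps t^(s - 1) continuous at 0; the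
    arguments k + N / 2 with N >= 3 are in this range. *)
Lemma GammaS (s : R) : 1 < s -> Gamma (s + 1) = s * Gamma s.
Proof.
move=> s1; have s0 : 0 < s - 1 by lra.
have [h _] := I_rec s1; have hf := I_fin s0.
transitivity (fine (I s)); first by rewrite /Gamma /Rintegral /I addrK.
by rewrite h fineM// ge0_fin_numE.
Qed.

End gamma_function.

Section normal_moments.
Variable R : realType.
Notation mu := (@lebesgue_measure R).
Variable sigma : R.
Hypothesis sigma_gt0 : 0 < sigma.

Let G := normal_fun 0 sigma.

Let G_ge0 x : 0 <= G x. Proof. exact: normal_fun_ge0. Qed.

Let GE x : G x = expR (- (x ^+ 2 / (2 * sigma ^+ 2))).
Proof. by rewrite /G /normal_fun subr0 mulNr -mulr_natl. Qed.

Let s0 : sigma != 0. Proof. by rewrite gt_eqF. Qed.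

Let dG (x : R) : is_derive x 1 G (- (x / sigma ^+ 2) * G x).
Proof.
rewrite (_ : G = (fun x => expR (- (x ^+ 2 / (2 * sigma ^+ 2))))); last first.
  by apply/funext => y; rewrite GE.
apply: is_derive_eq; rewrite /GRing.scale/= /GRing.scale/=; field.
exact: s0.
Qed.

Let cG k : continuous (fun x : R => x ^+ k * G x).
Proof.
move=> x; apply: cvgM; first exact: exprn_continuous.
apply/differentiable_continuous/derivable1_diffP.
by have [] := dG x.
Qed.

Let C k : R := 2 ^+ k * k`!%:R * expR (sigma ^+ 2 / 2).

Let G_ub k x : 0 <= x -> x ^+ k * G x <= C k * expR (- (x / 2)).
Proof.
move=> x0; have h : G x <= expR (sigma ^+ 2 / 2) * expR (- x).
  rewrite GE -expRD ler_expR.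
  rewrite -subr_ge0 (_ : _ - _ = (x - sigma ^+ 2) ^+ 2 / (2 * sigma ^+ 2)).
    by rewrite divr_ge0// ?sqr_ge0// mulr_ge0// sqr_ge0.
  by field.
apply: (@le_trans _ _ (2 ^+ k * k`!%:R * expR (x / 2) * (expR (sigma ^+ 2 / 2) * expR (- x)))).
  by apply: ler_pM => //; [exact: exprn_ge0|exact: exprn_le_expR].
rewrite (_ : expR (- (x / 2)) = expR (x / 2) * expR (- x)).
  by rewrite /C le_eqVlt; apply/orP; left; apply/eqP; ring.
by rewrite -expRD; congr expR; field.
Qed.

Let G_cvgy k : x ^+ k * G x @[x --> +oo%R] --> (0 : R).
Proof.
apply: (@squeeze_cvgr _ _ _ _ (fun=> 0) (fun t => C k * expR (- (t / 2)))).
- near=> t; rewrite G_ub// andbT mulr_ge0// exprn_ge0//.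
- exact: cvg_cst.
- exact: expR_half_cvg0.
Unshelve. all: by end_near. Qed.

Let half_moment k :
  (\int[mu]_(x in `[0%R, +oo[) (x ^+ k.+2 * G x)%:E =
   (k.+1%:R * sigma ^+ 2)%:E * \int[mu]_(x in `[0%R, +oo[) (x ^+ k * G x)%:E)%E.
Proof.
have s2 : 0 < sigma ^+ 2 by rewrite exprn_gt0.
have i2 : 0 <= (sigma ^+ 2)^-1 by rewrite invr_ge0 ltW.
have mG j c : measurable_fun (`[0%R, +oo[ : set R) (EFin \o (fun x => c * (x ^+ j * G x))).
  apply/measurable_EFinP/measurable_funTS/measurable_funM => //.
  by apply: continuous_measurable_fun; exact: cG.
have [] := @half_line_ibp R (C k.+2 / sigma ^+ 2) (fun t => k.+1%:R * (t ^+ k * G t))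
   (fun t => (sigma ^+ 2)^-1 * (t ^+ k.+2 * G t)) (fun t => t ^+ k.+1 * G t).
- by move=> x x0; rewrite !mulr_ge0// exprn_ge0.
- move=> x x0; apply/andP; split.
    by rewrite mulr_ge0// mulr_ge0// exprn_ge0.
  rewrite [leRHS](_ : _ = (sigma ^+ 2)^-1 * (C k.+2 * expR (- (x / 2)))); last by ring.
  by apply: ler_wpM2l => //; exact: G_ub.
- by apply: continuous_subspaceT => x; apply: cvgM; [exact: cvg_cst|exact: cG].
- by apply: continuous_subspaceT => x; apply: cvgM; [exact: cvg_cst|exact: cG].
- move=> x x0.
  have h1 : is_derive x 1 (fun t : R => t ^+ k.+1) (k.+1%:R * x ^+ k).
    rewrite (_ : (fun t : R => t ^+ k.+1) = (id : R -> R) ^+ k.+1); last first.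
      by apply/funext => t; rewrite exprfctE.
    by apply: is_derive_eq; rewrite /GRing.scale/= mulr1.
  rewrite (_ : _ - _ = x ^+ k.+1 *: (- (x / sigma ^+ 2) * G x) + G x *: (k.+1%:R * x ^+ k)).
    exact: (is_deriveM h1 (dG x)).
  by rewrite /GRing.scale/= !exprS; field.
- by rewrite expr0n mul0r.
- apply: cvg_at_right_filter; have := @cG k.+1 0.
  by rewrite /continuous_at expr0n mul0r.
- exact: G_cvgy.
move=> h _; rewrite EFinM -muleA.
transitivity ((sigma ^+ 2)%:E * \int[mu]_(t in `[0%R, +oo[) ((sigma ^+ 2)^-1 * (t ^+ k.+2 * G t))%:E)%E.
  rewrite -ge0_integralZl//=.
  - by apply: eq_integral => x _; rewrite -EFinM mulrA divff ?mul1r// gt_eqF.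
  - exact: mG.
  - by move=> x; rewrite in_itv/= andbT => x0; rewrite lee_fin mulr_ge0// mulr_ge0// exprn_ge0.
  - by rewrite lee_fin ltW.
rewrite -h [RHS]muleCA; congr (_ * _)%E.
rewrite -ge0_integralZl//=.
- by apply: eq_measurable_fun (mG k 1) => x _ /=; rewrite mul1r.
- by move=> x; rewrite in_itv/= andbT => x0; rewrite lee_fin mulr_ge0 ?exprn_ge0.
Qed.

(** Integrate the derivative of x^(2 k + 1) exp (- x^2 / (2 sigma^2)). *)
Lemma normal_even_moment (k : nat) :
  (\int[mu]_x (x ^+ (k.+1).*2 * normal_pdf 0 sigma x)%:E =
   ((k.*2).+1%:R * sigma ^+ 2)%:E * \int[mu]_x (x ^+ k.*2 * normal_pdf 0 sigma x)%:E)%E.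
Proof.
have pk := normal_peak_ge0 sigma.
have E j : (\int[mu]_x (x ^+ j.*2 * normal_pdf 0 sigma x)%:E =
    2%:E * ((normal_peak sigma)%:E * \int[mu]_(x in `[0%R, +oo[) (x ^+ j.*2 * G x)%:E))%E.
  rewrite ge0_symfun_integralT.
  - congr (_ * _)%E; rewrite -set_itvcy -ge0_integralZl//=.
    + by apply: eq_integral => x _; rewrite normal_pdfE// -EFinM mulrCA.
    + apply/measurable_EFinP/measurable_funTS.
      by apply: continuous_measurable_fun; exact: cG.
    + by move=> x; rewrite in_itv/= andbT => x0; rewrite lee_fin mulr_ge0 ?exprn_ge0.
  - by move=> x; rewrite mulr_ge0 ?normal_pdf_ge0// exprn_even_ge0// odd_double.
  - move=> x; apply: cvgM; first exact: exprn_continuous.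
    exact: continuous_normal_pdf.
  - move=> x /=; rewrite !normal_pdfE// /normal_fun !subr0 sqrrN.
    by rewrite -!mul2n !exprM sqrrN.
by rewrite !E doubleS half_moment !muleA; congr (_ * _)%E; rewrite -!EFinM; congr EFin; ring.
Qed.

Lemma normal_var : (\int[mu]_x (x ^+ 2 * normal_pdf 0 sigma x)%:E = (sigma ^+ 2)%:E)%E.
Proof.
have := normal_even_moment 0; rewrite double0 mul1r => ->.
under eq_integral do rewrite expr0 mul1r.
by rewrite integral_normal_pdf mule1.
Qed.

Lemma normal_kurt :
  (\int[mu]_x (x ^+ 4 * normal_pdf 0 sigma x)%:E = (3 * sigma ^+ 4)%:E)%E.
Proof.
by rewrite (normal_even_moment 1) normal_var -EFinM -mulrA -exprD.
Qed.

End normal_moments.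

(** * The radial eigenfunction of the Laplacian and a polynomial subsolution *)

Section monotone.
Variable R : realType.
Variables (f f' : R -> R) (a b : R).
Hypothesis df : forall x : R, is_derive x 1 f (f' x).

Let dfb (x : R) : derivable f x 1. Proof. by have [] := df x. Qed.
Let cf : {within `[a, b], continuous f}.
Proof.
apply: continuous_subspaceT => x.
exact/differentiable_continuous/derivable1_diffP.
Qed.

Lemma is_derive_nincr : a <= b -> (forall x, a < x < b -> f' x <= 0) -> f b <= f a.
Proof.
move=> ab h; apply: (@ler0_derive1_nincr _ f a b) => //.
by move=> x; rewrite in_itv/= => /h; rewrite derive1E (derive_val (is_derive := df x)).
Qed.

Lemma is_derive_decr : a < b -> (forall x, a < x < b -> f' x < 0) -> f b < f a.
Proof.
move=> ab h; apply: (@ltr0_derive1_decr _ f a b) => //.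
by move=> x; rewrite in_itv/= => /h; rewrite derive1E (derive_val (is_derive := df x)).
Qed.

End monotone.

Section entire_series.
Variable R : realType.

(** Such coefficients define an entire function.  Three successive formal
    derivatives of psi satisfy this bound, which makes psi twice
    differentiable. *)
Definition fact_bounded (c : nat -> R) := forall k, `|c k| <= (k`!%:R)^-1.

Lemma fact_bounded_cvg c x : fact_bounded c -> cvgn (pseries c x).
Proof.
move=> hc; apply: normed_cvg; apply: series_le_cvg (is_cvg_series_exp_coeff `|x|).
- by move=> n /=.
- by move=> n; rewrite exp_coeffE mulr_ge0 ?exprn_ge0// invr_ge0.
- by move=> n; rewrite exp_coeffE /= normrM normrX ler_wpM2r ?exprn_ge0.
Qed.

Lemma fact_bounded_derive c (x : R) : fact_bounded c -> fact_bounded (pseries_diffs c) ->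
    fact_bounded (pseries_diffs (pseries_diffs c)) ->
  is_derive x 1 (fun y => limn (pseries c y)) (limn (pseries (pseries_diffs c) x)).
Proof.
move=> h0 h1 h2; apply: (@pseries_snd_diffs _ _ (`|x| + 1)); try exact: fact_bounded_cvg.
by rewrite [ltRHS]ger0_norm ?ltrDl// addr_ge0.
Qed.

End entire_series.

Section radial_eigenfunction.
Variables (R : realType) (N : nat).
Hypothesis N_ge3 : (3 <= N)%N.

(** The coefficients of the power series solution of
    N u' + 2 s u'' = - u / 2 with u(0) = 1, i.e. of
    s |-> Gamma (N / 2) (sqrt s / 2)^(1 - N / 2) J_(N / 2 - 1) (sqrt s). *)
Definition psi_coef (k : nat) : R :=
  \prod_(i < k) - (2 * i.+1%:R * (N%:R + i.*2%:R))^-1.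

Lemma psi_coef0 : psi_coef 0 = 1. Proof. by rewrite /psi_coef big_ord0. Qed.

Lemma psi_coefS k : psi_coef k.+1 = - psi_coef k / (2 * k.+1%:R * (N%:R + k.*2%:R)).
Proof. by rewrite /psi_coef big_ord_recr/= mulrN mulNr. Qed.

Local Lemma Npos k : 0 < (N%:R + k.*2%:R : R).
Proof. by rewrite -natrD ltr0n addn_gt0 (leq_trans _ N_ge3). Qed.

Lemma psi_coef_rec k :
  k.+1%:R * (N%:R + k.*2%:R) * psi_coef k.+1 = - (psi_coef k / 2).
Proof.
rewrite psi_coefS; have := Npos k => h.
by field; rewrite ?gt_eqF ?ltr0n.
Qed.

Local Lemma psi_coef_le k : `|psi_coef k| <= (k`!%:R)^-1 * (k`!%:R)^-1.
Proof.
elim: k => [|k ih]; first by rewrite psi_coef0 fact0 normr1 invr1 mulr1.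
have np := Npos k.
rewrite psi_coefS normrM normrN normfV [`|2 * _ * _|]ger0_norm; last first.
  by rewrite mulr_ge0// ltW.
rewrite ler_pdivrMr; last by rewrite mulr_gt0.
apply: (le_trans ih); rewrite factS natrM !invfM.
have f0 : (0 : R) < (k`!%:R)^-1 by rewrite invr_gt0 ltr0n fact_gt0.
have k0 : (0 : R) < k.+1%:R by [].
rewrite (_ : _ * (2 * _ * _) = (k`!%:R)^-1 * (k`!%:R)^-1 * (2 * (N%:R + k.*2%:R) / k.+1%:R)); last first.
  have E (a b c : R) : b != 0 -> b^-1 * a * (b^-1 * a) * (2 * b * c) = a * a * (2 * c / b).
    by move=> b0; field.
  by apply: E; rewrite gt_eqF.
apply: ler_peMr; first by rewrite mulr_ge0 ?ltW.
rewrite ler_pdivlMr// mul1r -natrD -natrM ler_nat.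
by lia.
Qed.

Lemma psi_coef_bounded : [/\ fact_bounded psi_coef,
  fact_bounded (pseries_diffs psi_coef),
  fact_bounded (pseries_diffs (pseries_diffs psi_coef)) &
  fact_bounded (pseries_diffs (pseries_diffs (pseries_diffs psi_coef)))].
Proof.
have f0 k : (0 : R) < k`!%:R by rewrite ltr0n fact_gt0.
have h (j k : nat) : (j <= 3)%N -> (((k + j)`!%:R : R)^-1 <= (k`!%:R)^-1).
  move=> _; rewrite lef_pV2 ?posrE// ler_nat leq_fact//; exact: leq_addr.
have h0 : fact_bounded psi_coef.
  move=> k; apply: (le_trans (psi_coef_le k)); rewrite ler_piMr ?invr_ge0// invf_le1//.
  by rewrite ler1n fact_gt0.
have Df k : ((k.+1)`!%:R : R)^-1 = (k.+1%:R)^-1 * (k`!%:R)^-1.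
  by rewrite factS natrM invfM.
have E m k : (m <= 3)%N -> `|iter m (@pseries_diffs R) psi_coef k| <=
     (((k + m)`!%:R : R)^-1 * (k`!%:R)^-1).
  elim: m k => [|m ih] k m3; first by rewrite addn0; exact: psi_coef_le.
  rewrite iterS /pseries_diffs normrM ger0_norm//.
  apply: (@le_trans _ _ (k.+1%:R * (((k.+1 + m)`!%:R : R)^-1 * ((k.+1)`!%:R)^-1))).
    by rewrite ler_wpM2l//; exact/ih/ltnW.
  by rewrite (Df k) addSnnS mulrCA mulVKf// pnatr_eq0.
have B m : (m <= 3)%N -> fact_bounded (iter m (@pseries_diffs R) psi_coef).
  move=> m3 k; apply: (le_trans (E _ _ m3)); rewrite ler_piMl ?invr_ge0// invf_le1//.
  by rewrite ler1n fact_gt0.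
split; [exact: (B 0)|exact: (B 1%N)|exact: (B 2%N)|exact: (B 3%N)].
Qed.

Definition psi (s : R) := limn (pseries psi_coef s).
Definition psi1 (s : R) := limn (pseries (pseries_diffs psi_coef) s).
Definition psi2 (s : R) := limn (pseries (pseries_diffs (pseries_diffs psi_coef)) s).

Lemma is_derive_psi (s : R) : is_derive s 1 psi (psi1 s).
Proof. by have [? ? ? ?] := psi_coef_bounded; exact: fact_bounded_derive. Qed.

Lemma is_derive_psi1 (s : R) : is_derive s 1 psi1 (psi2 s).
Proof. by have [? ? ? ?] := psi_coef_bounded; exact: fact_bounded_derive. Qed.

Lemma psi_cvg s : pseries psi_coef s @ \oo --> psi s.
Proof. by have [? _ _ _] := psi_coef_bounded; exact: fact_bounded_cvg. Qed.

Lemma psi_0 : psi 0 = 1.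
Proof.
apply: cvg_lim => //; rewrite -(cvg_shiftS (pseries psi_coef 0)).
apply: cvg_near_cst; near=> n.
rewrite /pseries /series/= big_nat_recl// expr0 mulr1 psi_coef0 big1 ?addr0// => i _.
by rewrite expr0n mulr0.
Unshelve. all: by end_near. Qed.

(** This says that Delta u = - u for u (x) = psi (|x|^2). *)
Lemma psi_ode s : N%:R * psi1 s + 2 * s * psi2 s = - (psi s / 2).
Proof.
have [h0 h1 h2 _] := psi_coef_bounded.
have c0 := @fact_bounded_cvg _ _ s h0.
have c1 := @fact_bounded_cvg _ _ s h1.
have c2 := @fact_bounded_cvg _ _ s h2.
pose u (c : nat -> R) n := pseries c s n.
have E n : N%:R * u (pseries_diffs psi_coef) n.+1 +
    2 * s * u (pseries_diffs (pseries_diffs psi_coef)) n = - (u psi_coef n.+1 / 2).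
  rewrite /u /pseries /series/=; elim: n => [|n ih].
    rewrite !big_nat1 big_nil !expr0 !mulr1 mulr0 addr0.
    by have := psi_coef_rec 0; rewrite addr0 mul1r /pseries_diffs mul1r.
  rewrite big_nat_recr//= [X in _ + _ * X]big_nat_recr//= [in RHS]big_nat_recr//=.
  rewrite !mulrDr addrACA ih [in RHS]mulrDl opprD; congr (_ + _).
  have := psi_coef_rec n.+1; rewrite doubleS /pseries_diffs => h.
  transitivity (n.+2%:R * (N%:R + (n.*2).+2%:R) * psi_coef n.+2 * s ^+ n.+1).
    by rewrite (_ : (n.*2).+2 = (n.+1 * 2)%N) ?natrM ?exprS -?natr1; [ring|lia].
  by rewrite h; ring.
have l0 : u psi_coef n.+1 @[n --> \oo] --> psi s by rewrite (cvg_shiftS (u psi_coef)).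
have l1 : u (pseries_diffs psi_coef) n.+1 @[n --> \oo] --> psi1 s.
  by rewrite (cvg_shiftS (u (pseries_diffs psi_coef))).
have l2 : u (pseries_diffs (pseries_diffs psi_coef)) n @[n --> \oo] --> psi2 s by [].
have L : - (u psi_coef n.+1 / 2) @[n --> \oo] --> N%:R * psi1 s + 2 * s * psi2 s.
  under eq_fun do rewrite -E.
  by apply: cvgD; apply: cvgMr.
apply: (cvg_unique _ L) => //.
by apply: cvgN; apply: cvgMl.
Qed.

(** Up to a constant, the flux of the gradient of x |-> psi (|x|^2) through the
    sphere of radius r; by the equation its derivative is a multiple of
    r^(N - 1) psi (r^2). *)
Let flux (r : R) := r ^+ N * psi1 (r ^+ 2).

Local Lemma is_derive_psi_sqr (r : R) : is_derive r 1 (fun r => psi (r ^+ 2)) (2 * r * psi1 (r ^+ 2)).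
Proof.
have h := is_derive_psi (r ^+ 2).
have h2 : is_derive r 1 (fun r : R => r ^+ 2) (2 * r).
  by apply: is_derive_eq; rewrite /GRing.scale/= !mulr1; ring.
have := @is_derive1_comp _ psi (fun r : R => r ^+ 2) r _ _ h h2; rewrite /comp/= => H.
by rewrite mulrC; exact: H.
Qed.

Local Lemma is_derive_exprS (k : nat) (r : R) : is_derive r 1 (fun r : R => r ^+ k.+1) (k.+1%:R * r ^+ k).
Proof.
rewrite (_ : (fun t : R => t ^+ k.+1) = (id : R -> R) ^+ k.+1); last first.
  by apply/funext => t; rewrite exprfctE.
by apply: is_derive_eq; rewrite /GRing.scale/= mulr1.
Qed.

Local Lemma is_derive_exprN (r : R) : is_derive r 1 (fun r : R => r ^+ N) (N%:R * r ^+ N.-1).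
Proof. by have := is_derive_exprS N.-1 r; rewrite prednK// (leq_trans _ N_ge3). Qed.

Local Lemma exprN_pred (r : R) : r ^+ N = r * r ^+ N.-1.
Proof. by rewrite -exprS prednK// (leq_trans _ N_ge3). Qed.

Local Lemma is_derive_flux (r : R) : is_derive r 1 flux (- (r ^+ N.-1 * psi (r ^+ 2) / 2)).
Proof.
have h := is_derive_psi1 (r ^+ 2).
have h2 : is_derive r 1 (fun r : R => r ^+ 2) (2 * r).
  by apply: is_derive_eq; rewrite /GRing.scale/= !mulr1; ring.
have := @is_derive1_comp _ psi1 (fun r : R => r ^+ 2) r _ _ h h2; rewrite /comp/= => H.
have := is_deriveM (is_derive_exprN r) H; rewrite /GRing.scale/= => H2.
rewrite (_ : - _ = r ^+ N * (psi2 (r ^+ 2) * (2 * r)) + psi1 (r ^+ 2) * (N%:R * r ^+ N.-1)); first exact: H2.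
have -> : - (r ^+ N.-1 * psi (r ^+ 2) / 2) = r ^+ N.-1 * (- (psi (r ^+ 2) / 2)) by ring.
by rewrite -psi_ode exprN_pred; ring.
Qed.

Local Lemma flux0 : flux 0 = 0.
Proof. by rewrite /flux expr0n gtn_eqF ?mul0r// (leq_trans _ N_ge3). Qed.

Lemma psi1_le0 (r0 : R) : 0 < r0 -> (forall r, 0 < r < r0 -> 0 <= psi (r ^+ 2)) ->
  psi1 (r0 ^+ 2) <= 0.
Proof.
move=> r00 h; have := @is_derive_nincr R flux _ 0 r0 is_derive_flux (ltW r00).
rewrite flux0 => H; rewrite -(pmulr_rle0 _ (exprn_gt0 N r00)); apply: H => x x0.
rewrite oppr_le0 !mulr_ge0 ?h//; first by rewrite exprn_ge0// ltW//; case/andP: x0.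
Qed.

Lemma psi1_lt0 (r0 : R) : 0 < r0 -> (forall r, 0 < r < r0 -> 0 < psi (r ^+ 2)) ->
  psi1 (r0 ^+ 2) < 0.
Proof.
move=> r00 h; have := @is_derive_decr R flux _ 0 r0 is_derive_flux r00.
rewrite flux0 => H; rewrite -(pmulr_rlt0 _ (exprn_gt0 N r00)); apply: H => x x0.
by rewrite oppr_lt0 !mulr_gt0 ?h// ?invr_gt0// exprn_gt0//; case/andP: x0.
Qed.

Lemma psi_nincr (r0 r s : R) : (forall x, 0 < x < r0 -> 0 <= psi (x ^+ 2)) ->
  0 <= r -> r <= s -> s <= r0 -> psi (s ^+ 2) <= psi (r ^+ 2).
Proof.
move=> h r00 rs sr.
apply: (@is_derive_nincr R (fun r => psi (r ^+ 2)) _ r s is_derive_psi_sqr rs) => x /andP[rx xs].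
have x0 : 0 < x by exact: le_lt_trans rx.
rewrite pmulr_rle0 ?mulr_gt0//; apply: psi1_le0 => // y /andP[y0 yx]; apply: h.
by rewrite y0 (lt_le_trans (lt_trans yx xs)).
Qed.

(** Assume that psi > 0.  Then psi is decreasing, since its flux is negative.
    Compare it with v (x) = s0 - |x|^2, which vanishes on the sphere
    |x|^2 = s0.  By Green's formula the integral of psi (Delta v + v) over the
    ball |x|^2 < s0 is a negative multiple of the integral of psi over the
    sphere, hence negative.  On the other hand Delta v + v = s0 - 2 N - |x|^2
    changes sign from positive to negative at |x|^2 = s0 - 2 N, so that, as psi
    is decreasing, replacing psi by the constant c = psi (s0 - 2 N) can only
    decrease this integral.  But the integral of Delta v + v is positive as
    soon as s0 > N (N + 2). *)
Lemma psi_has_nonpos : exists2 s : R, 0 <= s & psi s <= 0.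
Proof.
apply: contrapT => H.
have pos s : 0 <= s -> 0 < psi s.
  by move=> s0; rewrite ltNge; apply/negP => h; apply: H; exists s.
have pos2 (x : R) : 0 < psi (x ^+ 2) by rewrite pos ?sqr_ge0.
have N0 : (3 : R) <= N%:R by rewrite ler_nat.
pose s0 : R := N%:R * (N%:R + 2) + 1.
have s00 : 0 < s0 by rewrite /s0; nra.
have ss0 : 0 <= s0 - 2 * N%:R by rewrite /s0; nra.
pose r0 := Num.sqrt s0.
have r00 : 0 < r0 by rewrite sqrtr_gt0.
have r02 : r0 ^+ 2 = s0 by rewrite sqr_sqrtr// ltW.
pose c := psi (s0 - 2 * N%:R).
(* A primitive of r^(N - 1) (psi (r^2) - c) (Delta v + v) / (- 2); this
   function is nonpositive because both factors change sign at r^2 = s0 - 2 N. *)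
pose M (r : R) := (s0 - r ^+ 2) * flux r + r ^+ N * psi (r ^+ 2)
   - c * (r ^+ N * ((1 - s0 / (2 * N%:R)) + (2 * (N%:R + 2))^-1 * r ^+ 2)).
have dM (r : R) : is_derive r 1 M
    (r ^+ N.-1 * (psi (r ^+ 2) - c) * (N%:R - (s0 - r ^+ 2) / 2)).
  have h2 : is_derive r 1 (fun r : R => r ^+ 2) (2 * r).
    by apply: is_derive_eq; rewrite /GRing.scale/= !mulr1; ring.
  have a1 := is_deriveB (is_derive_cst s0 r 1) h2.
  have a2 := is_deriveM a1 (is_derive_flux r).
  have a3 := is_deriveM (is_derive_exprN r) (is_derive_psi_sqr r).
  have a4 : is_derive r 1 (fun r : R => (1 - s0 / (2 * N%:R)) + (2 * (N%:R + 2))^-1 * r ^+ 2) (0 + (2 * (N%:R + 2))^-1 * (2 * r)).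
    exact: (is_deriveD (is_derive_cst _ r 1) (is_deriveZ _ h2)).
  have a5 := is_deriveM (is_derive_exprN r) a4.
  have a6 := is_deriveZ c a5.
  have a7 := is_deriveB (is_deriveD a2 a3) a6.
  move: a7; rewrite /GRing.scale/= => a7.
  rewrite [X in is_derive _ _ _ X](_ : _ = (s0 - r ^+ 2) * (- (r ^+ N.-1 * psi (r ^+ 2) / 2)) +
        flux r * (0 - 2 * r) +
        (r ^+ N * (2 * r * psi1 (r ^+ 2)) + psi (r ^+ 2) * (N%:R * r ^+ N.-1)) -
        c * (r ^+ N * (0 + (2 * (N%:R + 2))^-1 * (2 * r)) +
           (1 - s0 / (2 * N%:R) + (2 * (N%:R + 2))^-1 * r ^+ 2) * (N%:R * r ^+ N.-1))); first exact: a7.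
  rewrite /flux exprN_pred; field.
  by apply/andP; split; lra.
have := @is_derive_nincr R M _ 0 r0 dM (ltW r00).
have N1 : (0 < N)%N by rewrite (leq_trans _ N_ge3).
have -> : M 0 = 0 by rewrite /M flux0 [0 ^+ N]expr0n gtn_eqF// !mul0r; ring.
rewrite leNgt => /(_ _)/negP H2; apply: H2; last first.
  rewrite /M r02 subrr mul0r add0r.
  rewrite (_ : _ - _ = r0 ^+ N * (psi s0 - c * (1 - s0 / (2 * N%:R) + (2 * (N%:R + 2))^-1 * s0))); last by ring.
  rewrite mulr_gt0 ?exprn_gt0// subr_gt0.
  apply: (@lt_trans _ _ 0); last by rewrite pos// ltW.
  rewrite pmulr_rlt0; last by rewrite pos.
  rewrite (_ : _ + _ = - (1 / (N%:R * (N%:R + 2)))).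
    by rewrite oppr_lt0 divr_gt0// mulr_gt0; lra.
  by rewrite /s0; field; apply/andP; split; lra.
move=> r /andP[rp rr0].
rewrite -mulrA; apply: mulr_ge0_le0; first by rewrite exprn_ge0// ltW.
pose t := Num.sqrt (s0 - 2 * N%:R).
have t2 : t ^+ 2 = s0 - 2 * N%:R by rewrite sqr_sqrtr.
have t0 : 0 <= t by rewrite sqrtr_ge0.
have h x : 0 < x < Num.max r t -> 0 <= psi (x ^+ 2) by move=> _; exact: ltW.
have [rt|tr] := leP r t.
  have p1 : c <= psi (r ^+ 2).
    by rewrite /c -t2; have := psi_nincr h (ltW rp) rt; rewrite le_max lexx orbT; exact.
  have r2 : r ^+ 2 <= t ^+ 2 by rewrite ler_sqr ?nnegrE// ltW.
  by apply: mulr_ge0_le0; [lra|rewrite t2 in r2; lra].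
have p1 : psi (r ^+ 2) <= c.
  by rewrite /c -t2; have := psi_nincr h t0 (ltW tr); rewrite le_max lexx; exact.
have r2 : t ^+ 2 <= r ^+ 2 by rewrite ler_sqr ?nnegrE// ltW.
by apply: mulr_le0_ge0; [lra|rewrite t2 in r2; lra].
Qed.

Let mu : R := (N%:R - 2) / 2.

(** By induction on k, through the recurrence of the Gamma function. *)
Lemma bessel_coef k : (-1) ^+ k / (k`!%:R * Gamma (mu + k%:R + 1)) =
  psi_coef k * 4 ^+ k / Gamma (N%:R / 2).
Proof.
have N3 : (3 : R) <= N%:R by rewrite ler_nat.
elim: k => [|k ih].
  rewrite psi_coef0 !expr0 fact0 !mul1r addr0; congr ((Gamma _)^-1).
  by rewrite /mu; field.
have k0 : (0 : R) <= k%:R by [].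
have h : 1 < mu + k%:R + 1 by rewrite /mu; lra.
have -> : mu + k.+1%:R + 1 = (mu + k%:R + 1) + 1 by rewrite -natr1; ring.
rewrite GammaS// factS natrM.
have G1 := Gamma_gt0 h.
have G2 : 0 < Gamma (N%:R / 2 : R) by apply: Gamma_gt0; lra.
have f0 : (0 : R) < k`!%:R by rewrite ltr0n fact_gt0.
transitivity (((-1) ^+ k / (k`!%:R * Gamma (mu + k%:R + 1))) * (- (k.+1%:R * (mu + k%:R + 1))^-1)).
  have E (a g f l m : R) : f != 0 -> g != 0 -> l != 0 -> m != 0 ->
    (-1) * a / (l * f * (m * g)) = (a / (f * g)) * (- (l * m)^-1).
    by move=> ? ? ? ?; field; do ?[apply/andP; split].
  move: (Gamma (mu + k%:R + 1)) G1 => g G1.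
  by rewrite exprS; apply: E; rewrite gt_eqF// (lt_trans ltr01 h).
rewrite ih psi_coefS exprS -muln2 natrM.
have k1 : (0 : R) < k.+1%:R by [].
have np : 0 < N%:R + k%:R * 2 :> R.
  by apply: ltr_wpDr; [exact: mulr_ge0|exact: lt_le_trans N3].
have E (c p g l n m : R) : g != 0 -> l != 0 -> n + m * 2 != 0 ->
    c * p / g * - (l * ((n - 2) / 2 + m + 1))^-1 =
    - c / (2 * l * (n + m * 2)) * (4 * p) / g.
  move=> ? ? h2; field; do ?[apply/andP; split] => //.
by apply: E; rewrite gt_eqF.
Qed.

Lemma besselJ_psi (x : R) : 0 < x ->
  besselJ mu x = (x / 2) `^ mu / Gamma (N%:R / 2) * psi (x ^+ 2).
Proof.
move=> x0; rewrite /besselJ.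
pose A := (x / 2) `^ mu / Gamma (N%:R / 2).
have x2 : 0 < x / 2 by rewrite divr_gt0.
rewrite (_ : (fun k => _) = A *: (fun k => psi_coef k * (x ^+ 2) ^+ k)).
  by rewrite lim_seriesZ//; exact: psi_cvg.
apply/funext => k; rewrite bessel_coef /GRing.scale/= /A powRD; last first.
  by apply/implyP => _; rewrite gt_eqF.
rewrite powR_mulrn ?ltW//.
have -> : (x / 2) ^+ k.*2 = (x ^+ 2) ^+ k / 4 ^+ k.
  rewrite -muln2 mulnC exprM [(x / 2) ^+ 2]expr_div_n expr_div_n.
  by congr (_ / _ ^+ k); ring.
have E (a c p g y : R) : p != 0 -> g != 0 -> c * p / g * (a * (y / p)) = a / g * (c * y).
  by move=> ? ?; field; apply/andP.
apply: E; first by rewrite expf_neq0.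
by rewrite gt_eqF// Gamma_gt0// ltr_pdivlMr// mul1r ltr_nat.
Qed.

Lemma psi_sqr_continuous : continuous (fun r : R => psi (r ^+ 2)).
Proof.
move=> x; apply/differentiable_continuous/derivable1_diffP.
by have [] := is_derive_psi_sqr x.
Qed.

(** The least zero of r |-> psi (r^2) exists by [psi_has_nonpos], so that
    [bessel_j1] is not its default value. *)
Lemma bessel_j1_zero : let j := bessel_j1 mu in
  [/\ 0 < j, psi (j ^+ 2) = 0 & forall r, 0 <= r < j -> 0 < psi (r ^+ 2)].
Proof.
have G2 : 0 < Gamma (N%:R / 2 : R).
  by apply: Gamma_gt0; rewrite ltr_pdivlMr// mul1r ltr_nat.
have J0 x : 0 < x -> (besselJ mu x == 0) = (psi (x ^+ 2) == 0).
  move=> x0; rewrite besselJ_psi// mulf_eq0 gt_eqF//.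
  by rewrite divr_gt0// powR_gt0// divr_gt0.
have psir0 : psi (0 ^+ 2) = 1 by rewrite expr0n /= psi_0.
have IV r : 0 <= r -> psi (r ^+ 2) <= 0 -> exists2 z, 0 <= z <= r & psi (z ^+ 2) = 0.
  move=> r0 hr.
  have [|z] := @IVT _ (fun r => psi (r ^+ 2)) 0 r 0 r0 (continuous_subspaceT psi_sqr_continuous).
    by rewrite psir0 ge_min hr orbT le_max ler01.
  by rewrite in_itv/=; exists z.
have [j [j0 pj hj]] : exists j, [/\ 0 < j, psi (j ^+ 2) = 0 &
    forall x, 0 < x < j -> psi (x ^+ 2) != 0].
  pose Z := [set x : R | 0 <= x /\ psi (x ^+ 2) = 0].
  have Z0 : Z !=set0.
    have [s s0 ps] := psi_has_nonpos.
    have [||z /andP[z0 _] pz] := IV (Num.sqrt s); rewrite ?sqrtr_ge0 ?sqr_sqrtr//.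
    by exists z.
  have lZ : has_lbound Z by exists 0 => x [].
  have hZ : has_inf Z by [].
  have i0 : 0 <= inf Z by apply: lb_le_inf => // x [].
  have pj : psi (inf Z ^+ 2) = 0.
    apply: contrapT => /eqP pn.
    have := @psi_sqr_continuous (inf Z) => /cvgrPdist_lt/(_ `|psi (inf Z ^+ 2)|).
    rewrite normr_gt0 => /(_ pn)[e /= e0 He].
    have [z [z0 pz] zl] := inf_adherent e0 hZ.
    have zi : inf Z <= z by exact: ge_inf.
    have := He z; rewrite /ball/= pz subr0 ltxx => H; apply/(notF (H _)).
    by rewrite distrC ger0_norm ?subr_ge0// ltrBlDl.
  exists (inf Z); split => //.
    rewrite lt_neqAle i0 andbT; apply/eqP => i00.
    by move: pj; rewrite -i00 psir0 => /eqP; rewrite oner_eq0.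
  move=> x /andP[x0 xi]; apply/eqP => px.
  have : inf Z <= x by apply: ge_inf => //; split => //; exact: ltW.
  by rewrite leNgt xi.
have fz : first_positive_zero (besselJ mu) (bessel_j1 mu).
  rewrite /bessel_j1; apply: (@xgetPex _ 0 [set j | first_positive_zero (besselJ mu) j]).
  exists j; split => //; first by apply/eqP; rewrite J0// pj.
  by move=> x /andP[x0 xj]; rewrite J0// hj// x0.
move: fz; set k := bessel_j1 mu => -[k0 /eqP]; rewrite J0// => /eqP pk hk.
split => // r /andP[r0 rk]; rewrite ltNge; apply/negP => pr.
have [z /andP[z0 zr] pz] := IV _ r0 pr.
have zp : 0 < z.
  rewrite lt_neqAle z0 andbT; apply/eqP => zz.
  by move: pz; rewrite -zz psir0 => /eqP; rewrite oner_eq0.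
have := hk z; rewrite zp (le_lt_trans zr rk) => /(_ isT).
by rewrite J0// pz eqxx.
Qed.

(** Otherwise psi would have a minimum at j^2, against [psi1_lt0]. *)
Lemma psi_neg_after_zero (rho : R) : bessel_j1 mu ^+ 2 < rho ->
  exists2 s, bessel_j1 mu ^+ 2 < s < rho & psi s < 0.
Proof.
have [] := bessel_j1_zero; set j := bessel_j1 mu => j0 pj hj jr.
apply: contrapT => H.
have j20 : 0 < j ^+ 2 by rewrite exprn_gt0.
have dj : is_derive (j ^+ 2) 1 psi 0.
  apply: (@derive1_at_min _ psi 0 rho) => //.
  - by rewrite ltW// (lt_trans j20).
  - by move=> t _; have [] := is_derive_psi t.
  - by rewrite in_itv/= j20.
  - move=> t; rewrite in_itv/= => /andP[t0 tr]; rewrite pj.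
    have [tj|jt] := ltP t (j ^+ 2).
      have st : Num.sqrt t < j by rewrite -(ger0_norm (ltW j0)) -sqrtr_sqr ltr_sqrt.
      have /hj : 0 <= Num.sqrt t < j by rewrite sqrtr_ge0.
      by rewrite sqr_sqrtr ?(ltW t0)// => /ltW.
    move: jt; rewrite le_eqVlt => /predU1P[<-|jt]; first by rewrite pj.
    by rewrite leNgt; apply/negP => ht; apply: H; exists t => //; rewrite jt.
have := @psi1_lt0 j j0; have h2 := is_derive_psi (j ^+ 2).
rewrite -(derive_val (is_derive := h2)) (derive_val (is_derive := dj)) ltxx => h3.
by apply/notF/h3 => r /andP[r0 rj]; apply: hj; rewrite ltW.
Qed.

(** Half of the Laplacian of x |-> p (|x|^2) is (radial_half_laplacian p) (|x|^2). *)
Definition radial_half_laplacian (p : {poly R}) : {poly R} :=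
  N%:R *: p^`() + 2 *: ('X * p^`(2)).

(** Let S be a partial sum of psi.  The recurrence of the coefficients makes
    L S + S / 2 equal to half of the last term of S, which is small on
    [0, rho1] for a partial sum that is long enough.  Adding a constant e to S
    adds e / 2 to L S + S / 2, and leaves S + e negative at rho1 provided that
    e < - psi (rho1). *)
Lemma polynomial_subsolution (rho : R) : bessel_j1 mu ^+ 2 < rho ->
  exists (p : {poly R}) (rho1 rho2 delta : R),
  [/\ 0 < rho1 < rho, rho1 < rho2, 0 < delta, 0 < p.[0] &
   (forall s, rho1 <= s <= rho2 -> p.[s] <= 0) /\
   (forall s, 0 <= s <= rho1 -> delta <= (radial_half_laplacian p).[s] + p.[s] / 2)].
Proof.
move=> /psi_neg_after_zero[rho1 /andP[jr r1r] pr].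
have [j0 _ _] := bessel_j1_zero.
have r10 : 0 < rho1 by apply: lt_trans jr; rewrite exprn_gt0.
pose e := - psi rho1 / 2; have e0 : 0 < e by rewrite divr_gt0// oppr_gt0.
have cS := @psi_cvg rho1.
have ct : psi_coef n * rho1 ^+ n @[n --> \oo] --> (0 : R).
  by apply: cvg_series_cvg_0; apply/cvg_ex; exists (psi rho1).
have [n [hn1 hn2]] : exists n, `|psi rho1 - pseries psi_coef rho1 n.+1| < e / 2 /\
    `|psi_coef n * rho1 ^+ n| < e / 2.
  have e2 : 0 < e / 2 by rewrite divr_gt0.
  have [n1 _ h1] : \forall n \near \oo, `|psi rho1 - pseries psi_coef rho1 n| < e / 2.
    by move/cvgrPdist_lt : cS; apply.
  have [n2 _ h2] : \forall n \near \oo, `|psi_coef n * rho1 ^+ n| < e / 2.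
    by move/cvgr0Pnorm_lt : ct; apply.
  exists (maxn n1 n2); split; last by apply: h2 => /=; exact: leq_maxr.
  by apply: h1 => /=; apply: leqW; exact: leq_maxl.
pose p : {poly R} := \poly_(i < n.+1) psi_coef i + e%:P.
have pE s : p.[s] = pseries psi_coef s n.+1 + e.
  rewrite /p hornerD hornerC horner_poly /pseries /series/= big_mkord//.
have pr1 : p.[rho1] < 0.
  rewrite pE; move: hn1; rewrite ltr_distl => /andP[h1 h2].
  by move: h1; rewrite /e => h1; lra.
have [rho2 r12 hp] : exists2 rho2, rho1 < rho2 & forall s, rho1 <= s <= rho2 -> p.[s] <= 0.
  have := @continuous_horner R p rho1 => /cvgrPdist_lt/(_ (- p.[rho1])).
  rewrite oppr_gt0 => /(_ pr1)[d /= d0 hd].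
  exists (rho1 + d / 2); first by rewrite ltrDl divr_gt0.
  move=> s /andP[s1 s2].
  have : `|p.[rho1] - p.[s]| < - p.[rho1].
    by apply: hd; rewrite /= distrC ger0_norm ?subr_ge0//; lra.
  by rewrite ltr_norml => /andP[h1 h2]; lra.
exists p, rho1, rho2, (e / 4); split => //.
- by rewrite r10.
- by rewrite divr_gt0.
- rewrite pE /pseries /series/= big_nat_recl// expr0 mulr1 psi_coef0 big1 ?addr0.
    by rewrite addr_gt0.
  by move=> i _; rewrite expr0n mulr0.
split => // s /andP[s0 sr].
have -> : (radial_half_laplacian p).[s] + p.[s] / 2 = psi_coef n * s ^+ n / 2 + e / 2.
  rewrite pE mulrDl addrA; congr (_ + _).
  rewrite /radial_half_laplacian.
  have -> : N%:R *: p^`() + 2 *: ('X * p^`(2)) =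
    - (2^-1 *: \poly_(i < n) psi_coef i).
    have pc k : p`_k.+1 = if (k < n)%N then psi_coef k.+1 else 0.
      by rewrite /p coefD coefC /= addr0 coef_poly ltnS.
    have d1 k : p^`()`_k = p`_k.+1 *+ k.+1 by rewrite coef_deriv.
    have d2 k : p^`(2)`_k = p`_k.+2 *+ (k.+2 * k.+1).
      by rewrite coef_derivn !add2n !ffactnS ffactn0 muln1.
    apply/polyP => i; rewrite coefD !coefZ coefXM d1 d2 coefN coefZ coef_poly pc.
    case: i => [|i] /=.
      rewrite mulr0 addr0; case: ifP => _; last by rewrite mul0rn !mulr0 oppr0.
      by have := psi_coef_rec 0; rewrite double0 addr0 mul1r => ->; rewrite mulrC.
    rewrite pc; case: ifP => _; last by rewrite !mul0rn !mulr0 oppr0 addr0.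
    rewrite -[_ *+ i.+2]mulr_natr.
    transitivity (i.+2%:R * (N%:R + (i.+1).*2%:R) * psi_coef i.+2).
      by rewrite -muln2 -mulr_natr !natrM; ring.
    by rewrite psi_coef_rec; ring.
  rewrite hornerN hornerZ horner_poly /pseries /series/= big_nat_recr//= big_mkord.
  by field.
have : `|psi_coef n * s ^+ n| <= `|psi_coef n * rho1 ^+ n|.
  rewrite !normrM; apply: ler_wpM2l => //; rewrite !normrX (ger0_norm s0) (ger0_norm (ltW r10)).
  by apply: lerXn2r => //; rewrite nnegrE ltW.
move=> /le_lt_trans/(_ hn2); rewrite ltr_norml => /andP[h1 h2]; lra.
Qed.

End radial_eigenfunction.

(** * A one-sided Taylor estimate for the cut-off subsolution *)

Section poly_taylor.
Variable R : realFieldType.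

Lemma poly_bounded (p : {poly R}) (M : R) :
  exists2 C : R, 0 <= C & forall s, `|s| <= M -> `|p.[s]| <= C.
Proof.
elim/poly_ind: p => [|p c [C C0 hC]].
  by exists 0 => // s _; rewrite horner0 normr0.
have [M0|M0] := leP 0 M; last first.
  by exists 0 => // s sM; have := le_trans (normr_ge0 s) sM; rewrite leNgt M0.
exists (C * M + `|c|); first by rewrite addr_ge0// mulr_ge0.
move=> s sM; rewrite hornerMXaddC (le_trans (ler_normD _ _))// lerD2r normrM.
by apply: ler_pM => //; exact: hC.
Qed.

(** By induction on p = q X + c. *)
Lemma poly_taylor2 (p : {poly R}) (M D : R) : 0 <= M -> 0 <= D ->
  exists2 K : R, 0 <= K & forall s d, `|s| <= M -> `|d| <= D ->
    `|p.[s + d] - (p.[s] + p^`().[s] * d + p^`()^`().[s] / 2 * d ^+ 2)| <= K * `|d| ^+ 3.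
Proof.
move=> M0 D0; elim/poly_ind: p => [|p c [K K0 hK]].
  exists 0 => // s d _ _; rewrite !deriv0 !horner0 !mul0r !addr0 subrr normr0.
  by rewrite ?mul0r.
have [C C0 hC] := poly_bounded p^`()^`() M.
exists ((M + D) * K + C / 2); first by rewrite addr_ge0 ?mulr_ge0 ?addr_ge0 ?invr_ge0.
move=> s d sM dD.
have -> : (p * 'X + c%:P).[s + d] - ((p * 'X + c%:P).[s] + (p * 'X + c%:P)^`().[s] * d
    + (p * 'X + c%:P)^`()^`().[s] / 2 * d ^+ 2) =
  (s + d) * (p.[s + d] - (p.[s] + p^`().[s] * d + p^`()^`().[s] / 2 * d ^+ 2)) +
  p^`()^`().[s] / 2 * d ^+ 3.
  rewrite !(derivD, derivC, derivM, derivX, addr0, mulr1).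
  rewrite !(hornerD, hornerM, hornerX, hornerC).
  by field.
apply: (le_trans (ler_normD _ _)); rewrite [leRHS]mulrDl; apply: lerD.
  rewrite normrM -[leRHS]mulrA; apply: ler_pM => //; last exact: hK.
  by apply: (le_trans (ler_normD _ _)); exact: lerD.
rewrite normrM [`|d ^+ 3|]normrX normrM [`|2^-1|]ger0_norm ?invr_ge0//.
by apply: ler_wpM2r; rewrite ?exprn_ge0//; apply: ler_wpM2r; rewrite ?invr_ge0//; exact: hC.
Qed.

End poly_taylor.

Section cutoff.
Variable R : realType.
Variables (p : {poly R}) (rho1 rho2 : R).
Hypothesis rho1_gt0 : 0 < rho1.
Hypothesis rho12 : rho1 < rho2.
Hypothesis p_le0 : forall s, rho1 <= s <= rho2 -> p.[s] <= 0.

(** Far beyond rho1 the polynomial p may become positive again; the condition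
    s <= rho1 discards these values. *)
Definition cutoff (s : R) : R := if s <= rho1 then Num.max p.[s] 0 else 0.

Lemma cutoff_ge0 s : 0 <= cutoff s.
Proof. by rewrite /cutoff; case: ifP => // _; rewrite le_max lexx orbT. Qed.

Lemma cutoff_gt0 s : 0 < cutoff s -> s <= rho1 /\ cutoff s = p.[s].
Proof.
rewrite /cutoff; case: ifP => [_|]; last by rewrite ltxx.
by case: (leP p.[s] 0) => // _; rewrite ltxx.
Qed.

Lemma cutoff_ub : exists2 C : R, 0 < C & forall s, 0 <= s -> cutoff s <= C.
Proof.
have [C C0 hC] := poly_bounded p rho1; exists (C + 1); first by rewrite ltr_wpDl.
move=> s s0; rewrite /cutoff; case: ifP => [sr|_]; last by rewrite addr_ge0.
rewrite ge_max addr_ge0// andbT (le_trans (ler_norm _))// (le_trans (hC _ _)) ?lerDl//.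
by rewrite ger0_norm.
Qed.

Lemma cutoff_ge_poly s : s <= rho2 -> p.[s] <= cutoff s.
Proof.
move=> sr; rewrite /cutoff; case: ifP => [_|/negbT]; first by rewrite le_max lexx.
by rewrite -ltNge => rs; apply: p_le0; rewrite ltW.
Qed.

(** For small t this is Taylor's formula for p, because p <= cutoff up to rho2
    and the increment of s does not reach beyond rho2.  For t bounded below,
    cutoff >= 0 and all the other terms are at most a multiple of t^3. *)
Lemma cutoff_taylor (c : R) : 0 <= c -> exists2 K : R, 0 <= K &
  forall s a t, 0 <= s <= rho1 -> 0 <= t -> `|a| <= c * t ->
    p.[s] + p^`().[s] * (2 * a + t ^+ 2) + 2 * p^`()^`().[s] * a ^+ 2 - K * t ^+ 3
    <= cutoff (s + (2 * a + t ^+ 2)).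
Proof.
move=> c0.
pose gap := rho2 - rho1; have g0 : 0 < gap by rewrite subr_gt0.
(* For t <= tau the increment 2 a + t^2 is at most rho2 - rho1. *)
pose tau := Num.min 1 (gap / (2 * c + 1)).
have c1 : 0 < 2 * c + 1 by rewrite ltr_wpDl// mulr_ge0.
have tau0 : 0 < tau by rewrite lt_min ltr01 divr_gt0.
have [M0 M00 hM0] := poly_bounded p rho1.
have [M1 M10 hM1] := poly_bounded p^`() rho1.
have [M2 M20 hM2] := poly_bounded p^`()^`() rho1.
have [K1 K10 hK1] := poly_taylor2 p (ltW rho1_gt0) (ltW g0).
pose L := 2 * c + 1.
pose Ka := K1 * L ^+ 3 + M2 * (2 * c + 1).
pose Kb := M0 / tau ^+ 3 + M1 * (2 * c / tau ^+ 2 + 1 / tau) + 2 * M2 * (c ^+ 2 / tau).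
have Ka0 : 0 <= Ka by rewrite addr_ge0// mulr_ge0 ?exprn_ge0// ltW.
have Kb0 : 0 <= Kb.
  by rewrite !addr_ge0 ?mulr_ge0 ?addr_ge0 ?mulr_ge0 ?invr_ge0 ?exprn_ge0// ltW.
exists (Ka + Kb); first by rewrite addr_ge0.
move=> s a t /andP[s0 sr] t0 at_.
have sn : `|s| <= rho1 by rewrite ger0_norm.
have t30 : 0 <= t ^+ 3 by rewrite exprn_ge0.
set d := 2 * a + t ^+ 2.
have [tt|tt] := leP t tau.
  have t1 : t <= 1 by rewrite (le_trans tt)// ge_min lexx.
  have tg : L * t <= gap.
    apply: (@le_trans _ _ (L * tau)); first by rewrite ler_wpM2l// ltW.
    by rewrite -ler_pdivlMl// mulrC ge_min lexx orbT.
  have t2 : t ^+ 2 <= t by rewrite expr2 ler_piMl.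
  have dL : `|d| <= L * t.
    rewrite (le_trans (ler_normD _ _))// normrM ger0_norm// (ger0_norm (exprn_ge0 2 t0)).
    rewrite (_ : L * t = 2 * (c * t) + t); last by rewrite /L; ring.
    by apply: lerD => //; rewrite ler_wpM2l.
  have dg : `|d| <= gap by exact: le_trans tg.
  have sd : s + d <= rho2.
    by have := ler_norm d; move: dg; rewrite /gap; lra.
  apply: le_trans (cutoff_ge_poly sd).
  have := hK1 _ _ sn dg; rewrite ler_norml => /andP[h1 _].
  have d3 : `|d| ^+ 3 <= L ^+ 3 * t ^+ 3.
    by rewrite -exprMn; apply: lerXn2r => //; rewrite ?nnegrE// mulr_ge0// ltW.
  have h2 : `|p^`()^`().[s] / 2 * d ^+ 2 - 2 * p^`()^`().[s] * a ^+ 2| <=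
      M2 * (2 * c + 1) * t ^+ 3.
    rewrite (_ : _ - _ = p^`()^`().[s] * (2 * a * t ^+ 2 + t ^+ 4 / 2)); last by rewrite /d; field.
    rewrite normrM -[leRHS]mulrA; apply: ler_pM => //; first exact: hM2.
    rewrite [leRHS]mulrDl mul1r; apply: (le_trans (ler_normD _ _)); apply: lerD.
      rewrite normrM normrX (ger0_norm t0) normrM (ger0_norm (_ : 0 <= 2 :> R))//.
      rewrite (_ : 2 * c * t ^+ 3 = 2 * (c * t) * t ^+ 2); last by ring.
      by apply: ler_wpM2r; rewrite ?exprn_ge0//; apply: ler_wpM2l.
    rewrite ger0_norm ?mulr_ge0 ?exprn_ge0 ?invr_ge0// (exprS _ 3).
    by rewrite -[leRHS]mul1r mulrAC ler_wpM2r//; lra.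
  move: h2; rewrite ler_norml => /andP[h2 _].
  have h3 : K1 * `|d| ^+ 3 <= K1 * (L ^+ 3 * t ^+ 3) by rewrite ler_wpM2l.
  have h4 : 0 <= Kb * t ^+ 3 by rewrite mulr_ge0.
  have -> : (Ka + Kb) * t ^+ 3 = K1 * (L ^+ 3 * t ^+ 3) + M2 * (2 * c + 1) * t ^+ 3 + Kb * t ^+ 3.
    by rewrite /Ka; ring.
  by lra.
apply: le_trans (cutoff_ge0 _).
have q1 : 1 <= t / tau by rewrite ler_pdivlMr// mul1r ltW.
have h0 : p.[s] <= M0 / tau ^+ 3 * t ^+ 3.
  apply: (le_trans (ler_norm _)); apply: (le_trans (hM0 _ sn)).
  by rewrite mulrAC -mulrA -expr_div_n ler_peMr// exprn_ege1.
have q2 : 1 <= (t / tau) ^+ 2 by rewrite exprn_ege1.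
have h1 : p^`().[s] * d <= M1 * (2 * c / tau ^+ 2 + 1 / tau) * t ^+ 3.
  apply: (le_trans (ler_norm _)); rewrite normrM -[leRHS]mulrA; apply: ler_pM => //; first exact: hM1.
  apply: (le_trans (ler_normD _ _)); rewrite [leRHS]mulrDl; apply: lerD.
    rewrite normrM ger0_norm// -!mulrA ler_wpM2l//.
    rewrite (_ : c * _ = c * t * ((t / tau) ^+ 2)); last by field; rewrite gt_eqF.
    by apply: (le_trans at_); rewrite ler_peMr// mulr_ge0.
  rewrite ger0_norm ?exprn_ge0// (_ : 1 / tau * _ = t ^+ 2 * (t / tau)); last by field; rewrite gt_eqF.
  by rewrite ler_peMr// exprn_ge0.
have h2 : 2 * p^`()^`().[s] * a ^+ 2 <= 2 * M2 * (c ^+ 2 / tau) * t ^+ 3.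
  apply: (le_trans (ler_norm _)); rewrite normrM [`|a ^+ 2|]normrX normrM (ger0_norm (_ : 0 <= 2 :> R))//.
  rewrite (_ : 2 * M2 * (c ^+ 2 / tau) * t ^+ 3 = 2 * M2 * ((c * t) ^+ 2 * (t / tau))); last by field; rewrite gt_eqF.
  apply: ler_pM => //; rewrite ?mulr_ge0//; first by rewrite ler_wpM2l// hM2.
  apply: (@le_trans _ _ ((c * t) ^+ 2)); last by rewrite ler_peMr// exprn_ge0// mulr_ge0.
  by apply: lerXn2r => //; rewrite ?nnegrE// mulr_ge0.
have h4 : 0 <= Ka * t ^+ 3 by rewrite mulr_ge0.
rewrite subr_le0 [leRHS]mulrDl; apply: (@le_trans _ _ (Kb * t ^+ 3)); last by rewrite lerDr.
rewrite [leRHS](_ : _ = M0 / tau ^+ 3 * t ^+ 3 + M1 * (2 * c / tau ^+ 2 + 1 / tau) * t ^+ 3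
  + 2 * M2 * (c ^+ 2 / tau) * t ^+ 3); last by rewrite /Kb; ring.
by apply: lerD => //; apply: lerD.
Qed.

End cutoff.

Section radial.
Variables (R : realType) (N : nat).

Definition normsq (x : 'rV[R]_N) : R := \sum_(i < N) x ord0 i ^+ 2.
Definition dot (x y : 'rV[R]_N) : R := \sum_(i < N) x ord0 i * y ord0 i.

Lemma normsq_ge0 x : 0 <= normsq x.
Proof. by apply: sumr_ge0 => i _; rewrite sqr_ge0. Qed.

Lemma normsqD x y : normsq (x + y) = normsq x + (2 * dot x y + normsq y).
Proof.
rewrite /normsq /dot mulr_sumr -!big_split/=; apply: eq_bigr => i _.
by rewrite mxE; ring.
Qed.

Lemma dot_sqr_le x y : dot x y ^+ 2 <= normsq x * normsq y.
Proof.
have [y0|y0] := eqVneq (normsq y) 0.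
  have yi i : y ord0 i = 0.
    move: y0; rewrite /normsq => /eqP; rewrite psumr_eq0; last by move=> j _; rewrite sqr_ge0.
    by move=> /allP/(_ i); rewrite mem_index_enum sqrf_eq0 => /(_ isT)/eqP.
  by rewrite y0 mulr0 /dot big1 ?expr0n// => i _; rewrite yi mulr0.
have yp : 0 < normsq y by rewrite lt_neqAle eq_sym y0 normsq_ge0.
have : 0 <= normsq (x + (- (dot x y / normsq y)) *: y) by exact: normsq_ge0.
rewrite normsqD.
have -> : dot x (- (dot x y / normsq y) *: y) = - (dot x y ^+ 2 / normsq y).
  rewrite {1}/dot (eq_bigr (fun i => - (dot x y / normsq y) * (x ord0 i * y ord0 i))).
    by rewrite -mulr_sumr -/(dot x y); ring.
  by move=> i _; rewrite mxE; ring.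
have -> : normsq (- (dot x y / normsq y) *: y) = dot x y ^+ 2 / normsq y.
  rewrite {1}/normsq (eq_bigr (fun i => (dot x y / normsq y) ^+ 2 * (y ord0 i ^+ 2))).
    by rewrite -mulr_sumr -/(normsq y); field.
  by move=> i _; rewrite mxE; ring.
move=> h; rewrite -ler_pdivrMr//; lra.
Qed.

(** Cauchy-Schwarz with the vector (1, ..., 1). *)
Lemma normsq_sqr_le x : normsq x ^+ 2 <= N%:R * \sum_(i < N) x ord0 i ^+ 4.
Proof.
have := dot_sqr_le (\row_i 1) (\row_i (x ord0 i ^+ 2)).
rewrite /dot /normsq.
under eq_bigr do rewrite !mxE mul1r.
under [X in _ <= X * _]eq_bigr do rewrite mxE expr1n.
under [X in _ <= _ * X]eq_bigr do rewrite mxE -exprM.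
by rewrite sumr_const card_ord.
Qed.

Variables (p : {poly R}) (rho1 rho2 : R).
Hypothesis rho1_gt0 : 0 < rho1.
Hypothesis rho12 : rho1 < rho2.
Hypothesis p_le0 : forall s, rho1 <= s <= rho2 -> p.[s] <= 0.

(** The cubic error is split as
    |z|^3 <= eta |z|^2 + |z|^4 / eta
    so that the mean of the error only involves even
    moments of z; eta will be the standard deviation of z. *)
Lemma radial_cutoff_taylor (k : R) : 0 < k -> exists2 K : R, 0 <= K &
  forall (eta : R) (y z : 'rV[R]_N), 0 < eta -> k * normsq y <= rho1 ->
    let s := k * normsq y in
    p.[s] + k * p^`().[s] * (2 * dot y z + normsq z)
      + 2 * k ^+ 2 * p^`()^`().[s] * dot y z ^+ 2
      - K * (eta * normsq z + eta^-1 * \sum_(i < N) z ord0 i ^+ 4)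
    <= cutoff p rho1 (k * normsq (y + z)).
Proof.
move=> k0; have [K K0 hK] := cutoff_taylor rho1_gt0 rho12 p_le0 (sqrtr_ge0 rho1).
exists (K * (k + k ^+ 2 * N%:R)).
  by rewrite mulr_ge0// addr_ge0 ?mulr_ge0 ?exprn_ge0// ltW.
move=> eta y z eta0 sr /=; set s := k * normsq y.
have kz : 0 <= k * normsq z by rewrite mulr_ge0 ?normsq_ge0// ltW.
pose t := Num.sqrt (k * normsq z).
have t2 : t ^+ 2 = k * normsq z by rewrite sqr_sqrtr.
have t0 : 0 <= t by rewrite sqrtr_ge0.
have s0 : 0 <= s by rewrite mulr_ge0 ?normsq_ge0// ltW.
have a_t : `|k * dot y z| <= Num.sqrt rho1 * t.
  rewrite -sqrtr_sqr /t -(sqrtrM _ (ltW rho1_gt0)) ler_sqrt; last by rewrite mulr_ge0// ltW.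
  apply: (@le_trans _ _ (s * (k * normsq z))); last by rewrite ler_wpM2r.
  rewrite /s (_ : _ * _ * _ = k ^+ 2 * (normsq y * normsq z)); last by ring.
  by rewrite exprMn; apply: ler_wpM2l; [rewrite exprn_ge0 ?ltW|exact: dot_sqr_le].
have := hK s (k * dot y z) t; rewrite s0 sr => /(_ isT t0 a_t).
have -> : s + (2 * (k * dot y z) + t ^+ 2) = k * normsq (y + z).
  by rewrite normsqD t2 /s; ring.
apply: le_trans.
have t3 : t ^+ 3 <= eta * t ^+ 2 + eta^-1 * t ^+ 4.
  have h1 : 0 <= eta^-1 * t ^+ 2 * (t - eta) ^+ 2.
    by apply: mulr_ge0; [apply: mulr_ge0; rewrite ?sqr_ge0// invr_ge0 ltW|exact: sqr_ge0].
  have h2 : 0 <= t ^+ 3 by rewrite exprn_ge0.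
  have h3 : eta^-1 * t ^+ 2 * (t - eta) ^+ 2 = eta * t ^+ 2 + eta^-1 * t ^+ 4 - 2 * t ^+ 3.
    by field; rewrite gt_eqF.
  by lra.
have t4 : t ^+ 4 <= k ^+ 2 * (N%:R * \sum_(i < N) z ord0 i ^+ 4).
  have -> : t ^+ 4 = k ^+ 2 * normsq z ^+ 2 by rewrite -exprMn -t2; ring.
  by apply: ler_wpM2l; [rewrite exprn_ge0 ?ltW|exact: normsq_sqr_le].
have S0 : 0 <= \sum_(i < N) z ord0 i ^+ 4.
  by apply: sumr_ge0 => i _; rewrite exprn_even_ge0.
have ie0 : 0 <= eta^-1 by rewrite invr_ge0 ltW.
have t5 : K * t ^+ 3 <= K * (k + k ^+ 2 * N%:R) * (eta * normsq z + eta^-1 * \sum_(i < N) z ord0 i ^+ 4).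
  rewrite -mulrA; apply: ler_wpM2l => //; apply: (le_trans t3); rewrite t2.
  apply: (@le_trans _ _ (eta * (k * normsq z) + eta^-1 * (k ^+ 2 * (N%:R * \sum_(i < N) z ord0 i ^+ 4)))).
    by apply: lerD => //; apply: ler_wpM2l.
  have h1 : 0 <= k ^+ 2 * N%:R * (eta * normsq z).
    by apply: mulr_ge0; apply: mulr_ge0; rewrite ?normsq_ge0 ?exprn_ge0// ltW.
  have h2 : 0 <= k * (eta^-1 * \sum_(i < N) z ord0 i ^+ 4).
    by apply: mulr_ge0; [exact: ltW|apply: mulr_ge0].
  rewrite [leRHS](_ : _ = eta * (k * normsq z) +
    eta^-1 * (k ^+ 2 * (N%:R * \sum_(i < N) z ord0 i ^+ 4)) +
    (k ^+ 2 * N%:R * (eta * normsq z) + k * (eta^-1 * \sum_(i < N) z ord0 i ^+ 4))).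
    by rewrite lerDl addr_ge0.
  by ring.
rewrite t2; apply: lerD; last by rewrite lerN2.
rewrite le_eqVlt; apply/orP; left; apply/eqP; ring.
Qed.

End radial.

(** * Integration against a Gaussian density, and independence *)

Section normal_density_integral.
Variables (R : realType) (m s : R).
Notation mu := (@lebesgue_measure R).
Local Open Scope ereal_scope.
Import HBNNSimple.

Let pdf := normal_pdf m s.
Let pdf_ge0 x : 0 <= (pdf x)%:E. Proof. by rewrite lee_fin normal_pdf_ge0. Qed.
Let mpdf : measurable_fun setT (EFin \o pdf).
Proof. by apply/measurable_EFinP; exact: measurable_normal_pdf. Qed.

Let indic_case (E : set (measurableTypeR R)) : measurable E ->
  \int[normal_prob m s]_x (\1_E x)%:E = \int[mu]_x ((\1_E x)%:E * (pdf x)%:E).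
Proof.
move=> mE; rewrite integral_indic//= setIT /normal_prob [LHS]integral_mkcond/=.
apply: eq_integral => x _; rewrite patchE indicE.
by case: ifPn => _; rewrite ?mul1e ?mul0e.
Qed.

Let nnsfun_case (f : {nnsfun measurableTypeR R >-> R}) :
  \int[normal_prob m s]_x (f x)%:E = \int[mu]_x ((f x)%:E * (pdf x)%:E).
Proof.
under [LHS]eq_integral do rewrite fimfunE -fsumEFin//.
rewrite [LHS]ge0_integral_fsum//; last 2 first.
  - by move=> r; exact/measurable_EFinP/measurableT_comp.
  - by move=> n x _; rewrite EFinM nnfun_muleindic_ge0.
under [RHS]eq_integral.
  move=> x xD; rewrite fimfunE -fsumEFin// muleC ge0_mule_fsumr; last first.
    by move=> r; rewrite EFinM nnfun_muleindic_ge0.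
  over.
rewrite [RHS]ge0_integral_fsum//; last 2 first.
  - move=> r; apply: emeasurable_funM => //.
    by apply/measurable_EFinP; do 2 apply/measurableT_comp => //.
  - by move=> n x _; rewrite mule_ge0// EFinM nnfun_muleindic_ge0.
apply: eq_fsbigr => r _.
rewrite integralZl_indic_nnsfun//= indic_case//.
have [r0|r0] := leP 0%R r; last first.
  have E0 : f @^-1` [set r] = set0.
    by rewrite -subset0 => x /= fx; have : (0 <= f x)%R by []; rewrite fx leNgt r0.
  rewrite E0; under eq_integral do rewrite indic0 mul0e.
  rewrite integral0 mule0; under [RHS]eq_integral do rewrite indic0 mulr0 mule0.
  by rewrite integral0.
rewrite -ge0_integralZl//.
- by apply: eq_integral => x _; rewrite EFinM muleA muleC.
- by apply: emeasurable_funM => //; exact/measurable_EFinP.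
- by move=> x _; rewrite mule_ge0.
Qed.

(** From indicator functions to nonnegative measurable functions by
    monotone approximation. *)
Lemma ge0_integral_normal_prob (f : measurableTypeR R -> \bar R) :
  measurable_fun setT f -> (forall x, 0 <= f x) ->
  \int[normal_prob m s]_x f x = \int[mu]_x (f x * (normal_pdf m s x)%:E).
Proof.
move=> mf f0; rewrite -/pdf.
pose f_ := nnsfun_approx measurableT mf.
transitivity (lim (\int[normal_prob m s]_x (f_ n x)%:E @[n --> \oo])).
  rewrite -monotone_convergence//=.
  - apply: eq_integral => ? /[!inE] xD; apply/esym/cvg_lim => //=.
    exact: cvg_nnsfun_approx.
  - by move=> n; exact/measurable_EFinP/measurable_funTS.
  - by move=> n ? _; rewrite lee_fin.
  - by move=> ? _ ? ? mn; rewrite lee_fin; exact/lefP/nd_nnsfun_approx.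
rewrite [RHS](_ : _ = lim (\int[mu]_x ((f_ n x)%:E * (pdf x)%:E) @[n --> \oo])); last first.
  rewrite -monotone_convergence//=.
  - apply: eq_integral => x _; apply/esym/cvg_lim => //.
    by apply: cvgeZr => //; exact: cvg_nnsfun_approx.
  - by move=> n; apply: emeasurable_funM => //; exact/measurable_EFinP.
  - by move=> n x _; apply: mule_ge0 => //; rewrite lee_fin.
  - by move=> x _ ? ? mn; rewrite lee_wpmul2r// lee_fin; exact/lefP/nd_nnsfun_approx.
by apply: congr_lim; apply/funext => n /=; exact: nnsfun_case.
Qed.

End normal_density_integral.

Section independence.
Context d (T : measurableType d) (R : realType) (P : probability T R).
Local Open Scope ereal_scope.

(** For a fixed F, the events that are independent of F form a lambda-system. *)
Lemma indep_sigma_left (C1 C2 : set (set T)) :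
  setI_closed C1 -> C1 `<=` measurable -> C2 `<=` measurable ->
  (forall E F, C1 E -> C2 F -> P (E `&` F) = P E * P F) ->
  forall E F, <<s C1>> E -> C2 F -> P (E `&` F) = P E * P F.
Proof.
move=> IC1 mC1 mC2 h E F sE CF.
pose H := [set E | measurable E /\ P (E `&` F) = P E * P F].
have mF := mC2 _ CF.
have fP A : measurable A -> P A \is a fin_num by move=> mA; exact: fin_num_measure.
suff : H E by case.
apply: (@lambda_system_subset _ C1 IC1 setT H) => //; last first.
  by move=> A CA; split; [exact: mC1|exact: h].
split => //.
- by split => //; rewrite setTI probability_setT mul1e.
- move=> A B BA [mA hA] [mB hB]; split; first exact: measurableD.
  have mAF : measurable (A `&` F) by exact: measurableI.
  have mBF : measurable (B `&` F) by exact: measurableI.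
  have -> : (A `\` B) `&` F = (A `&` F) `\` (B `&` F).
    by apply/seteqP; split => x /=; tauto.
  rewrite measureD//; last by rewrite -ge0_fin_numE// fP.
  have -> : (A `&` F) `&` (B `&` F) = B `&` F.
    by apply/seteqP; split => x /=; have := BA x; tauto.
  transitivity (P A * P F - P B * P F); first by rewrite -hA -hB.
  rewrite -muleBl ?fP// ?fin_num_adde_defr ?fP//; congr (_ * _).
  by rewrite measureD// ?(setIidr BA)// -ge0_fin_numE// fP.
- move=> A ndA hA; have mA i : measurable (A i) by have [] := hA i.
  have mU : measurable (\bigcup_i A i) by exact: bigcup_measurable.
  split => //.
  have c1 : P (A n) @[n --> \oo] --> P (\bigcup_n A n) by exact: nondecreasing_cvg_mu.
  have c2 : P (A n `&` F) @[n --> \oo] --> P (\bigcup_n (A n `&` F)).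
    apply: nondecreasing_cvg_mu.
    + by move=> n; exact: measurableI.
    + by apply: bigcup_measurable => n _; exact: measurableI.
    + by move=> a b ab; apply/subsetPset; apply: setSI; apply/subsetPset; exact: ndA.
  have e : (fun n => P (A n `&` F)) = (fun n => P (A n) * P F).
    by apply/funext => n; have [] := hA n.
  rewrite e in c2; rewrite setI_bigcupl; apply: (cvg_unique _ c2) => //.
  by apply: cvgeZr => //; exact: fP.
Qed.

Lemma indep_sigma (C1 C2 : set (set T)) :
  setI_closed C1 -> setI_closed C2 -> C1 `<=` measurable -> C2 `<=` measurable ->
  (forall E F, C1 E -> C2 F -> P (E `&` F) = P E * P F) ->
  forall E F, <<s C1>> E -> <<s C2>> F -> P (E `&` F) = P E * P F.
Proof.
move=> I1 I2 m1 m2 h E F sE sF.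
have mS C : C `<=` measurable -> <<s C>> `<=` (@measurable _ T).
  move=> mC; apply: smallest_sub => //; exact: sigma_algebra_measurable.
rewrite setIC muleC; apply: (@indep_sigma_left C2 <<s C1>>) => //.
- exact: mS.
- move=> A B CA sB; rewrite setIC muleC; apply: (@indep_sigma_left C1 C2) => //.
Qed.

Definition indep_fun (f g : T -> R) := forall A B : set R, measurable A ->
  measurable B -> P (f @^-1` A `&` g @^-1` B) = P (f @^-1` A) * P (g @^-1` B).

Lemma indep_fun_comp f g (u v : R -> R) : measurable_fun setT u ->
  measurable_fun setT v -> indep_fun f g -> indep_fun (u \o f) (v \o g).
Proof.
move=> mu mv h A B mA mB; apply: (h (u @^-1` A) (v @^-1` B)).
- by rewrite -[X in measurable X]setTI; exact: mu.
- by rewrite -[X in measurable X]setTI; exact: mv.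
Qed.

(** The law of the pair is the product of the laws, as they agree on
    rectangles; Tonelli's theorem then separates the variables.  The maxima
    with 0 in the proof extend the integrand to a nonnegative function of the
    whole plane. *)
Lemma indep_ge0_integralM (f g : T -> R) :
  measurable_fun setT f -> measurable_fun setT g -> indep_fun f g ->
  (forall x, 0 <= f x)%R -> (forall x, 0 <= g x)%R ->
  \int[P]_x (f x * g x)%:E = \int[P]_x (f x)%:E * \int[P]_x (g x)%:E.
Proof.
move=> mf mg h f0 g0.
pose F : {RV P >-> R} := HB.pack f (isMeasurableFun.Build _ _ _ _ f mf).
pose G : {RV P >-> R} := HB.pack g (isMeasurableFun.Build _ _ _ _ g mg).
pose X (w : T) := (f w, g w).
have mX : measurable_fun setT X by exact: measurable_fun_pair.
pose k (z : R * R) : \bar R := (Num.max z.1 0 * Num.max z.2 0)%:E.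
have mk : measurable_fun setT k.
  apply/measurable_EFinP; apply: measurable_funM; apply: measurable_maxr => //.
have k0 z : 0 <= k z by rewrite lee_fin mulr_ge0// le_max lexx orbT.
transitivity (\int[pushforward P X]_z k z).
  rewrite ge0_integral_pushforward//=.
  by apply: eq_integral => x _; rewrite /k/= !max_l.
transitivity (\int[distribution P F \x distribution P G]_z k z).
  apply: eq_measure_integral => A mA _; apply/esym.
  apply: (product_measure_unique (m' := pushforward P X)) => //.
rewrite fubini_tonelli1//=.
under eq_integral => x _.
  rewrite /fubini_F /k/=.
  under eq_integral do rewrite EFinM.
  rewrite ge0_integralZl//=; last 3 first.
  - by apply/measurable_EFinP; exact: measurable_maxr.
  - by move=> y _; rewrite lee_fin le_max lexx orbT.
  - by rewrite lee_fin le_max lexx orbT.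
  over.
rewrite ge0_integralZr//=; last 3 first.
- by apply/measurable_EFinP; exact: measurable_maxr.
- by move=> y _; rewrite lee_fin le_max lexx orbT.
- by apply: integral_ge0 => y _; rewrite lee_fin le_max lexx orbT.
congr (_ * _).
- rewrite ge0_integral_distribution//=.
  + by apply: eq_integral => x _; rewrite max_l.
  + by apply/measurable_EFinP; exact: measurable_maxr.
  + by move=> y; rewrite lee_fin le_max lexx orbT.
- rewrite ge0_integral_distribution//=.
  + by apply: eq_integral => x _; rewrite max_l.
  + by apply/measurable_EFinP; exact: measurable_maxr.
  + by move=> y; rewrite lee_fin le_max lexx orbT.
Qed.

Lemma indep_integrableM (f g : T -> R) : indep_fun f g ->
  P.-integrable setT (EFin \o f) -> P.-integrable setT (EFin \o g) ->
  P.-integrable setT (EFin \o (fun x => f x * g x)%R).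
Proof.
move=> h If Ig.
have mf : measurable_fun setT f by apply/measurable_EFinP; exact: measurable_int If.
have mg : measurable_fun setT g by apply/measurable_EFinP; exact: measurable_int Ig.
have mn : measurable_fun setT (@Num.norm R R) by exact: normr_measurable.
apply/integrableP; split; first by apply/measurable_EFinP; exact: measurable_funM.
under eq_integral do rewrite /= normrM.
rewrite (indep_ge0_integralM (f := fun x => `|f x|%R) (g := fun x => `|g x|%R))//; last 3 first.
- exact: measurableT_comp.
- exact: measurableT_comp.
- exact: (indep_fun_comp mn mn h).
apply: lte_mul_pinfty.
- by apply: integral_ge0 => x _.
- rewrite ge0_fin_numE; last by apply: integral_ge0 => x _.
  by have /integrableP[_] := If.
- by have /integrableP[_] := Ig.
Qed.

Lemma indep_RintegralM (f g : T -> R) : indep_fun f g ->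
  P.-integrable setT (EFin \o f) -> P.-integrable setT (EFin \o g) ->
  (\int[P]_x (f x * g x) = (\int[P]_x f x) * (\int[P]_x g x))%R.
Proof.
move=> h If Ig.
have mf : measurable_fun setT f by apply/measurable_EFinP; exact: measurable_int If.
have mg : measurable_fun setT g by apply/measurable_EFinP; exact: measurable_int Ig.
pose pp (x : R) := Num.max x 0%R; pose nn (x : R) := Num.max (- x)%R 0%R.
have mpp : measurable_fun setT pp by exact: measurable_maxr.
have mnn : measurable_fun setT nn.
  by apply: measurable_maxr => //.
have pp0 x : (0 <= pp x)%R by rewrite le_max lexx orbT.
have nn0 x : (0 <= nn x)%R by rewrite le_max lexx orbT.
have pn x : (x = pp x - nn x)%R.
  rewrite /pp /nn; case: (leP x 0%R) => x0; last by rewrite max_r ?subr0// oppr_le0 ltW.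
  by rewrite max_l ?oppr_ge0// opprK add0r.
have ppn x : (`|pp x| <= `|x|)%R.
  by rewrite ger0_norm// ge_max ler_norm normr_ge0.
have nnn x : (`|nn x| <= `|x|)%R.
  by rewrite ger0_norm// ge_max -[X in (_ <= `|X|)%R]opprK normrN ler_norm normr_ge0.
have Ic (u : R -> R) (k : T -> R) : measurable_fun setT u -> (forall x, `|u x| <= `|x|)%R ->
    P.-integrable setT (EFin \o k) -> P.-integrable setT (EFin \o (u \o k)).
  move=> mu hu Ik; have mk := measurable_int _ Ik; apply: le_integrable Ik => //.
  - apply/measurable_EFinP; apply: measurableT_comp => //.
    exact/measurable_EFinP.
  - by move=> x _; rewrite /= lee_fin.
have base (u v : R -> R) : measurable_fun setT u -> measurable_fun setT v ->
   (forall x, `|u x| <= `|x|)%R -> (forall x, `|v x| <= `|x|)%R ->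
   (forall x, 0 <= u x)%R -> (forall x, 0 <= v x)%R ->
   P.-integrable setT (EFin \o (fun x => (u (f x) * v (g x))%R)) /\
   (\int[P]_x (u (f x) * v (g x)) = (\int[P]_x (u (f x))) * (\int[P]_x (v (g x))))%R.
  move=> mu mv hu hv u0 v0; have h2 := indep_fun_comp mu mv h.
  have Iu := Ic _ _ mu hu If; have Iv := Ic _ _ mv hv Ig.
  split; first exact: indep_integrableM.
  have := indep_ge0_integralM (measurableT_comp mu mf) (measurableT_comp mv mg) h2.
  rewrite /Rintegral => -> //; [|by move=> x; exact: u0|by move=> x; exact: v0].
  by rewrite fineM//; exact: integrable_fin_num.
have [i1 e1] := base _ _ mpp mpp ppn ppn pp0 pp0.
have [i2 e2] := base _ _ mpp mnn ppn nnn pp0 nn0.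
have [i3 e3] := base _ _ mnn mpp nnn ppn nn0 pp0.
have [i4 e4] := base _ _ mnn mnn nnn nnn nn0 nn0.
have Efg (k : T -> R) : P.-integrable setT (EFin \o k) ->
   (\int[P]_x k x = \int[P]_x pp (k x) - \int[P]_x nn (k x))%R.
  move=> Ik; rewrite -RintegralB//; [|exact: (Ic pp)|exact: (Ic nn)].
  by apply: eq_Rintegral => x _; exact: pn.
rewrite (Efg f If) (Efg g Ig).
rewrite (_ : (\int[P]_x (f x * g x))%R = (\int[P]_x ((pp (f x) * pp (g x) - pp (f x) * nn (g x))
   - (nn (f x) * pp (g x) - nn (f x) * nn (g x))))%R); last first.
  by apply: eq_Rintegral => x _; rewrite {1}(pn (f x)) {1}(pn (g x)); ring.
rewrite RintegralB//; [|exact: (integrableB _ i1 i2)|exact: (integrableB _ i3 i4)].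
rewrite RintegralB// RintegralB// e1 e2 e3 e4; ring.
Qed.

End independence.

(** * Gaussian vectors independent of the past *)

Section coordinates.
Variables (R : realType) (N : nat).

Lemma borelRn_coord_measurable (i : 'I_N) :
  measurable_fun [set: borelRn R N] (fun x : borelRn R N => x ord0 i).
Proof.
apply: (measurability _ (RGenOpens.measurableE R)).
move=> _ [_ [a [b ->] <-]]; rewrite setTI; apply: sub_sigma_algebra.
by apply: open_comp; [move=> x _; exact: coord_continuous|exact: interval_open].
Qed.

Lemma coord_event_measurable d (T : measurableType d) (Z : T -> 'rV[R]_N) (A : 'I_N -> set R) :
  (forall i, measurable_fun [set: T] (fun w => Z w ord0 i)) -> (forall i, measurable (A i)) ->
  measurable [set w | forall i, A i (Z w ord0 i)].
Proof.
move=> mZ mA; rewrite [X in measurable X](_ : _ = \bigcap_(i in [set: 'I_N]) ((fun w => Z w ord0 i) @^-1` A i)).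
  apply: fin_bigcap_measurable => // i _.
  by rewrite -[X in measurable X]setTI; exact: mZ.
by apply/seteqP; split => x /= h i; [move=> _|]; exact: h.
Qed.

Lemma borelRn_rect_measurable (A : 'I_N -> set R) : (forall i, measurable (A i)) ->
  measurable ([set x | forall i, A i (x ord0 i)] : set (borelRn R N)).
Proof.
by move=> mA; apply: (@coord_event_measurable _ (borelRn R N) id A) => // i; exact: borelRn_coord_measurable.
Qed.

End coordinates.

Section gaussian_vector.
Context d (T : measurableType d) (R : realType) (P : probability T R) (N : nat).
Variables (v : R) (Z : T -> 'rV[R]_N).
Hypothesis v0 : 0 < v.
Hypothesis mZ : forall i, measurable_fun [set: T] (fun w => Z w ord0 i).
Hypothesis gZ : centered_gaussian P v Z.

Let sg := Num.sqrt v.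
Let sg0 : 0 < sg. Proof. by rewrite sqrtr_gt0. Qed.
Let sg2 : sg ^+ 2 = v. Proof. by rewrite sqr_sqrtr// ltW. Qed.

Lemma coord_law i (A : set R) : measurable A ->
  P ((fun w => Z w ord0 i) @^-1` A) = normal_prob 0 sg A.
Proof.
move=> mA; pose B j := if j == i then A else setT.
have mB j : measurable (B j) by rewrite /B; case: ifP.
have := gZ mB; rewrite (bigD1 i)//= big1 ?mule1; last first.
  by move=> j ji; rewrite /B (negbTE ji) probability_setT.
rewrite /B eqxx => <-; congr (P _); apply/seteqP; split => w /=.
  by move=> h j; case: ifP => // /eqP ->.
by move=> /(_ i); rewrite eqxx.
Qed.

Lemma coord_integral i (f : R -> R) : measurable_fun setT f -> (forall x, 0 <= f x) ->
  (\int[P]_w (f (Z w ord0 i))%:E = \int[lebesgue_measure]_x (f x * normal_pdf 0 sg x)%:E)%E.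
Proof.
move=> mf f0.
have mz : measurable_fun [set: T] ((fun w => Z w ord0 i) : T -> measurableTypeR R).
  exact: mZ.
pose F : {RV P >-> measurableTypeR R} := HB.pack ((fun w => Z w ord0 i) : T -> measurableTypeR R)
  (isMeasurableFun.Build _ _ _ _ ((fun w => Z w ord0 i) : T -> measurableTypeR R) mz).
transitivity (\int[distribution P F]_x (f x)%:E)%E.
  by rewrite ge0_integral_distribution//; exact/measurable_EFinP.
transitivity (\int[normal_prob 0 sg]_x (f x)%:E)%E.
  by apply: eq_measure_integral => A mA _; exact: coord_law.
by rewrite ge0_integral_normal_prob//; exact/measurable_EFinP.
Qed.

Lemma coord_sqr i : P.-integrable setT (EFin \o (fun w => Z w ord0 i ^+ 2)) /\
  \int[P]_w (Z w ord0 i ^+ 2) = v.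
Proof.
have e : (\int[P]_w (Z w ord0 i ^+ 2)%:E = v%:E)%E.
  rewrite (coord_integral i (f := fun x => x ^+ 2)) ?normal_var ?sg2//.
  by move=> x; rewrite sqr_ge0.
split; last by rewrite /Rintegral e.
apply/integrableP; split.
  by apply/measurable_EFinP/measurable_funX; exact: mZ.
by under eq_integral do rewrite /= ger0_norm ?sqr_ge0//; rewrite e ltry.
Qed.

Lemma coord_pow4 i : P.-integrable setT (EFin \o (fun w => Z w ord0 i ^+ 4)) /\
  \int[P]_w (Z w ord0 i ^+ 4) = 3 * v ^+ 2.
Proof.
have e : (\int[P]_w (Z w ord0 i ^+ 4)%:E = (3 * v ^+ 2)%:E)%E.
  rewrite (coord_integral i (f := fun x => x ^+ 4))//; last by move=> x; rewrite exprn_even_ge0.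
  by rewrite normal_kurt// -sg2 -exprM.
split; last by rewrite /Rintegral e.
apply/integrableP; split.
  by apply/measurable_EFinP/measurable_funX; exact: mZ.
by under eq_integral do rewrite /= ger0_norm ?exprn_even_ge0//; rewrite e ltry.
Qed.

(** The positive and negative parts have the same integral by the symmetry of
    the density. *)
Lemma coord_mean i : P.-integrable setT (EFin \o (fun w => Z w ord0 i)) /\
  \int[P]_w (Z w ord0 i) = 0.
Proof.
have Iz : P.-integrable setT (EFin \o (fun w => Z w ord0 i)).
  have [I2 _] := coord_sqr i.
  have I1 : P.-integrable setT (EFin \o (fun w => 1 + Z w ord0 i ^+ 2)).
    by apply: (integrableD _ (finite_measure_integrable_cst _ 1 measurableT) I2).
  apply: le_integrable I1 => //.
    by apply/measurable_EFinP; exact: mZ.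
  move=> w _ /=; rewrite lee_fin; set z := Z w ord0 i.
  rewrite (@ger0_norm _ (1 + z ^+ 2)); last by rewrite addr_ge0// sqr_ge0.
  by rewrite ler_norml; nra.
split => //.
pose pp (x : R) := Num.max x 0; pose nn (x : R) := Num.max (- x) 0.
have cpp : continuous pp by move=> x; apply: continuous_max; [exact: cvg_id|exact: cvg_cst].
have cnn : continuous nn by move=> x; apply: continuous_max; [exact: (@cvgN _ R^o)|exact: cvg_cst].
have mpp : measurable_fun setT pp by exact: continuous_measurable_fun.
have mnn : measurable_fun setT nn by exact: continuous_measurable_fun.
have pp0 x : 0 <= pp x by rewrite le_max lexx orbT.
have nn0 x : 0 <= nn x by rewrite le_max lexx orbT.
have pn x : x = pp x - nn x.
  rewrite /pp /nn; case: (leP x 0%R) => x0; last by rewrite max_r ?subr0// oppr_le0 ltW.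
  by rewrite max_l ?oppr_ge0// opprK add0r.
have ppn x : `|pp x| <= `|x| by rewrite ger0_norm// ge_max ler_norm normr_ge0.
have nnn x : `|nn x| <= `|x|.
  by rewrite ger0_norm// ge_max -[X in (_ <= `|X|)]opprK normrN ler_norm normr_ge0.
have cz := mZ i.
have Ip : P.-integrable setT (EFin \o (fun w => pp (Z w ord0 i))).
  apply: le_integrable Iz => //; first by apply/measurable_EFinP; exact: measurableT_comp.
  by move=> w _; rewrite /= lee_fin.
have In : P.-integrable setT (EFin \o (fun w => nn (Z w ord0 i))).
  apply: le_integrable Iz => //; first by apply/measurable_EFinP; exact: measurableT_comp.
  by move=> w _; rewrite /= lee_fin.
transitivity (\int[P]_w (pp (Z w ord0 i) - nn (Z w ord0 i))).
  by apply: eq_Rintegral => w _; exact: pn.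
rewrite RintegralB//; apply/eqP; rewrite subr_eq0; apply/eqP.
rewrite /Rintegral; congr (fine _).
rewrite (coord_integral i mpp pp0) (coord_integral i mnn nn0).
pose G (x : R) := nn x * normal_pdf 0 sg x.
have sgn : sg != 0 by rewrite gt_eqF.
have cG : continuous G by move=> x; apply: cvgM; [exact: cnn|exact: continuous_normal_pdf].
have G0 x : 0 <= G x by rewrite mulr_ge0// normal_pdf_ge0.
transitivity (\int[lebesgue_measure]_(x in `[0%R, +oo[) ((G \o -%R) x)%:E)%E; last first.
  rewrite -ge0_integration_by_substitutionNy//.
  - rewrite oppr0 integral_mkcond; apply: eq_integral => x _.
    rewrite patchE; case: ifPn => //; rewrite notin_setE /= in_itv/= => /negP.
    by rewrite -ltNge => x0; rewrite /nn max_r ?mul0r// oppr_le0 ltW.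
  - exact: continuous_subspaceT.
rewrite [RHS]integral_mkcond; apply: eq_integral => x _.
rewrite patchE; case: ifPn => [_|].
  rewrite /G /= /nn opprK; congr (_ * _)%:E.
  by rewrite !normal_pdfE// /normal_fun !subr0 sqrrN.
rewrite notin_setE /= in_itv/= andbT => /negP.
by rewrite -ltNge => x0; rewrite /pp max_r ?mul0r// ltW.
Qed.

Lemma coord_cross i j : i != j ->
  P.-integrable setT (EFin \o (fun w => Z w ord0 i * Z w ord0 j)) /\
  \int[P]_w (Z w ord0 i * Z w ord0 j) = 0.
Proof.
move=> ij; have [Ii Ei] := coord_mean i; have [Ij Ej] := coord_mean j.
have h : indep_fun P (fun w => Z w ord0 i) (fun w => Z w ord0 j).
  move=> A B mA mB; rewrite !coord_law//.
  pose C k := if k == i then A else if k == j then B else setT.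
  have mC k : measurable (C k) by rewrite /C; do 2 case: ifP => //.
  have := gZ mC; rewrite (bigD1 i)//= (bigD1 j) 1?eq_sym//= big1 ?mule1; last first.
    by move=> k /andP[ki kj]; rewrite /C (negbTE ki) (negbTE kj) probability_setT.
  rewrite /C !eqxx (eq_sym j i) (negbTE ij) => <-; congr (P _).
  apply/seteqP; split => w /=.
    by move=> [h1 h2] k; case: ifP => [/eqP->//|_]; case: ifP => [/eqP->//|].
  move=> h; have := h i; have := h j; rewrite !eqxx (eq_sym j i) (negbTE ij).
  by split.
split; first exact: indep_integrableM.
by rewrite indep_RintegralM// Ei mul0r.
Qed.

Section past.
Variable C1 : set (set T).
Hypothesis C1I : setI_closed C1.
Hypothesis C1m : C1 `<=` measurable.
Hypothesis C1indep : forall E (A : 'I_N -> set R), C1 E -> (forall i, measurable (A i)) ->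
  P (E `&` [set w | forall i, A i (Z w ord0 i)]) =
  (P E * P [set w | forall i, A i (Z w ord0 i)])%E.

(** Functions of the past, when C generates the events of the past. *)
Definition sigma_measurable (C : set (set T)) (f : T -> R) :=
  @measurable_fun _ _ (g_sigma_algebraType C) R setT f.

Let cyl := [set F : set T | exists2 A : 'I_N -> set R, (forall i, measurable (A i)) &
   F = [set w | forall i, A i (Z w ord0 i)]].

Let cylI : setI_closed cyl.
Proof.
move=> _ _ [A mA ->] [B mB ->]; exists (fun i => A i `&` B i).
  by move=> i; exact: measurableI.
apply/seteqP; split => w /=; first by move=> [h1 h2] i; split.
by move=> h; split => i; have [] := h i.
Qed.

Let cylm : cyl `<=` measurable.
Proof.
by move=> _ [A mA ->]; exact: coord_event_measurable.
Qed.

Let cyl_coord i : sigma_measurable cyl (fun w => Z w ord0 i).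
Proof.
move=> _ A mA; rewrite setTI; apply: sub_sigma_algebra.
exists (fun j => if j == i then A else setT); first by move=> j; case: ifP.
apply/seteqP; split => w /=; first by move=> h j; case: ifP => // /eqP->.
by move=> /(_ i); rewrite eqxx.
Qed.

Let subm C (f : T -> R) : C `<=` measurable -> sigma_measurable C f -> measurable_fun setT f.
Proof.
move=> Cm mf _ A mA; have := mf measurableT A mA; apply: smallest_sub => //.
exact: sigma_algebra_measurable.
Qed.

Definition bounded_past (f : T -> R) :=
  sigma_measurable C1 f /\ exists M : R, forall w, `|f w| <= M.

Lemma bounded_past_integrable f : bounded_past f -> P.-integrable setT (EFin \o f).
Proof.
move=> [mf [M hM]]; have := finite_measure_integrable_cst P M (@measurableT _ T).
apply: le_integrable => //; first by apply/measurable_EFinP; exact: (subm C1m mf).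
by move=> w _ /=; rewrite lee_fin (le_trans (hM _))// ler_norm.
Qed.

(* A function of the past is independent of a function of Z. *)
Let past_moment f g : bounded_past f -> sigma_measurable cyl g ->
  P.-integrable setT (EFin \o g) ->
  P.-integrable setT (EFin \o (fun w => f w * g w)) /\
  \int[P]_w (f w * g w) = (\int[P]_w f w) * (\int[P]_w g w).
Proof.
move=> bf mg Ig; have If := bounded_past_integrable bf.
have h : indep_fun P f g.
  move=> A B mA mB; apply: (@indep_sigma _ _ _ P C1 cyl) => //.
  - by move=> E F CE [D mD ->]; exact: C1indep.
  - by rewrite -[X in _ X]setTI; exact: bf.1.
  - by rewrite -[X in _ X]setTI; exact: mg.
by split; [exact: indep_integrableM|exact: indep_RintegralM].
Qed.

Lemma past_mean f i : bounded_past f ->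
  P.-integrable setT (EFin \o (fun w => f w * Z w ord0 i)) /\
  \int[P]_w (f w * Z w ord0 i) = 0.
Proof.
move=> bf; have [Iz Ez] := coord_mean i.
by have [I ->] := past_moment bf (cyl_coord i) Iz; rewrite Ez mulr0.
Qed.

Lemma past_cov f i j : bounded_past f ->
  P.-integrable setT (EFin \o (fun w => f w * (Z w ord0 i * Z w ord0 j))) /\
  \int[P]_w (f w * (Z w ord0 i * Z w ord0 j)) = (i == j)%:R * (v * \int[P]_w f w).
Proof.
move=> bf; have m : sigma_measurable cyl (fun w => Z w ord0 i * Z w ord0 j).
  by apply: measurable_funM; exact: cyl_coord.
have [ij|ij] := eqVneq i j; last first.
  have [Iz Ez] := coord_cross ij.
  by have [I ->] := past_moment bf m Iz; rewrite Ez mulr0 mul0r.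
subst j; have [Iz Ez] := coord_sqr i.
have [I ->] := past_moment bf m Iz; split => //.
by rewrite mul1r mulrC -[in RHS]Ez.
Qed.

Lemma past_pow4 f i : bounded_past f ->
  P.-integrable setT (EFin \o (fun w => f w * Z w ord0 i ^+ 4)) /\
  \int[P]_w (f w * Z w ord0 i ^+ 4) = 3 * v ^+ 2 * \int[P]_w f w.
Proof.
move=> bf; have m : sigma_measurable cyl (fun w => Z w ord0 i ^+ 4).
  by apply: measurable_funX; exact: cyl_coord.
have [Iz Ez] := coord_pow4 i.
by have [I ->] := past_moment bf m Iz; split => //; rewrite Ez mulrC.
Qed.

End past.
End gaussian_vector.

(** * One step of a Gaussian walk killed outside a ball *)

Section has_mean.
Context d (T : measurableType d) (R : realType) (P : probability T R).

(** Keeping integrability together with the value lets linear combinations of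
    many terms be averaged without side conditions. *)
Definition has_mean (f : T -> R) (x : R) :=
  P.-integrable setT (EFin \o f) /\ \int[P]_w f w = x.

Lemma has_mean_add f g x y : has_mean f x -> has_mean g y ->
  has_mean (fun w => f w + g w) (x + y).
Proof.
move=> [If <-] [Ig <-]; split; first exact: (integrableD _ If Ig).
by rewrite RintegralD.
Qed.

Lemma has_mean_sub f g x y : has_mean f x -> has_mean g y ->
  has_mean (fun w => f w - g w) (x - y).
Proof.
move=> [If <-] [Ig <-]; split; first exact: (integrableB _ If Ig).
by rewrite RintegralB.
Qed.

Lemma has_mean_scale k f x : has_mean f x -> has_mean (fun w => k * f w) (k * x).
Proof.
move=> [If <-]; split; first exact: (integrableZl _ k If).
by rewrite RintegralZl.
Qed.

Lemma has_mean_sum (n : nat) (f : 'I_n -> T -> R) (x : 'I_n -> R) :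
  (forall i, has_mean (f i) (x i)) ->
  has_mean (fun w => \sum_(i < n) f i w) (\sum_(i < n) x i).
Proof.
elim: n f x => [|n ih] f x h.
  under eq_fun do rewrite big_ord0.
  rewrite big_ord0; split; first exact: finite_measure_integrable_cst.
  by rewrite Rintegral_cst// mul0r.
under eq_fun do rewrite big_ord_recr.
rewrite big_ord_recr; apply: has_mean_add => //.
exact: (ih (fun i => f (widen_ord (leqnSn n) i)) (fun i => x (widen_ord (leqnSn n) i))).
Qed.

Lemma has_mean_le f g x y : has_mean f x -> has_mean g y ->
  (forall w, f w <= g w) -> x <= y.
Proof. by move=> [If <-] [Ig <-] h; apply: le_Rintegral. Qed.

Lemma has_mean_bounded (f : T -> R) (M : R) : measurable_fun setT f ->
  (forall w, `|f w| <= M) -> has_mean f (\int[P]_w f w).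
Proof.
move=> mf hM; split => //.
have := finite_measure_integrable_cst P M (@measurableT _ T).
apply: le_integrable => //; first exact/measurable_EFinP.
by move=> w _ /=; rewrite lee_fin (le_trans (hM _))// ler_norm.
Qed.

End has_mean.

Section one_step.
Context d (T : measurableType d) (R : realType) (P : probability T R) (N : nat).
Variables (v : R) (Z : T -> 'rV[R]_N).
Hypothesis v0 : 0 < v.
Hypothesis mZ : forall i, measurable_fun [set: T] (fun w => Z w ord0 i).
Hypothesis gZ : centered_gaussian P v Z.
Variable C1 : set (set T).
Hypothesis C1I : setI_closed C1.
Hypothesis C1m : C1 `<=` measurable.
Hypothesis C1indep : forall E (A : 'I_N -> set R), C1 E -> (forall i, measurable (A i)) ->
  P (E `&` [set w | forall i, A i (Z w ord0 i)]) =
  (P E * P [set w | forall i, A i (Z w ord0 i)])%E.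
Variables (E : set T) (Y : T -> 'rV[R]_N).
Hypothesis sE : <<s C1>> E.
Hypothesis mY : forall i, sigma_measurable C1 (fun w => Y w ord0 i).
Variables (p : {poly R}) (rho1 k K delta : R).
Hypothesis k0 : 0 < k.
Hypothesis EY : forall w, E w -> k * normsq (Y w) <= rho1.
Hypothesis taylor : forall (eta : R) (y z : 'rV[R]_N), 0 < eta -> k * normsq y <= rho1 ->
    let s := k * normsq y in
    p.[s] + k * p^`().[s] * (2 * dot y z + normsq z)
      + 2 * k ^+ 2 * p^`()^`().[s] * dot y z ^+ 2
      - K * (eta * normsq z + eta^-1 * \sum_(i < N) z ord0 i ^+ 4)
    <= cutoff p rho1 (k * normsq (y + z)).
Hypothesis subsol : forall s, 0 <= s <= rho1 ->
  delta <= (radial_half_laplacian N p).[s] + p.[s] / 2.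
Hypothesis small : 4 * K * N%:R * Num.sqrt v <= k * delta.

Let q w := k * normsq (Y w).

Let mq : sigma_measurable C1 q.
Proof.
apply: measurable_funM => //; apply: measurable_sum => i.
by apply: measurable_funX; exact: mY.
Qed.

Let mpq (r : {poly R}) : sigma_measurable C1 (fun w => r.[q w]).
Proof.
have mh : measurable_fun setT (fun s : R => r.[s]).
  by apply: continuous_measurable_fun; exact: continuous_horner.
exact: (measurableT_comp mh mq).
Qed.

Let q_itv w : E w -> 0 <= q w <= rho1.
Proof. by move=> Ew; rewrite EY// andbT mulr_ge0 ?normsq_ge0// ltW. Qed.

Let bdE (g : T -> R) := exists M : R, forall w, E w -> `|g w| <= M.

Let bdM f g : bdE f -> bdE g -> bdE (fun w => f w * g w).
Proof.
move=> [M hM] [L hL]; exists (`|M| * `|L|) => w Ew; rewrite normrM.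
by apply: ler_pM => //; [apply: le_trans (hM _ Ew) _|apply: le_trans (hL _ Ew) _]; exact: ler_norm.
Qed.

Let bdC x : bdE (fun=> x). Proof. by exists `|x|. Qed.

Let bp (g : T -> R) : sigma_measurable C1 g -> bdE g -> bounded_past C1 (fun w => \1_E w * g w).
Proof.
move=> mg [M hM]; split.
  by apply: measurable_funM => //; exact: measurable_indic.
exists `|M| => w; rewrite indicE; case: (boolP (w \in E)) => wE.
  by rewrite mul1r; apply: (le_trans (hM _ (set_mem wE))); exact: ler_norm.
by rewrite mul0r normr0.
Qed.

Let bdp (r : {poly R}) : bdE (fun w => r.[q w]).
Proof.
have [M _ hM] := poly_bounded r rho1; exists M => w Ew; apply: hM.
by have /andP[q0 qr] := q_itv Ew; rewrite ger0_norm.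
Qed.

Let bdY i : bdE (fun w => Y w ord0 i).
Proof.
exists (1 + rho1 / k) => w Ew; have h : Y w ord0 i ^+ 2 <= rho1 / k.
  rewrite ler_pdivlMr// mulrC; apply: le_trans (EY Ew).
  apply: ler_wpM2l; rewrite ?(ltW k0)// /normsq (bigD1 i)//= lerDl.
  by apply: sumr_ge0 => j _; rewrite sqr_ge0.
by rewrite ler_norml; nra.
Qed.

Let a w := \1_E w * p.[q w].
Let b w := \1_E w * (k * p^`().[q w]).
Let bi i w := \1_E w * (k * p^`().[q w] * (2 * Y w ord0 i)).
Let c i j w := \1_E w * (2 * k ^+ 2 * p^`()^`().[q w] * (Y w ord0 i * Y w ord0 j)).

Let bpa : bounded_past C1 a. Proof. by apply: bp; [exact: mpq|exact: bdp]. Qed.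
Let bpb : bounded_past C1 b.
Proof.
apply: bp; first by apply: measurable_funM => //; exact: mpq.
by apply: bdM; [exact: bdC|exact: bdp].
Qed.
Let bpbi i : bounded_past C1 (bi i).
Proof.
apply: bp.
  apply: measurable_funM; apply: measurable_funM => //; first exact: mpq.
  exact: mY.
by apply: bdM; apply: bdM; [exact: bdC|exact: bdp|exact: bdC|exact: bdY].
Qed.
Let bpc i j : bounded_past C1 (c i j).
Proof.
apply: bp.
  apply: measurable_funM; apply: measurable_funM => //; [exact: mpq|exact: mY|exact: mY].
by apply: bdM; apply: bdM; [exact: bdC|exact: bdp|exact: bdY|exact: bdY].
Qed.
Let bpe : bounded_past C1 (\1_E : T -> R).
Proof.
split; first exact: measurable_indic.
by exists 1 => w; rewrite indicE; case: (w \in E); rewrite ?normr1 ?normr0.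
Qed.

Let mean f : bounded_past C1 f -> has_mean P f (\int[P]_w f w).
Proof. by move=> bf; split => //; exact: (bounded_past_integrable P C1m bf). Qed.

Lemma cutoff_measurable : measurable_fun setT (cutoff p rho1).
Proof.
rewrite (_ : cutoff p rho1 = (fun s => \1_(`]-oo, rho1]) s * Num.max p.[s] 0)).
  apply: measurable_funM; first exact: measurable_indic.
  apply: measurable_maxr => //; apply: continuous_measurable_fun; exact: continuous_horner.
apply/funext => s; rewrite /cutoff indicE mem_setE in_itv/=.
by case: ifP; rewrite ?mul1r ?mul0r.
Qed.

Let subm (f : T -> R) : sigma_measurable C1 f -> measurable_fun setT f.
Proof.
move=> mf _ A mA; have := mf measurableT A mA; apply: smallest_sub => //.
exact: sigma_algebra_measurable.
Qed.

Lemma walk_normsq_measurable : measurable_fun setT (fun w => normsq (Y w + Z w)).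
Proof.
apply: measurable_sum => i; apply: measurable_funX.
under eq_fun do rewrite mxE.
by apply: measurable_funD; [exact: subm (mY i)|exact: mZ].
Qed.

(** Average the Taylor inequality [taylor] on the event E, which belongs to the
    past.  The coefficients are functions of the past, independent of the
    increment Z: the linear term vanishes, and the quadratic terms add up to
    v times half of the Laplacian of the subsolution, which [subsol] bounds
    below by k (delta - p / 2).  With eta = sqrt v the error is of order
    v sqrt v, so that k delta v absorbs it under the condition [small]. *)
Lemma one_step_le : (1 - k * v / 2) * \int[P]_w (\1_E w * p.[k * normsq (Y w)]) <=
  \int[P]_w (\1_E w * cutoff p rho1 (k * normsq (Y w + Z w))).
Proof.
pose eta := Num.sqrt v; have eta0 : 0 < eta by rewrite sqrtr_gt0.
have eta2 : eta ^+ 2 = v by rewrite sqr_sqrtr// ltW.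
pose Ea := \int[P]_w a w; pose Eb := \int[P]_w b w.
pose Ec i := \int[P]_w c i i w; pose Ee := \int[P]_w \1_E w.
pose H : has_mean _ _ _ := mean bpa.
have Hbi i : has_mean P (fun w => bi i w * Z w ord0 i) 0 := past_mean v0 mZ gZ C1I C1m C1indep i (bpbi i).
have Hb i : has_mean P (fun w => b w * (Z w ord0 i * Z w ord0 i)) (v * Eb).
  by have := past_cov v0 mZ gZ C1I C1m C1indep i i bpb; rewrite eqxx mul1r.
have Hc i j : has_mean P (fun w => c i j w * (Z w ord0 i * Z w ord0 j))
    ((i == j)%:R * (v * \int[P]_w c i j w)).
  exact: (past_cov v0 mZ gZ C1I C1m C1indep i j (bpc i j)).
have He i : has_mean P (fun w => \1_E w * (Z w ord0 i * Z w ord0 i)) (v * Ee).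
  by have := past_cov v0 mZ gZ C1I C1m C1indep i i bpe; rewrite eqxx mul1r.
have He4 i : has_mean P (fun w => \1_E w * Z w ord0 i ^+ 4) (3 * v ^+ 2 * Ee).
  exact: (past_pow4 v0 mZ gZ C1I C1m C1indep i bpe).
have HG := has_mean_sub (has_mean_add (has_mean_add (has_mean_add H (has_mean_sum Hbi))
   (has_mean_sum Hb)) (has_mean_sum (fun i => has_mean_sum (Hc i))))
   (has_mean_scale K (has_mean_add (has_mean_scale eta (has_mean_sum He))
      (has_mean_scale eta^-1 (has_mean_sum He4)))).
have [Cm Cm0 hCm] := cutoff_ub p rho1.
have HF : has_mean P (fun w => \1_E w * cutoff p rho1 (k * normsq (Y w + Z w)))
    (\int[P]_w (\1_E w * cutoff p rho1 (k * normsq (Y w + Z w)))).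
  apply: (@has_mean_bounded _ _ _ P _ Cm).
    apply: measurable_funM; first exact: subm bpe.1.
    apply: measurableT_comp; first exact: cutoff_measurable.
    by apply: measurable_funM => //; exact: walk_normsq_measurable.
  move=> w; rewrite ger0_norm; last by rewrite mulr_ge0// ?cutoff_ge0// indicE.
  rewrite -[leRHS]mul1r; apply: ler_pM; rewrite ?cutoff_ge0 ?indicE//.
    by case: (w \in E).
  by apply: hCm; rewrite mulr_ge0 ?normsq_ge0// ltW.
have := has_mean_le HG HF; set G := _ - _ => hG.
have {}hG : G <= \int[P]_w (\1_E w * cutoff p rho1 (k * normsq (Y w + Z w))).
  apply: hG => w; rewrite /a /b /bi /c indicE.
  case: (boolP (w \in E)) => wE; last first.
    have s0 (F : 'I_N -> R) : (forall i, F i = 0) -> \sum_(i < N) F i = 0.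
      by move=> h; rewrite big1.
    rewrite !s0; try (by move=> i; rewrite ?mul0r ?s0// => j; rewrite !mul0r).
    by rewrite !mul0r !mulr0 !addr0 mulr0 subrr.
  rewrite !mul1r; have := taylor (Z w) eta0 (EY (set_mem wE)); rewrite /= -/(q w).
  apply: le_trans; rewrite le_eqVlt; apply/orP; left; apply/eqP.
  congr (_ - K * (_ * _ + _ * _)); last 2 first.
  - by apply: eq_bigr => i _; rewrite mul1r.
  - by apply: eq_bigr => i _; rewrite mul1r.
  rewrite mulrDr addrA; congr (_ + _ + _ + _).
  - rewrite /dot mulr_sumr mulr_sumr; apply: eq_bigr => i _; ring.
  - by rewrite /normsq mulr_sumr; apply: eq_bigr => i _; rewrite ?mul1r; ring.
  - rewrite [dot _ _ ^+ 2]expr2 /dot mulr_suml mulr_sumr; apply: eq_bigr => i _.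
    rewrite mulr_sumr mulr_sumr; apply: eq_bigr => j _; rewrite !mul1r; ring.
apply: le_trans hG.
have HL : has_mean P (fun w => \sum_(i < N) (b w + c i i w)) (\sum_(i < N) (Eb + Ec i)).
  by apply: has_mean_sum => i; apply: has_mean_add; exact: mean.
have HR : has_mean P (fun w => k * delta * \1_E w - k / 2 * a w) (k * delta * Ee - k / 2 * Ea).
  by apply: has_mean_sub; apply: has_mean_scale; exact: mean.
have hL : k * delta * Ee - k / 2 * Ea <= \sum_(i < N) (Eb + Ec i).
  apply: (has_mean_le HR HL) => w; rewrite /a /b /c indicE.
  case: (boolP (w \in E)) => wE; last first.
    by rewrite !mul0r !mulr0 subrr big1// => i _; rewrite !mul0r addr0.
  have := subsol (q_itv (set_mem wE)).
  rewrite /radial_half_laplacian hornerD !hornerZ hornerM hornerX.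
  rewrite (_ : p^`(2) = p^`()^`()) => [h|]; last by rewrite derivnS derivn1.
  rewrite !mul1r mulr1.
  rewrite (eq_bigr (fun i => k * p^`().[q w] + 2 * k ^+ 2 * p^`()^`().[q w] * (Y w ord0 i ^+ 2))); last first.
    by move=> i _; rewrite !mul1r; ring.
  rewrite big_split/= sumr_const card_ord -mulr_sumr -/(normsq (Y w)) -[_ *+ N]mulr_natr.
  rewrite [leRHS](_ : _ = k * (N%:R * p^`().[q w] + 2 * (q w * p^`()^`().[q w]))); last by rewrite /q; ring.
  rewrite [leLHS](_ : _ = k * (delta - p.[q w] / 2)); last by ring.
  by apply: ler_wpM2l; [exact: ltW|lra].
have Ee0 : 0 <= Ee by apply: Rintegral_ge0 => w _; rewrite indicE.
(* The factor 4 is 1 + 3, where 3 comes from the fourth moment 3 v^2. *)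
have GE : G = Ea + v * \sum_(i < N) (Eb + Ec i) - 4 * K * N%:R * eta * (v * Ee).
  rewrite /G -/Ea big1// addr0 big_split/= !sumr_const card_ord.
  rewrite (eq_bigr (fun i => v * Ec i)); last first.
    move=> i _; rewrite (bigD1 i)//= eqxx mul1r big1 ?addr0// => j ji.
    by rewrite eq_sym (negbTE ji) mul0r.
  rewrite -mulr_sumr -[v * Eb *+ N]mulr_natr -[v * Ee *+ N]mulr_natr.
  rewrite -[3 * v ^+ 2 * Ee *+ N]mulr_natr -[Eb *+ N]mulr_natr.
  have alg (x y z u n e : R) : e != 0 -> x + e ^+ 2 * y * n + e ^+ 2 * z -
      K * (e * (e ^+ 2 * u * n) + e^-1 * (3 * (e ^+ 2) ^+ 2 * u * n)) =
      x + e ^+ 2 * (y * n + z) - 4 * K * n * e * (e ^+ 2 * u).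
    by move=> e1; field.
  by rewrite -eta2; apply: alg; exact: lt0r_neq0.
rewrite GE -/Ea.
have h1 : v * (k * delta * Ee - k / 2 * Ea) <= v * \sum_(i < N) (Eb + Ec i).
  by rewrite ler_wpM2l// ltW.
have h2 : 4 * K * N%:R * eta * (v * Ee) <= k * delta * (v * Ee).
  by rewrite ler_wpM2r// mulr_ge0// ltW.
by lra.
Qed.

End one_step.

(** * Gaussian walks confined to a ball *)

Section walk.
Context d (T : measurableType d) (R : realType) (P : probability T R) (N : nat).
Variables (X Y : nat -> T -> 'rV[R]_N) (x : 'rV[R]_N).
Hypothesis mX : forall k i, measurable_fun [set: T] (fun w => X k w ord0 i).
Hypothesis iX : forall n, mutually_independent P (fun k : 'I_n => X k).
Hypothesis YE : forall k w, Y k w = x + \sum_(j < k) X j w.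

(** Cylinder events of the first k increments. *)
Definition past k := [set E : set T | exists2 A : nat -> 'I_N -> set R,
  (forall j i, measurable (A j i)) &
  E = [set w | forall j, (j < k)%N -> forall i, A j i (X j w ord0 i)]].

Lemma past_setI k : setI_closed (past k).
Proof.
move=> _ _ [A mA ->] [B mB ->]; exists (fun j i => A j i `&` B j i).
  by move=> j i; exact: measurableI.
apply/seteqP; split => w /=; first by move=> [h1 h2] j jk i; split; [exact: h1|exact: h2].
by move=> h; split => j jk i; have [] := h j jk i.
Qed.

Lemma row_event_measurable k (A : 'I_N -> set R) : (forall i, measurable (A i)) ->
  measurable [set w | forall i, A i (X k w ord0 i)].
Proof.
by move=> mA; apply: coord_event_measurable.
Qed.

Let past_prob k (A : nat -> 'I_N -> set R) : (forall j i, measurable (A j i)) ->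
  P [set w | forall j, (j < k)%N -> forall i, A j i (X j w ord0 i)] =
  (\prod_(j < k) P [set w | forall i, A j i (X j w ord0 i)])%E.
Proof.
move=> mA; have := @iX k (fun j => [set y : 'rV[R]_N | forall i, A j i (y ord0 i)])
  (fun j => borelRn_rect_measurable (mA j)).
move=> <-; congr (P _); apply/seteqP; split => w /=.
  by move=> h j _; exact: h.
by move=> h j jk; exact: (h (Ordinal jk) I).
Qed.

Lemma past_measurable k : past k `<=` measurable.
Proof.
move=> _ [A mA ->].
rewrite [X in measurable X](_ : _ = \bigcap_(j in [set j : nat | (j < k)%N])
    [set w | forall i, A j i (X j w ord0 i)]).
  by apply: bigcap_measurableType => j _; exact: row_event_measurable.
by apply/seteqP; split => w /= h j; exact: h.
Qed.

Lemma past_indep k E (A : 'I_N -> set R) : past k E -> (forall i, measurable (A i)) ->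
  P (E `&` [set w | forall i, A i (X k w ord0 i)]) =
  (P E * P [set w | forall i, A i (X k w ord0 i)])%E.
Proof.
move=> [B mB ->] mA.
pose D j i := if (j < k)%N then B j i else A i.
have mD j i : measurable (D j i) by rewrite /D; case: ifP.
transitivity (P [set w | forall j, (j < k.+1)%N -> forall i, D j i (X j w ord0 i)]).
  congr (P _); apply/seteqP; split => w /=.
    move=> [h1 h2] j; rewrite ltnS leq_eqVlt => /predU1P[->|jk] i; rewrite /D.
      by rewrite ltnn; exact: h2.
    by rewrite jk; exact: h1.
  move=> h; split => [j jk i|i].
    by have := h j (ltnW jk) i; rewrite /D jk.
  by have := h k (ltnSn k) i; rewrite /D ltnn.
rewrite past_prob// big_ord_recr/= past_prob//; congr (_ * _)%E.
  by apply: eq_bigr => j _; rewrite /D ltn_ord.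
by rewrite /D ltnn.
Qed.

Lemma past_sigmaS k : <<s past k>> `<=` <<s past k.+1>>.
Proof.
apply: smallest_sub; first exact: smallest_sigma_algebra.
move=> _ [A mA ->]; apply: sub_sigma_algebra.
exists (fun j => if (j < k)%N then A j else fun=> setT); first by move=> j i; case: ifP.
apply/seteqP; split => w /=; first by move=> h j _ i; case: ifP => // jk; exact: h.
by move=> h j jk i; have := h j (ltnW jk) i; rewrite jk.
Qed.

Let X_past j k i : (j < k)%N -> sigma_measurable (past k) (fun w => X j w ord0 i).
Proof.
move=> jk _ A mA; rewrite setTI; apply: sub_sigma_algebra.
exists (fun j' i' => if (j' == j) && (i' == i) then A else setT).
  by move=> j' i'; case: ifP.
apply/seteqP; split => w /=.
  by move=> h j' _ i'; case: ifP => // /andP[/eqP-> /eqP->].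
by move=> h; have := h j jk i; rewrite !eqxx.
Qed.

Lemma walk_past k i : sigma_measurable (past k) (fun w => Y k w ord0 i).
Proof.
rewrite (_ : (fun w => Y k w ord0 i) = (fun w => x ord0 i + \sum_(j < k) X j w ord0 i)); last first.
  by apply/funext => w; rewrite YE mxE summxE.
apply: measurable_funD => //; apply: measurable_sum => j; exact: X_past.
Qed.

Lemma walkS k w : Y k.+1 w = Y k w + X k w.
Proof. by rewrite !YE big_ord_recr addrA. Qed.

Variables (p : {poly R}) (rho1 k K delta h c0 : R) (n : nat).
Hypothesis h0 : 0 < h.
Hypothesis gX : forall j, (0 < j <= n)%N -> centered_gaussian P h (X j).
Hypothesis k0 : 0 < k.
Hypothesis taylor : forall (eta : R) (y z : 'rV[R]_N), 0 < eta -> k * normsq y <= rho1 ->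
    let s := k * normsq y in
    p.[s] + k * p^`().[s] * (2 * dot y z + normsq z)
      + 2 * k ^+ 2 * p^`()^`().[s] * dot y z ^+ 2
      - K * (eta * normsq z + eta^-1 * \sum_(i < N) z ord0 i ^+ 4)
    <= cutoff p rho1 (k * normsq (y + z)).
Hypothesis subsol : forall s, 0 <= s <= rho1 ->
  delta <= (radial_half_laplacian N p).[s] + p.[s] / 2.
Hypothesis small : 4 * K * N%:R * Num.sqrt h <= k * delta.
Hypothesis small2 : 0 <= 1 - k * h / 2.
Variable D0 : set T.
Hypothesis sD0 : <<s past 1>> D0.
Hypothesis D0c : forall w, D0 w -> c0 <= cutoff p rho1 (k * normsq (Y 1%N w)).

(** D0 is a condition on the first increment, which brings the walk to the
    place from which it is followed; the walk is not watched at time 0. *)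
Definition stay m := D0 `&` [set w | forall j, (0 < j <= m)%N -> k * normsq (Y j w) <= rho1].

Let q m w := k * normsq (Y m w).

Let q_past m : sigma_measurable (past m) (q m).
Proof.
apply: measurable_funM => //; apply: measurable_sum => i.
by apply: measurable_funX; exact: walk_past.
Qed.

Let q_event m (A : set R) : measurable A -> <<s past m>> (q m @^-1` A).
Proof. by move=> mA; rewrite -[X in _ X]setTI; exact: (q_past measurableT mA). Qed.

Let sigma_setI m (A B : set T) : <<s past m>> A -> <<s past m>> B -> <<s past m>> (A `&` B).
Proof. exact: (@measurableI _ (g_sigma_algebraType (past m))). Qed.

Lemma stayS m : stay m.+1 = stay m `&` [set w | q m.+1 w <= rho1].
Proof.
apply/seteqP; split => w /=.
  move=> [D0w hs]; split; last by apply: hs; rewrite /= leqnn.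
  by split => // j /andP[j0 jm]; apply: hs; rewrite j0 ltnW.
move=> [[D0w hs] hq]; split => // j /andP[j0]; rewrite leq_eqVlt => /predU1P[->//|jm].
by apply: hs; rewrite j0.
Qed.

Lemma stay_past m : <<s past m.+1>> (stay m.+1).
Proof.
have hI : measurable (`]-oo, rho1] : set R) by [].
have hq j : <<s past j>> [set w | q j w <= rho1].
  have := @q_event j _ hI; rewrite (_ : _ @^-1` _ = [set w | q j w <= rho1])//.
elim: m => [|m ih]; rewrite stayS; apply: sigma_setI; try exact: hq.
  rewrite (_ : stay 0 = D0)//; apply/seteqP; split => w; first by case.
  by move=> ?; split => // j /andP[]; case: j.
by apply: past_sigmaS.
Qed.

Let sigma_sub m : <<s past m>> `<=` (@measurable _ T).
Proof. apply: smallest_sub; [exact: sigma_algebra_measurable|exact: past_measurable]. Qed.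

Let a m := \int[P]_w (\1_(stay m) w * cutoff p rho1 (q m w)).

Let mc m : measurable_fun setT (fun w => cutoff p rho1 (q m w)).
Proof.
apply: measurableT_comp; first exact: cutoff_measurable.
by move=> _ A mA; rewrite setTI; apply: (@sigma_sub m); exact: q_event.
Qed.

Let cbound := cutoff_ub p rho1.

Let q0 m w : 0 <= q m w. Proof. by rewrite mulr_ge0 ?normsq_ge0// ltW. Qed.

Let indic_mean (E : set T) m : measurable E ->
  has_mean P (fun w => \1_E w * cutoff p rho1 (q m w)) (\int[P]_w (\1_E w * cutoff p rho1 (q m w))).
Proof.
move=> mE; have [M M0 hM] := cbound; apply: (@has_mean_bounded _ _ _ P _ M).
  by apply: measurable_funM; [exact: measurable_indic|exact: mc].
move=> w; rewrite ger0_norm; last by rewrite mulr_ge0// ?cutoff_ge0// indicE.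
rewrite -[leRHS]mul1r; apply: ler_pM; rewrite ?cutoff_ge0 ?indicE//; last exact: hM.
by case: (w \in E).
Qed.

(* The event E of positive value is where cutoff and p agree. *)
Let step m : (m < n)%N -> (1 - k * h / 2) * a m.+1 <= a m.+2.
Proof.
move=> mn.
pose E := stay m.+1 `&` [set w | 0 < cutoff p rho1 (q m.+1 w)].
have mpos : measurable (cutoff p rho1 @^-1` `]0, +oo[ : set R).
  rewrite -[X in measurable X]setTI; exact: (cutoff_measurable p rho1 measurableT).
have sE : <<s past m.+1>> E.
  apply: sigma_setI; first exact: stay_past.
  have := @q_event m.+1 _ mpos; rewrite (_ : _ @^-1` _ = [set w | 0 < cutoff p rho1 (q m.+1 w)])//.
  by apply/seteqP; split => w /=; rewrite in_itv/= andbT.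
have EY w : E w -> q m.+1 w <= rho1 by move=> [[_ hs] _]; apply: hs => /=.
have mn1 : (0 < m.+1 <= n)%N by [].
have := @one_step_le _ T R P N h (X m.+1) h0 (mX m.+1) (gX mn1) (past m.+1)
  (@past_setI m.+1) (@past_measurable m.+1) (@past_indep m.+1) E (Y m.+1) sE
  (@walk_past m.+1) p rho1 k K delta k0 EY taylor subsol small.
have E1 w : \1_E w * p.[k * normsq (Y m.+1 w)] = \1_(stay m.+1) w * cutoff p rho1 (q m.+1 w).
  rewrite !indicE; case: (boolP (w \in E)) => wE.
    have [h1 h2] := set_mem wE; rewrite (mem_set h1) !mul1r.
    by have [_ ->] := cutoff_gt0 h2.
  rewrite mul0r; case: (boolP (w \in stay m.+1)) => ws; last by rewrite mul0r.
  rewrite mul1r; apply/esym/eqP; rewrite eq_le cutoff_ge0 andbT leNgt; apply/negP => h2.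
  by move/negP: wE; apply; apply/mem_set; split => //; exact: set_mem.
have -> : \int[P]_w (\1_E w * p.[k * normsq (Y m.+1 w)]) = a m.+1.
  by apply: eq_Rintegral => w _; exact: E1.
move=> /le_trans; apply.
have -> : \int[P]_w (\1_E w * cutoff p rho1 (k * normsq (Y m.+1 w + X m.+1 w))) =
    \int[P]_w (\1_E w * cutoff p rho1 (q m.+2 w)).
  by apply: eq_Rintegral => w _; rewrite /q (walkS m.+1).
have mE : measurable E by exact: (@sigma_sub m.+1).
have ms : measurable (stay m.+2) by apply: (@sigma_sub m.+2); exact: stay_past.
apply: (has_mean_le (indic_mean m.+2 mE) (indic_mean m.+2 ms)) => w.
have [h2|h2] := ltP 0 (cutoff p rho1 (q m.+2 w)); last first.
  have -> : cutoff p rho1 (q m.+2 w) = 0 by apply/eqP; rewrite eq_le h2 cutoff_ge0.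
  by rewrite !mulr0.
apply: ler_wpM2r; first exact: cutoff_ge0.
rewrite !indicE; case: (boolP (w \in E)) => // wE.
have [h1 _] := set_mem wE; rewrite mem_set// stayS; split => //=.
by have [] := cutoff_gt0 h2.
Qed.

(** Let a_m be the mean of phi (Y_m) on the event that the walk has stayed in the
    ball up to time m.  The one-step estimate gives
    a_(m + 1) >= (1 - k h / 2) a_m, with c0 P(D0) <= a_1 and
    a_(n + 1) <= M P(stay).  The last increment is independent of
    all this. *)
Lemma walk_stay_prob (M : R) (A : 'I_N -> set R) : 0 < M ->
  (forall s, 0 <= s -> cutoff p rho1 s <= M) -> (forall i, measurable (A i)) -> 0 <= c0 ->
  (c0 * (1 - k * h / 2) ^+ n * fine (P D0)
     * fine (P [set w | forall i, A i (X n.+1 w ord0 i)])) <=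
  M * fine (P (stay n.+1 `&` [set w | forall i, A i (X n.+1 w ord0 i)])).
Proof.
move=> M0 hM mA c00.
have mD0 : measurable D0 by exact: (@sigma_sub 1).
have ms : measurable (stay n.+1) by apply: (@sigma_sub n.+1); exact: stay_past.
have mF := row_event_measurable n.+1 mA.
set F := [set w | forall i, A i (X n.+1 w ord0 i)] in mF *.
have -> : P (stay n.+1 `&` F) = (P (stay n.+1) * P F)%E.
  apply: (@indep_sigma_left _ T R P (past n.+1) [set G | exists2 A : 'I_N -> set R,
     (forall i, measurable (A i)) & G = [set w | forall i, A i (X n.+1 w ord0 i)]]).
  - exact: past_setI.
  - exact: past_measurable.
  - by move=> _ [B mB ->]; exact: row_event_measurable.
  - by move=> E _ pE [B mB ->]; exact: past_indep.
  - exact: stay_past.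
  - by exists A.
rewrite fineM ?fin_num_measure// mulrA ler_wpM2r ?fine_ge0//.
have Rindic (E : set T) : measurable E -> has_mean P (\1_E : T -> R) (fine (P E)).
  move=> mE; split; last by rewrite /Rintegral integral_indic// setIT.
  by apply: integrable_indic => //; rewrite ltey_eq fin_num_measure.
have a1 : c0 * fine (P D0) <= a 1%N.
  apply: (has_mean_le (has_mean_scale c0 (Rindic _ mD0)) (indic_mean 1 _)) => [|w].
    by apply: (@sigma_sub 1%N); exact: stay_past.
  rewrite !indicE; case: (boolP (w \in D0)) => wD; last first.
    by rewrite mulr0 mulr_ge0 ?cutoff_ge0.
  have [h1|h1] := ltP 0 c0; last first.
    by rewrite mulr1 (le_trans h1)// mulr_ge0 ?cutoff_ge0.
  have D0w := set_mem wD; have h2 := D0c D0w.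
  have [h3 _] := cutoff_gt0 (lt_le_trans h1 h2).
  rewrite mem_set ?mul1r ?mulr1//; split => // j /andP[j0 j1].
  by rewrite (_ : j = 1%N)//; apply/eqP; rewrite eqn_leq j0 j1.
have aM : a n.+1 <= M * fine (P (stay n.+1)).
  apply: (has_mean_le (indic_mean n.+1 ms) (has_mean_scale M (Rindic _ ms))) => w.
  by rewrite mulrC ler_wpM2r// hM.
apply: le_trans aM.
have pw m : (m <= n)%N -> (1 - k * h / 2) ^+ m * a 1%N <= a m.+1.
  elim: m => [|m ih] mn; first by rewrite expr0 mul1r.
  apply: le_trans (step mn); rewrite exprS -mulrA ler_wpM2l//.
  exact/ih/ltnW.
apply: le_trans (pw n (leqnn n)).
by rewrite mulrAC mulrC ler_wpM2l// exprn_ge0.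
Qed.

End walk.

(** * Brownian motion along a refining grid of times *)

Section gaussian_boxes.
Variable R : realType.
Notation mu := (@lebesgue_measure R).

Lemma expR_le_1minus (theta y : R) : 0 < theta -> 0 <= y -> y <= theta / (1 + theta) ->
  expR (- ((1 + theta) * y)) <= 1 - y.
Proof.
move=> t0 y0 yt; have t1 : 0 < 1 + theta by rewrite addr_gt0.
have h : y * (1 + theta) <= theta by rewrite -ler_pdivlMr.
rewrite expRN -[leLHS]mul1r ler_pdivrMr ?expR_gt0//.
have h1 := expR_ge1Dx ((1 + theta) * y).
have y1 : 0 <= 1 - y by nra.
apply: le_trans (ler_wpM2l y1 h1); nra.
Qed.

Lemma normal_prob_itv_ge (s L : R) : 0 < s -> exists2 m : R, 0 < m &
  forall u v, - L <= u -> u <= v -> v <= L -> m * (v - u) <= fine (normal_prob 0 s `[u, v]).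
Proof.
move=> s0; have sn0 := lt0r_neq0 s0.
pose m : R := normal_peak s * expR (- L ^+ 2 / (s ^+ 2 *+ 2)).
have m0 : 0 < m by rewrite mulr_gt0 ?normal_peak_gt0 ?expR_gt0.
exists m => // u v Lu uv vL.
have mI : measurable (`[u, v] : set R) by [].
rewrite -lee_fin fineK; last exact: (fin_num_measure (normal_prob 0 s)).
have -> : (m * (v - u))%:E = (\int[mu]_(x in `[u, v]) (cst m%:E x))%E.
  rewrite integral_cst//= lebesgue_measure_itv/= lte_fin.
  case: ltP => [_|vu]; first by rewrite EFinM EFinB.
  by rewrite (@le_anti _ _ u v) ?subrr ?mulr0 ?mule0 ?uv.
apply: ge0_le_integral => //=.
- by move=> x _; rewrite lee_fin ltW.
- by apply/measurable_EFinP; apply: measurable_funTS; exact: measurable_normal_pdf.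
move=> x; rewrite in_itv/= => /andP[ux xv]; rewrite lee_fin normal_pdfE// /m.
rewrite ler_wpM2l ?normal_peak_ge0// ler_expR subr0 !mulNr lerN2 ler_wpM2r//.
  by rewrite invr_ge0 mulrn_wge0// sqr_ge0.
have h1 : - L <= x by exact: le_trans ux.
have h2 : x <= L by exact: le_trans vL.
nra.
Qed.

(** On [- L, L] the density is bounded below. *)
Lemma gaussian_box_ge (N : nat) (v L : R) : 0 < v -> exists2 m : R, 0 < m &
  forall d (T : measurableType d) (P : probability T R) (Z : T -> 'rV[R]_N)
    (a : 'I_N -> R) (l : R), centered_gaussian P v Z -> 0 <= l ->
    (forall i, - L <= a i) -> (forall i, a i + l <= L) ->
    (m * l) ^+ N <= fine (P [set w | forall i, `[a i, a i + l]%classic (Z w ord0 i)]).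
Proof.
move=> v0; have s0 : 0 < Num.sqrt v by rewrite sqrtr_gt0.
have [m m0 hm] := normal_prob_itv_ge L s0; exists m => // d T P Z a l gZ l0 La aL.
rewrite (gZ (fun i => `[a i, a i + l]%classic))//.
rewrite (eq_bigr (fun i => (fine (normal_prob 0 (Num.sqrt v) `[a i, a i + l]))%:E)); last first.
  by move=> i _; rewrite fineK//; exact: (fin_num_measure (normal_prob 0 (Num.sqrt v))).
rewrite prodEFin /= -[N in leLHS]card_ord -prodr_const.
apply: ler_prod => i _; rewrite mulr_ge0//=; last exact: ltW.
have -> : m * l = m * (a i + l - a i) by congr (_ * _); ring.
by apply: hm; rewrite ?lerDl.
Qed.

End gaussian_boxes.

Section grid.
Variables (R : realType) (t : R).
Hypothesis t0 : 0 < t.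

Definition mesh (q : nat) : R := t / 3 / (2 ^ q)%:R.

Definition grid (q j : nat) : R := t / 3 + j%:R * mesh q.

(** The first and the last interval carry the approach to the ball and the
    departure from it, the equal ones in between carry the confinement. *)
Definition walk_time (q k : nat) : R :=
  if k is k'.+1 then if (k' <= 2 ^ q)%N then grid q k' else t else 0.

Lemma pow2_neq0 q : (2 ^ q)%:R != 0 :> R.
Proof. by rewrite pnatr_eq0 expn_eq0. Qed.

Lemma mesh_gt0 q : 0 < mesh q.
Proof. by rewrite !divr_gt0// ltr0n expn_gt0. Qed.

Lemma grid0 q : grid q 0 = t / 3. Proof. by rewrite /grid mul0r addr0. Qed.

Lemma grid_last q : grid q (2 ^ q) = 2 * t / 3.
Proof. by rewrite /grid /mesh; have := pow2_neq0 q => h; field. Qed.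

Lemma grid_le q i j : (i <= j)%N -> grid q i <= grid q j.
Proof. by move=> ij; rewrite lerD2l ler_wpM2r ?ler_nat// ltW// mesh_gt0. Qed.

Lemma gridS q j : grid q j.+1 - grid q j = mesh q.
Proof. by rewrite /grid -natr1; ring. Qed.

Lemma grid_ge0 q j : 0 <= grid q j.
Proof. by rewrite addr_ge0 ?divr_ge0// ?mulr_ge0// ltW// mesh_gt0. Qed.

Lemma grid_refine q q' j : (q <= q')%N -> (j <= 2 ^ q)%N ->
  exists2 j', (j' <= 2 ^ q')%N & grid q j = grid q' j'.
Proof.
move=> qq jq; exists (j * 2 ^ (q' - q))%N.
  by rewrite -[in leqRHS](subnKC qq) expnD leq_mul2r jq orbT.
rewrite /grid /mesh (_ : (2 ^ q')%:R = (2 ^ q)%:R * (2 ^ (q' - q))%:R :> R) ?natrM; last first.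
  by rewrite -natrM -expnD subnKC.
have h1 := pow2_neq0 q; have h2 := pow2_neq0 (q' - q).
by congr (_ + _); field; rewrite ?h1 ?h2.
Qed.

Lemma walk_time_ge0 q k : 0 <= walk_time q k.
Proof. by case: k => //= k; case: ifP => _; rewrite ?grid_ge0// ltW. Qed.

Lemma walk_time_le q k : walk_time q k <= walk_time q k.+1.
Proof.
case: k => [|k]/=; first exact: grid_ge0.
case: (ltnP k (2 ^ q)) => kq; first by rewrite (ltnW kq) grid_le.
case: ifP => // kq'; have -> : k = (2 ^ q)%N by apply/eqP; rewrite eqn_leq kq kq'.
by rewrite grid_last ler_pdivrMr//; have := t0; lra.
Qed.

Lemma mesh_small (e : R) : 0 < e -> exists q0, forall q, (q0 <= q)%N -> mesh q <= e.
Proof.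
move=> e0; pose q0 := Num.bound (t / 3 / e); exists q0 => q qq.
have te : 0 <= t / 3 / e by rewrite !divr_ge0// ltW.
have h := archi_boundP te; rewrite -/q0 in h.
rewrite /mesh ler_pdivrMr ?ltr0n ?expn_gt0// [leRHS]mulrC -ler_pdivrMr//.
apply: (le_trans (ltW h)); rewrite ler_nat (leq_trans qq)// ltnW// ltn_expl//.
Qed.

Lemma grid_dense (s e : R) : t / 3 <= s <= 2 * t / 3 -> 0 < e ->
  exists q j, (j <= 2 ^ q)%N /\ `|grid q j - s| <= e.
Proof.
move=> /andP[s1 s2] e0; have [q hq] := mesh_small e0.
have {}hq := hq q (leqnn q); have m0 := mesh_gt0 q.
pose z := (s - t / 3) / mesh q; have z0 : 0 <= z by rewrite divr_ge0 ?subr_ge0// ltW.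
exists q, (Num.truncn z); have /andP[h1 h2] := truncn_itv z0.
have zE : z * mesh q = s - t / 3 by rewrite /z divfK// lt0r_neq0.
split.
  rewrite -(ler_nat R); apply: (le_trans h1).
  rewrite -(ler_pM2r m0) zE /mesh [leRHS]mulrC divfK ?pow2_neq0//; lra.
rewrite /grid ler_norml; rewrite -natr1 in h2; nra.
Qed.

End grid.

Section confinement.
Context d (T : measurableType d) (R : realType) (P : probability T R) (N : nat).
Variables (x : 'rV[R]_N) (B : R -> T -> 'rV[R]_N) (t : R).
Hypothesis hB : brownian_motion P x B.
Hypothesis t0 : 0 < t.

Lemma brownian_coord_measurable s i : 0 <= s ->
  measurable_fun [set: T] (fun w => B s w ord0 i).
Proof.
by move=> s0; exact: (measurableT_comp (borelRn_coord_measurable i) (bm_measurable hB s0)).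
Qed.

Let incr q k w := B (walk_time t q k.+1) w - B (walk_time t q k) w.
Let pos q k w := x + (B (walk_time t q k) w - B 0 w).

Lemma diff_measurable s s' i : 0 <= s -> 0 <= s' ->
  measurable_fun [set: T] (fun w => (B s w - B s' w) ord0 i).
Proof.
move=> s0 s'0; under eq_fun do rewrite !mxE.
by apply: measurable_funB; exact: brownian_coord_measurable.
Qed.

Let incr_measurable q k i : measurable_fun [set: T] (fun w => incr q k w ord0 i).
Proof. by apply: diff_measurable; exact: walk_time_ge0. Qed.

Let incr_indep q n : mutually_independent P (fun k : 'I_n => incr q k).
Proof. by apply: (bm_independent hB); [exact: walk_time_ge0|move=> k; exact: walk_time_le]. Qed.

Let posE q k w : pos q k w = x + \sum_(j < k) incr q j w.
Proof.
congr (_ + _); elim: k => [|k ih]; first by rewrite big_ord0 subrr.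
by rewrite big_ord_recr/= -ih /incr addrC addrA subrK.
Qed.

Let incr_gauss q j : (0 < j <= 2 ^ q)%N -> centered_gaussian P (mesh t q) (incr q j).
Proof.
case: j => // j /= jq; have := @bm_gaussian _ _ _ _ _ _ _ hB (grid t q j) (grid t q j.+1)
  (grid_ge0 t0 q j); rewrite gridS => h.
rewrite /incr /walk_time jq (ltnW jq); apply: h.
by rewrite -subr_gt0 gridS mesh_gt0.
Qed.

Variables (p : {poly R}) (rho1 k K delta c0 M : R) (A0 A1 : 'I_N -> set R).
Hypothesis k0 : 0 < k.
Hypothesis taylor : forall (eta : R) (y z : 'rV[R]_N), 0 < eta -> k * normsq y <= rho1 ->
    let s := k * normsq y in
    p.[s] + k * p^`().[s] * (2 * dot y z + normsq z)
      + 2 * k ^+ 2 * p^`()^`().[s] * dot y z ^+ 2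
      - K * (eta * normsq z + eta^-1 * \sum_(i < N) z ord0 i ^+ 4)
    <= cutoff p rho1 (k * normsq (y + z)).
Hypothesis K0 : 0 <= K.
Hypothesis delta0 : 0 < delta.
Hypothesis subsol : forall s, 0 <= s <= rho1 ->
  delta <= (radial_half_laplacian N p).[s] + p.[s] / 2.
Hypothesis c00 : 0 <= c0.
Hypothesis M0 : 0 < M.
Hypothesis cM : forall s, 0 <= s -> cutoff p rho1 s <= M.
Hypothesis mA0 : forall i, measurable (A0 i).
Hypothesis mA1 : forall i, measurable (A1 i).
Hypothesis A0c : forall z : 'rV[R]_N, (forall i, A0 i (z ord0 i)) -> c0 <= cutoff p rho1 (k * normsq (x + z)).

Let start := [set w | forall i, A0 i ((B (t / 3) w - B 0 w) ord0 i)].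
Let final := [set w | forall i, A1 i ((B t w - B (2 * t / 3) w) ord0 i)].
Let conf s := [set w | k * normsq (x + (B s w - B 0 w)) <= rho1].
Let confined q := \bigcap_(j in [set j | (j <= 2 ^ q)%N]) conf (grid t q j).

Let conf_measurable s : 0 <= s -> measurable (conf s).
Proof.
move=> s0; rewrite -[X in measurable X]setTI.
have m : measurable_fun [set: T] (fun w => k * normsq (x + (B s w - B 0 w))).
  apply: measurable_funM => //; apply: measurable_sum => i; apply: measurable_funX.
  under eq_fun do rewrite mxE.
  by apply: measurable_funD => //; exact: diff_measurable.
have := m measurableT `]-oo, rho1]%classic (measurable_itv _).
by rewrite (_ : _ @^-1` _ = conf s)//; apply/seteqP; split => w /=; rewrite in_itv.
Qed.

Let confined_measurable q : measurable (confined q).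
Proof.
by apply: bigcap_measurableType => j _; apply: conf_measurable; exact: grid_ge0.
Qed.

Let final_measurable : measurable final.
Proof.
apply: (@coord_event_measurable _ _ _ _ (fun w => B t w - B (2 * t / 3) w)) => // i.
by apply: diff_measurable; rewrite ?divr_ge0 ?mulr_ge0// ltW.
Qed.

Let start_measurable : measurable start.
Proof.
apply: (@coord_event_measurable _ _ _ _ (fun w => B (t / 3) w - B 0 w)) => // i.
by apply: diff_measurable; rewrite ?divr_ge0// ltW.
Qed.

(** The estimate for walks, applied to the increments of B along
    [walk_time t q].  The position is written x + (B s - B 0), which is the
    sum of the increments for every sample point, and equals B s almost surely. *)
Lemma grid_stay_prob q : 4 * K * N%:R * Num.sqrt (mesh t q) <= k * delta ->
  0 <= 1 - k * mesh t q / 2 ->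
  c0 * (1 - k * mesh t q / 2) ^+ (2 ^ q) * fine (P start) * fine (P final) <=
  M * fine (P (confined q `&` final)).
Proof.
move=> sm1 sm2.
have sD0 : <<s past (incr q) 1>> start.
  apply: sub_sigma_algebra; exists (fun=> A0) => //.
  have e0 w : incr q 0 w = B (t / 3) w - B 0 w by rewrite /incr /= grid0.
  apply/seteqP; split => w /=; first by move=> h [|//] _ i; rewrite e0; exact: h.
  by move=> h i; have := h 0%N isT i; rewrite e0.
have := walk_stay_prob (incr_measurable q) (incr_indep q) (posE q) (mesh_gt0 t0 q)
  (@incr_gauss q) k0 taylor subsol sm1 sm2 sD0 _ M0 cM mA1 c00.
have fE : [set w | forall i, A1 i (incr q (2 ^ q).+1 w ord0 i)] = final.
  by rewrite /incr /final /= leqnn ltnn grid_last.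
rewrite fE => h; apply: le_trans (h _) _.
  move=> w sw; apply: A0c => i; have := sw i.
  by rewrite /= grid0.
have -> : stay (pos q) rho1 k start (2 ^ q).+1 `&` final = start `&` (confined q `&` final).
  apply/seteqP; split => w /=.
    move=> [[sw hs] fw]; split => //; split => // j /= jq.
    by have := hs j.+1; rewrite /pos /walk_time ltnS jq; exact.
  move=> [sw [hs fw]]; split => //; split => // -[|j]//= jq.
  by have := hs j jq; rewrite /conf /= /pos /walk_time -ltnS jq.
have mcf : measurable (confined q `&` final) by exact: measurableI.
rewrite ler_wpM2l// ?(ltW M0)//; apply: fine_le; rewrite ?fin_num_measure//.
  exact: measurableI.
by apply: le_measure; rewrite ?inE//; apply: measurableI.
Qed.

Let confined_decr : {homo (fun q => confined q `&` final) : n m / (n <= m)%N >-> (m <= n)%O}.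
Proof.
move=> q q' qq; apply/subsetPset; apply: setSI => w hw j jq.
by have [j' jq' ->] := grid_refine t qq jq; exact: hw.
Qed.

(** The events for successive q decrease, so that the probability of their
    intersection is the limit.  The loss of theta makes up for the difference
    between 1 - y and exp (- y) for a small step y = k h / 2. *)
Lemma path_stay_prob (theta : R) : 0 < theta ->
  measurable (\bigcap_q (confined q `&` final)) /\
  c0 * expR (- ((1 + theta) * (k * (t / 3) / 2))) * fine (P start) * fine (P final) <=
  M * fine (P (\bigcap_q (confined q `&` final))).
Proof.
move=> theta0; set lhs := (X in _ /\ X <= _).
have mE q : measurable (confined q `&` final) by exact: measurableI.
have mC : measurable (\bigcap_q (confined q `&` final)) by exact: bigcap_measurableType.
split => //; suff h : ((lhs / M)%:E <= P (\bigcap_q (confined q `&` final)))%E.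
  by rewrite mulrC -ler_pdivrMr// -lee_fin fineK ?fin_num_measure.
have c := @nonincreasing_cvg_mu _ _ _ P _ _ mE mC confined_decr.
apply: (cvge_ge _ (c _)); last by rewrite ltey_eq fin_num_measure.
(* Bounds on the mesh for the two smallness conditions of the one-step estimate. *)
pose e1 := (k * delta / (4 * K * N%:R + 1)) ^+ 2; pose e2 := 2 * (theta / (1 + theta)) / k.
have KN : 0 < 4 * K * N%:R + 1 by rewrite ltr_wpDl// mulr_ge0// mulr_ge0.
have e10 : 0 < e1 by rewrite exprn_gt0// divr_gt0// mulr_gt0.
have t1 : 0 < 1 + theta by rewrite addr_gt0.
have e20 : 0 < e2 by rewrite divr_gt0// mulr_gt0// divr_gt0.
have e0 : 0 < Num.min e1 e2 by rewrite lt_min e10.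
have [q0 hq0] := mesh_small t0 e0.
exists q0 => // q /= qq; have := hq0 q qq; rewrite le_min => /andP[m1 m2].
have mq := mesh_gt0 t0 q.
have sm1 : 4 * K * N%:R * Num.sqrt (mesh t q) <= k * delta.
  have : Num.sqrt (mesh t q) <= Num.sqrt e1 by rewrite ler_wsqrtr.
  rewrite sqrtr_sqr ger0_norm; last by rewrite divr_ge0// ?mulr_ge0// ltW.
  rewrite ler_pdivlMr// => h; have := sqrtr_ge0 (mesh t q); lra.
have y2 : k * mesh t q / 2 <= theta / (1 + theta).
  by move: m2; rewrite /e2 ler_pdivlMr// => h; lra.
have y0 : 0 <= k * mesh t q / 2 by rewrite divr_ge0// mulr_ge0// ltW.
have th1 : theta / (1 + theta) <= 1 by rewrite ler_pdivrMr// mul1r lerDr.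
have sm2 : 0 <= 1 - k * mesh t q / 2 by lra.
have h := grid_stay_prob sm1 sm2.
rewrite /= -[leRHS]fineK ?fin_num_measure// lee_fin ler_pdivrMr// mulrC.
apply: le_trans h; rewrite /lhs !ler_wpM2r ?fine_ge0// ler_wpM2l//.
have -> : - ((1 + theta) * (k * (t / 3) / 2)) = - ((1 + theta) * (k * mesh t q / 2)) * (2 ^ q)%:R.
  by rewrite /mesh; have := pow2_neq0 R q => hp; field.
by rewrite expRM_natr lerXn2r ?nnegrE ?expR_ge0// expR_le_1minus.
Qed.

End confinement.

(** * Brownian paths confined to a small ball *)

Section confined.
Variables (R : realType) (N : nat).
Hypothesis hN : (3 <= N)%N.

Lemma grid_le_limit (t s c : R) (f : R -> R) : 0 < t -> t / 3 <= s <= 2 * t / 3 ->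
  {for s, continuous f} -> (forall q j, (j <= 2 ^ q)%N -> f (grid t q j) <= c) -> f s <= c.
Proof.
move=> t0 hs cf h; rewrite leNgt; apply/negP => cs.
have /cf /nbhs_ballP[e /= e0 he] : nbhs (f s) [set y | c < y].
  exact: lt_nbhsr.
have e20 : 0 < e / 2 by rewrite divr_gt0.
have [q [j [jq hj]]] := grid_dense t0 hs e20.
have := he (grid t q j); rewrite /= /ball/= distrC => /(_ _)/wrap[].
  by apply: (le_lt_trans hj); rewrite ltr_pdivrMr// ltr_pMr// ltr1n.
by rewrite ltNge h.
Qed.

Lemma within_pos_continuous (f : R -> 'rV[R]_N) (s : R) (i : 'I_N) : 0 < s ->
  {within `[0, +oo[, continuous f} -> {for s, continuous (fun s => f s ord0 i)}.
Proof.
move=> s0 cf.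
have sub : `]0, +oo[ `<=` (`[0, +oo[ : set R).
  by move=> y /=; rewrite !in_itv/= !andbT => /ltW.
have := continuous_subspaceW sub cf.
rewrite continuous_open_subspace; last exact: interval_open.
have sin : s \in `]0, +oo[%classic by rewrite inE/= in_itv/= andbT.
move=> /(_ s sin) cs.
apply: (@continuous_comp _ _ _ f (fun y : 'rV[R]_N => y ord0 i)) => //.
exact: coord_continuous.
Qed.

Lemma normsq_path_continuous (f : R -> 'rV[R]_N) (s : R) : 0 < s ->
  {within `[0, +oo[, continuous f} -> {for s, continuous (fun s => normsq (f s))}.
Proof.
move=> s0 cf; rewrite /continuous_at /normsq.
apply: cvg_big; first exact: add_continuous.
move=> i _.
apply: (@continuous_comp _ _ _ (fun s => f s ord0 i) (fun y => y ^+ 2)).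
  exact: within_pos_continuous.
exact: exprn_continuous.
Qed.

Lemma normr_le_sqr (a r : R) : 0 < r -> a ^+ 2 <= r ^+ 2 -> `|a| <= r.
Proof. by move=> r0 h; rewrite ler_norml; apply/andP; split; nra. Qed.

Lemma coord_sqr_le_normsq (y : 'rV[R]_N) i : y ord0 i ^+ 2 <= normsq y.
Proof.
by rewrite /normsq (bigD1 i)//= lerDl; apply: sumr_ge0 => j _; rewrite sqr_ge0.
Qed.

(** With k = rho1 / r^2 the ball of radius r is {k |y|^2 <= rho1}, and the
    factor lost along [t / 3, 2 t / 3] is
    exp (- (1 + theta) k t / 6) with theta = rho / rho1 - 1, so that only the
    prescribed rho appears.  C is independent of r: the box in which
    the path must be at time t / 3 has side proportional to r, and the increment
    after time 2 t / 3 has to hit a fixed box. *)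
Lemma brownian_confined d (T : measurableType d) (P : probability T R)
    (x : 'rV[R]_N) (B : R -> T -> 'rV[R]_N) (t rho e : R) (y0 : 'rV[R]_N) :
  brownian_motion P x B -> 0 < t -> bessel_j1 ((N%:R - 2) / 2) ^+ 2 < rho -> 0 < e ->
  exists C r1 : R, [/\ 0 < C, 0 < r1 & forall r, 0 < r -> r < r1 ->
    exists E : set T, [/\ measurable E,
      C * r ^+ N * expR (- (rho * (t / 3) / (2 * r ^+ 2))) <= fine (P E) &
      forall w, E w -> B 0 w = x -> {within `[0, +oo[, continuous (fun s => B s w)} ->
        (forall s, t / 3 <= s <= 2 * t / 3 -> normsq (B s w) <= r ^+ 2) /\
        (forall i, `|B t w ord0 i - y0 ord0 i| <= e)]].
Proof.
move=> hB t0 rhoj e0.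
have [p [rho1 [rho2 [delta [/andP[rho10 rho1r] r12 d0 p00 [ple sub]]]]]] :=
  polynomial_subsolution hN rhoj.
have [s0 [s00 s0r hs0]] : exists s0, [/\ 0 < s0, s0 <= rho1 & forall s, 0 <= s <= s0 -> p.[0] / 2 <= p.[s]].
  have cp : {for 0, continuous (horner p)} by apply: continuous_horner.
  have hp : p.[0] / 2 < p.[0] by rewrite ltr_pdivrMr// ltr_pMr// ltr1n.
  have /cp /nbhs_ballP[s1 /= s10 hs1] : nbhs p.[0] [set y | p.[0] / 2 < y].
    exact: lt_nbhsr.
  exists (Num.min rho1 (s1 / 2)); split; first by rewrite lt_min rho10 divr_gt0.
    by rewrite ge_min lexx.
  move=> s /andP[s0]; rewrite le_min => /andP[_ ss]; apply/ltW/hs1.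
  by rewrite /ball/= sub0r normrN ger0_norm//; lra.
have [M M0 hM] := cutoff_ub p rho1.
have NR0 : 0 < N%:R :> R by rewrite ltr0n (leq_trans _ hN).
pose L := \sum_(i < N) `|x ord0 i| + 1.
have hL i : `|x ord0 i| + 1 <= L.
  by rewrite lerD2r (bigD1 i)//= lerDl sumr_ge0.
pose L1 := \sum_(i < N) `|y0 ord0 i| + e.
have hL1 i : `|y0 ord0 i| + e <= L1.
  by rewrite lerD2r (bigD1 i)//= lerDl sumr_ge0.
have t30 : 0 < t / 3 - 0 by rewrite subr0 divr_gt0.
have t31 : 0 < t - 2 * t / 3 by lra.
have [m m0 hm] := gaussian_box_ge N L t30.
have [m1 m10 hm1] := gaussian_box_ge N L1 t31.
(* Coordinates bounded by sg r give k |y|^2 <= s0, i.e. a value of the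
   subsolution above half of its value at the origin. *)
pose sg := Num.min 1 (s0 / (rho1 * N%:R)).
have sg0 : 0 < sg by rewrite lt_min ltr01 divr_gt0// mulr_gt0.
have sg1 : sg <= 1 by rewrite ge_min lexx.
have sgs : sg * (rho1 * N%:R) <= s0.
  by rewrite -ler_pdivlMr ?mulr_gt0// ge_min lexx orbT.
pose c0 := p.[0] / 2; have c00 : 0 < c0 by rewrite divr_gt0.
exists (c0 * (m * (2 * sg)) ^+ N * (m1 * e) ^+ N / M), (Num.min 1 (e / 2)); split.
- by rewrite divr_gt0// !mulr_gt0// exprn_gt0// !mulr_gt0.
- by rewrite lt_min ltr01 divr_gt0.
move=> r r0; rewrite lt_min => /andP[r1 re].
pose k := rho1 / r ^+ 2.
have r20 : 0 < r ^+ 2 by rewrite exprn_gt0.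
have k0 : 0 < k by rewrite divr_gt0.
have [K K0 taylor] := radial_cutoff_taylor N rho10 r12 ple k0.
pose theta := rho / rho1 - 1.
have theta0 : 0 < theta by rewrite subr_gt0 ltr_pdivlMr// mul1r.
pose A0 i := `[- x ord0 i - sg * r, - x ord0 i - sg * r + 2 * sg * r]%classic.
pose A1 i := `[y0 ord0 i - e / 2, y0 ord0 i - e / 2 + e]%classic.
have mA0 i : measurable (A0 i) by exact: measurable_itv.
have mA1 i : measurable (A1 i) by exact: measurable_itv.
have A0c (z : 'rV[R]_N) : (forall i, A0 i (z ord0 i)) -> c0 <= cutoff p rho1 (k * normsq (x + z)).
  move=> hz; have hq : k * normsq (x + z) <= s0.
    have : normsq (x + z) <= N%:R * (sg * r) ^+ 2.
      rewrite mulrC mulr_natr -[N in leRHS]card_ord -sumr_const; apply: ler_sum => i _.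
      have := hz i; rewrite /A0 /= in_itv/= => /andP[h1 h2].
      by rewrite mxE; nra.
    move=> h; apply: le_trans (ler_wpM2l (ltW k0) h) _; apply: le_trans sgs.
    rewrite /k [leLHS](_ : _ = sg ^+ 2 * (rho1 * N%:R)); last by field; rewrite lt0r_neq0.
    by rewrite ler_wpM2r ?mulr_ge0// ?(ltW rho10)// expr2 ler_piMl// ltW.
  have q0 : 0 <= k * normsq (x + z) by rewrite mulr_ge0 ?normsq_ge0// ltW.
  apply: le_trans (cutoff_ge_poly ple _); first by apply: hs0; rewrite q0.
  by apply: (le_trans hq); apply: (le_trans s0r); exact: ltW.
have key := path_stay_prob hB t0 k0 taylor K0 d0 sub (ltW c00) M0 hM mA0 mA1 A0c theta0.
move: key => /=; set E := \bigcap_q _ => -[mE key]; exists E.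
have kE : (1 + theta) * (k * (t / 3) / 2) = rho * (t / 3) / (2 * r ^+ 2).
  by rewrite /theta /k; field; rewrite !lt0r_neq0.
rewrite kE in key.
have hP0 : (m * (2 * sg)) ^+ N * r ^+ N <=
    fine (P [set w | forall i, A0 i ((B (t / 3) w - B 0 w) ord0 i)]).
  rewrite -exprMn [X in X ^+ N](_ : _ = m * (2 * sg * r)); last by ring.
  have sgr1 : sg * r <= 1 by rewrite mulr_ile1 ?(ltW sg0) ?(ltW r0) ?(ltW r1).
  apply: (hm _ T P (fun w => B (t / 3) w - B 0 w) (fun i => - x ord0 i - sg * r)).
  - by apply: (bm_gaussian hB (lexx 0)); rewrite divr_gt0.
  - by rewrite mulr_ge0 ?(ltW r0)// mulr_ge0// ltW.
  - move=> i; have := hL i; have := ler_norm (x ord0 i); lra.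
  - move=> i; have := hL i; have := ler_norm (- x ord0 i); rewrite normrN; clear -sgr1; lra.
have hP1 : (m1 * e) ^+ N <=
    fine (P [set w | forall i, A1 i ((B t w - B (2 * t / 3) w) ord0 i)]).
  apply: (hm1 _ T P (fun w => B t w - B (2 * t / 3) w) (fun i => y0 ord0 i - e / 2)).
  - apply: (bm_gaussian hB); last by rewrite -subr_gt0.
    by rewrite divr_ge0// mulr_ge0// ltW.
  - exact: ltW.
  - move=> i; have := hL1 i; have := ler_norm (- y0 ord0 i); rewrite normrN; lra.
  - move=> i; have := hL1 i; have := ler_norm (y0 ord0 i); lra.
have pe : 0 < expR (- (rho * (t / 3) / (2 * r ^+ 2))) by exact: expR_gt0.
split => //.
- rewrite -(ler_pM2l M0); apply: le_trans key.
  rewrite [leLHS](_ : _ = c0 * expR (- (rho * (t / 3) / (2 * r ^+ 2))) *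
    (((m * (2 * sg)) ^+ N * r ^+ N) * (m1 * e) ^+ N)); last first.
    move: pe; move: (expR _) ((m * _) ^+ N) ((m1 * e) ^+ N) (r ^+ N) => a b c d' _.
    by field; rewrite lt0r_neq0.
  rewrite -[leRHS]mulrA ler_wpM2l//; first by rewrite mulr_ge0 ?(ltW c00)// ltW.
  apply: ler_pM => //; rewrite ?mulr_ge0 ?exprn_ge0 ?mulr_ge0// ltW//.
move=> w Ew B0 cB.
have conf s : t / 3 <= s <= 2 * t / 3 -> normsq (B s w) <= r ^+ 2.
  move=> hs; have s_gt0 : 0 < s by case/andP: hs => + _; apply: lt_le_trans; rewrite divr_gt0.
  apply: (@grid_le_limit t s _ (fun s => normsq (B s w)) t0 hs).
    exact: normsq_path_continuous.
  move=> q j jq; have [/(_ j jq) + _] := Ew q I.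
  rewrite /= B0 addrC subrK /k mulrAC ler_pdivrMr// ler_pM2l//.
split => // i; have [_ /(_ i)] := Ew 0%N I.
rewrite /A1 /= in_itv/= !mxE => /andP[h1 h2].
have h3 : normsq (B (2 * t / 3) w) <= r ^+ 2 by apply: conf; clear -t0; lra.
have h4 := le_trans (coord_sqr_le_normsq _ i) h3.
have /ler_normlP[h5 h6] : `|B (2 * t / 3) w ord0 i| <= r.
  exact: normr_le_sqr.
rewrite ler_norml; clear -re h1 h2 h5 h6; lra.
Qed.

End confined.

(** * The time spent by a Brownian path in a null set *)

Section null_cover.
Variables (R : realType) (N : nat).
Hypothesis N0 : (0 < N)%N.
Local Open Scope ereal_scope.

Let box0 : 'rV[R]_N * 'rV[R]_N := (0, 0)%R.

Let box0_vol : box_vol box0 = 0%R.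
Proof.
by rewrite /box_vol (bigD1 (Ordinal N0))//= mxE subrr max_l ?mul0r.
Qed.

(** Coverings by a countable set of boxes are turned into sequences, completed
    by an empty box. *)
Lemma null_cover (Z : set 'rV[R]_N) : lebesgue_outer Z = 0 ->
  exists p : nat -> nat -> 'rV[R]_N * 'rV[R]_N, forall k : nat,
    Z `<=` \bigcup_n box (p k n) /\
    \sum_(0 <= n <oo) (box_vol (p k n))%:E <= (k.+1%:R^-1)%:E.
Proof.
move=> Z0.
suff H k : exists p : nat -> 'rV[R]_N * 'rV[R]_N, Z `<=` \bigcup_n box (p n) /\
    \sum_(0 <= n <oo) (box_vol (p n))%:E <= (k.+1%:R^-1)%:E.
  have [p hp] := choice H; exists p => k; exact: hp.
have k0 : (0 < k.+1%:R^-1 :> R)%R by rewrite invr_gt0.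
have fZ : lebesgue_outer Z \is a fin_num by rewrite Z0.
have [_ [D [cD ZD] <-]] := lb_ereal_inf_adherent k0 fZ.
rewrite -/(lebesgue_outer Z) Z0 add0e => /ltW hD.
have /countable_injP[f finj] := cD.
pose F n := [set p | D p /\ f p = n].
pose p n := xget box0 (F n); exists p; split.
  move=> z /ZD[q Dq qz]; exists (f q) => //; rewrite /p.
  case: xgetP => [q' _ [Dq' fq']|/(_ q)]; last by move=> /(_ _)/wrap[].
  by rewrite (finj q' q) ?inE.
apply: le_trans hD; rewrite (_ : D = \bigcup_n F n); last first.
  by apply/seteqP; split => [q Dq|q [n _ []]//]; exists (f q).
rewrite nneseries_sum_bigcup//; last 2 first.
  - by apply/trivIsetP => i j _ _ ij; rewrite -subset0 => q [[_ h1] [_ h2]]; move/eqP: ij; rewrite -h1 -h2.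
  - by move=> q; exact: box_vol_ge0.
apply: lee_nneseries => n _; first by move=> _; exact: box_vol_ge0.
rewrite /p; case: xgetP => [q _ Fq|_]; last by rewrite box0_vol; apply: esum_ge0 => q _; exact: box_vol_ge0.
rewrite (_ : F n = [set q]) ?esum_set1 ?box_vol_ge0//.
apply/seteqP; split => [q' [Dq' fq']|q' ->//] /=.
by apply: finj; rewrite ?inE//; [exact: Fq.1|rewrite fq' Fq.2].
Qed.

End null_cover.

Section fubini_null.
Context d (T : measurableType d) (R : realType) (P : probability T R).
Notation mu := (@lebesgue_measure R).
Local Open Scope ereal_scope.

Lemma fubini_null (S : set (measurableTypeR R * T)) : measurable S ->
  (forall s, P (xsection S s) = 0) -> {ae P, forall w, mu (ysection S w) = 0}.
Proof.
move=> mS hS.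
have mf : measurable_fun setT (fun z => (\1_S z)%:E : \bar R).
  by apply/measurable_EFinP; exact: measurable_indic.
have f0 (z : measurableTypeR R * T) : 0 <= (\1_S z)%:E :> \bar R by rewrite lee_fin indicE.
have := fubini_tonelli (m1 := mu) (m2 := P) _ mf f0.
have -> : \int[mu]_s \int[P]_w (\1_S (s, w))%:E = 0.
  apply: integral0_eq => s _; rewrite -[RHS](hS s).
  rewrite -[xsection S s]setIT -integral_indic//; last exact: measurable_xsection.
  by apply: eq_integral => w _; rewrite !indicE mem_xsection.
have e w : \int[mu]_s (\1_S (s, w))%:E = mu (ysection S w).
  rewrite -[ysection S w]setIT -integral_indic//; last exact: measurable_ysection.
  by apply: eq_integral => s _; rewrite !indicE mem_ysection.
under eq_integral do rewrite e.
move=> /esym h0.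
have [h _] := ae_eq_integral_abs P measurableT (measurable_fun_ysection mu mS).
have /h : \int[P]_w `|mu (ysection S w)| = 0.
  by rewrite -[RHS]h0; apply: eq_integral => w _; rewrite gee0_abs.
by apply: filterS => w /(_ I).
Qed.

End fubini_null.

Section occupation.
Context d (T : measurableType d) (R : realType) (P : probability T R) (N : nat).
Variables (x : 'rV[R]_N) (B : R -> T -> 'rV[R]_N) (t : R).
Hypothesis hB : brownian_motion P x B.
Hypothesis t0 : 0 < t.
Notation mu := (@lebesgue_measure R).

Let Y s w := x + (B s w - B 0 w).

Lemma normal_prob_itv_le (v a b : R) : 0 < v ->
  (normal_prob 0 v `]a, b] <= (normal_peak v * Num.max 0 (b - a))%:E)%E.
Proof.
move=> v0; have vn0 := lt0r_neq0 v0.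
have -> : (normal_peak v * Num.max 0 (b - a))%:E =
    (\int[mu]_(y in `]a, b]) (cst (normal_peak v)%:E y))%E.
  rewrite integral_cst//= lebesgue_measure_itv/= lte_fin.
  case: ltP => ab; first by rewrite -EFinB -EFinM max_r// subr_ge0 ltW.
  by rewrite max_l ?mulr0 ?mule0// subr_le0.
apply: ge0_le_integral => //=.
- by move=> y _; rewrite lee_fin normal_pdf_ge0.
- by apply/measurable_EFinP; apply: measurable_funTS; exact: measurable_normal_pdf.
- by move=> y _; rewrite lee_fin normal_pdf_ub.
Qed.

Lemma box_prob_le s (p : 'rV[R]_N * 'rV[R]_N) : 0 < s ->
  (P [set w | box p (Y s w)] <= (normal_peak (Num.sqrt s) ^+ N * box_vol p)%:E)%E.
Proof.
move=> s0.
have -> : [set w | box p (Y s w)] = [set w | forall i,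
    `]p.1 ord0 i - x ord0 i, p.2 ord0 i - x ord0 i]%classic ((B s w - B 0 w) ord0 i)].
  apply/seteqP; split => w /= h i; have := h i; rewrite ?in_itv/= /Y !mxE => /andP[h1 h2];
    apply/andP; split; lra.
rewrite (bm_gaussian hB (lexx 0) s0 (A := fun i => `]p.1 ord0 i - x ord0 i, p.2 ord0 i - x ord0 i]%classic))//.
rewrite subr0 /box_vol -[N in _ ^+ N]card_ord -prodr_const -big_split/=.
rewrite (eq_bigr (fun i => (fine (normal_prob 0 (Num.sqrt s)
    `]p.1 ord0 i - x ord0 i, p.2 ord0 i - x ord0 i]))%:E)); last first.
  by move=> i _; rewrite fineK//; exact: (fin_num_measure (normal_prob 0 (Num.sqrt s))).
rewrite prodEFin lee_fin; apply: ler_prod => i _; rewrite fine_ge0//=.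
rewrite -lee_fin fineK; last exact: (fin_num_measure (normal_prob 0 (Num.sqrt s))).
have -> : p.2 ord0 i - p.1 ord0 i = p.2 ord0 i - x ord0 i - (p.1 ord0 i - x ord0 i) by ring.
by apply: normal_prob_itv_le; rewrite sqrtr_gt0.
Qed.

Variable G : set T.
Hypothesis mG : measurable G.
Hypothesis Gc : forall w, G w -> {within `[0, +oo[, continuous (fun s => B s w)}.
Let D : set (measurableTypeR R * T) := `[t / 3, 2 * t / 3] `*` G.

Let Yc s i : 0 <= s -> measurable_fun [set: T] (fun w => Y s w ord0 i).
Proof.
move=> s0; under eq_fun do rewrite mxE.
by apply: measurable_funD => //; exact: (diff_measurable hB).
Qed.

(** The path is the limit of the step functions that take the value of B at
    the last grid point, by continuity on the event G. *)
Lemma path_jointly_measurable i :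
  measurable_fun D (fun z : measurableTypeR R * T => Y z.1 z.2 ord0 i).
Proof.
pose g q (z : measurableTypeR R * T) := \sum_(j < (2 ^ q).+1)
  \1_(`[grid t q j, grid t q j.+1[) z.1 * Y (grid t q j) z.2 ord0 i.
apply: (@measurable_fun_cvg _ _ _ _ g).
  move=> q; apply: measurable_funTS; apply: measurable_sum => j.
  apply: measurable_funM.
    by apply: (measurableT_comp _ measurable_fst); exact: measurable_indic.
  by apply: (measurableT_comp (Yc i (grid_ge0 t0 q j)) measurable_snd).
move=> [s w] [/= hs Gw]; move: hs; rewrite in_itv/= => hs.
have s0 : 0 < s by case/andP: hs => + _; apply: lt_le_trans; rewrite divr_gt0.
have gE q : exists j, g q (s, w) = Y (grid t q j) w ord0 i /\ `|grid t q j - s| <= mesh t q.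
  case/andP: hs => hs1 hs2; have m0 := mesh_gt0 t0 q.
  pose z := (s - t / 3) / mesh t q; have z0 : 0 <= z by rewrite divr_ge0 ?subr_ge0// ltW.
  have /andP[h1 h2] := truncn_itv z0; set j := Num.truncn z in h1 h2.
  have zE : z * mesh t q = s - t / 3 by rewrite /z divfK// lt0r_neq0.
  have jq : (j < (2 ^ q).+1)%N.
    rewrite ltnS -(ler_nat R); apply: (le_trans h1).
    rewrite -(ler_pM2r m0) zE /mesh [leRHS]mulrC divfK ?pow2_neq0//; lra.
  have g1 : grid t q j <= s by rewrite /grid; nra.
  have g2 : s < grid t q j.+1 by rewrite /grid; nra.
  exists j; split; last first.
    by have := gridS t q j; rewrite ler_norml => ?; lra.
  rewrite /g (bigD1 (Ordinal jq))//= indicE mem_set ?mul1r; last first.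
    by rewrite /= in_itv/= g1.
  rewrite big1 ?addr0// => j' /eqP jj'; rewrite indicE memNset ?mul0r//=.
  rewrite in_itv/= => /andP[g3 g4]; apply: jj'; apply/val_inj => /=.
  apply/eqP; rewrite eqn_leq; apply/andP; split; rewrite leqNgt; apply/negP => lt.
    by have := grid_le t0 q lt; rewrite leNgt (le_lt_trans g3).
  by have := grid_le t0 q lt; rewrite leNgt (le_lt_trans g1).
have cY : {for s, continuous (fun s => Y s w ord0 i)}.
  rewrite (_ : (fun s => _) = (fun s => x ord0 i + (B s w ord0 i - B 0 w ord0 i))); last first.
    by apply/funext => s'; rewrite /Y !mxE.
  apply: cvgD; first exact: cvg_cst.
  by apply: cvgB; [exact: within_pos_continuous s0 (Gc Gw)|exact: cvg_cst].
apply/cvgrPdist_le => e e0.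
have [dl /= dl0 hdl] : \forall s' \near s, `|Y s w ord0 i - Y s' w ord0 i| <= e.
  by move/cvgrPdist_le : cY; apply.
have dl20 : 0 < dl / 2 by rewrite divr_gt0.
have [q0 hq0] := mesh_small t0 dl20.
exists q0 => // q /= qq; have [j [-> hj]] := gE q; apply: hdl.
rewrite /ball/= distrC; apply: (le_lt_trans hj); apply: (le_lt_trans (hq0 q qq)).
by rewrite ltr_pdivrMr// ltr_pMr// ltr1n.
Qed.

(** The measurable set S contains the pairs (s, w) such that the path is in Z at
    time s.  Its sections at a fixed time are covered by box events of
    arbitrarily small total probability, so they are null, and Fubini's theorem
    exchanges the variables. *)
Lemma occupation_null (Z : set 'rV[R]_N) : (0 < N)%N -> (lebesgue_outer Z = 0)%E ->
  P (~` G) = 0%E -> (forall w, G w -> B 0 w = x) ->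
  {ae P, forall w, mu.-negligible [set s | t / 3 <= s <= 2 * t / 3 /\ Z (B s w)]}.
Proof.
move=> N0 Z0 PG GB0.
have [p hp] := null_cover N0 Z0.
have mbox k n : measurable (D `&` [set z | box (p k n) (Y z.1 z.2)]).
  have -> : D `&` [set z | box (p k n) (Y z.1 z.2)] = D `&` \bigcap_(i in [set: 'I_N])
     (D `&` (fun z : measurableTypeR R * T => Y z.1 z.2 ord0 i) @^-1`
       `](p k n).1 ord0 i, (p k n).2 ord0 i]%classic).
    apply/seteqP; split => z [Dz hz]; split => // i.
      by move=> _; split => //=; rewrite in_itv/=; exact: hz.
    by have [_] := hz i I; rewrite /= in_itv/=.
  have mD : measurable D by apply: measurableX.
  apply: measurableI => //; apply: fin_bigcap_measurable => // i _.
  exact: path_jointly_measurable.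
pose S := \bigcap_k \bigcup_n (D `&` [set z | box (p k n) (Y z.1 z.2)]).
have mS : measurable S.
  by apply: bigcapT_measurable => k; apply: bigcupT_measurable => n; exact: mbox.
have hS s : P (xsection S s) = 0%E.
  have [hs|hs] := boolP (t / 3 <= s <= 2 * t / 3); last first.
    rewrite (_ : xsection S s = set0) ?measure0//; apply/seteqP; split => // w.
    rewrite xsectionE => /(_ 0%N I)[n _ [[/= + _] _]].
    by rewrite in_itv/=; exact/negP.
  have s0 : 0 < s by case/andP: hs => + _; apply: lt_le_trans; rewrite divr_gt0.
  have mx : measurable (xsection S s) by exact: measurable_xsection.
  apply/eqP; rewrite eq_le measure_ge0 andbT.
  pose c := normal_peak (Num.sqrt s) ^+ N.
  have c0 : 0 <= c by rewrite exprn_ge0// normal_peak_ge0.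
  have hk k : (P (xsection S s) <= (c * k.+1%:R^-1)%:E)%E.
    have [_ hpk] := hp k.
    have mb n : measurable [set w | box (p k n) (Y s w)].
      apply: (@coord_event_measurable _ _ _ _ (fun w => Y s w)
        (fun i => `](p k n).1 ord0 i, (p k n).2 ord0 i]%classic)) => // i.
      exact/Yc/ltW.
    apply: (@le_trans _ _ (\sum_(0 <= n <oo) P [set w | box (p k n) (Y s w)])%E).
      apply: measure_sigma_subadditive => // w.
      by rewrite xsectionE => /(_ k I)[n _ [_ hn]]; exists n.
    apply: (@le_trans _ _ (\sum_(0 <= n <oo) (c%:E * (box_vol (p k n))%:E))%E).
      by apply: lee_nneseries => // n _; exact: box_prob_le.
    rewrite nneseriesZl//; last by move=> n _; exact: box_vol_ge0.
    by rewrite EFinM lee_wpmul2l// lee_fin.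
  rewrite -[X in (X <= _)%E]fineK ?fin_num_measure// lee_fin leNgt; apply/negP => pos.
  have cp0 : 0 <= c / fine (P (xsection S s)) by rewrite divr_ge0// ltW.
  have := archi_boundP cp0; set k := Num.bound _ => hb.
  have := hk k; rewrite -[X in (X <= _)%E]fineK ?fin_num_measure// lee_fin.
  rewrite ler_pdivlMr// leNgt => /negP; apply.
  rewrite ltr_pdivrMr// in hb; apply: (lt_le_trans hb).
  by rewrite [leRHS]mulrC ler_wpM2r// ?(ltW pos)// ler_nat.
have := fubini_null mS hS.
have : {ae P, forall w, G w} by exists (~` G); split => //; exact: measurableC.
apply: filterS2 => w Gw h0; exists (ysection S w); split => //.
  exact: measurable_ysection.
move=> s /= [hs Zs]; rewrite ysectionE /= => k _.
have [/(_ _ Zs)[n _ hn] _] := hp k; exists n => //; split.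
  by split => //=; rewrite in_itv.
by rewrite /= /Y GB0// addrC subrK.
Qed.

End occupation.

(** * Explosion of the Feynman-Kac functional *)

Section lower_integral.
Context d (T : measurableType d) (R : realType) (mu : {measure set T -> \bar R}).
Local Open Scope ereal_scope.

(** The integral of a nonnegative function is a supremum over the simple
    functions below it, whether or not the function is measurable; the
    integrands of the Feynman-Kac formula need not be. *)
Lemma ge0_integral_mono (D D' : set T) (f g : T -> \bar R) : D `<=` D' ->
  (forall x, D x -> 0 <= f x) -> (forall x, D' x -> 0 <= g x) ->
  (forall x, D x -> f x <= g x) ->
  \int[mu]_(x in D) f x <= \int[mu]_(x in D') g x.
Proof.
move=> DD f0 g0 fg; rewrite !ge0_integralE//; apply: ereal_sup_le => _ [h hf <-].
exists h => //= x; apply: le_trans (hf x) _; rewrite !patchE.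
case: (boolP (x \in D)) => [/set_mem Dx|_]; first by rewrite mem_set ?fg//; exact: DD.
by case: (boolP (x \in D')) => // /set_mem; exact: g0.
Qed.

Lemma ge0_integral_ge (D E : set T) (f : T -> \bar R) (c : R) : measurable E -> E `<=` D ->
  (0 <= c)%R -> (forall x, D x -> 0 <= f x) ->
  mu.-negligible [set x | E x /\ ~ (c%:E <= f x)] ->
  c%:E * mu E <= \int[mu]_(x in D) f x.
Proof.
move=> mE ED c0 f0 [A [mA A0 hA]].
have mEA : measurable (E `\` A) by exact: measurableD.
have -> : mu E = mu (E `\` A).
  apply/eqP; rewrite eq_le; apply/andP; split; last first.
    by apply: le_measure; rewrite ?inE//; exact: subDsetl.
  rewrite -[leRHS]adde0 -A0; apply: (le_trans _ (measureU2 mu mEA mA)).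
  apply: le_measure; rewrite ?inE//; first exact: measurableU.
  by move=> x Ex; have [|] := pselect (A x); [right|left].
rewrite -integral_cst//; apply: ge0_integral_mono => //.
- by move=> x [Ex _]; exact: ED.
- by move=> x [Ex nA]; apply: contrapT => h; apply: nA; exact: hA.
Qed.

End lower_integral.

Section singularity.
Variables (R : realType) (N : nat).
Hypothesis N0 : (0 < N)%N.

Lemma lebesgue_outer_point0 : lebesgue_outer [set (0 : 'rV[R]_N)] = 0%E.
Proof.
apply/eqP; rewrite eq_le lebesgue_outer_ge0 andbT; apply/lee_addgt0Pr => e e0.
rewrite add0e; pose e' := Num.min 1 e.
have e'0 : 0 < e' by rewrite lt_min ltr01.
pose p : 'rV[R]_N * 'rV[R]_N := (const_mx (- e'), 0).
apply: (@le_trans _ _ (box_vol p)%:E).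
  apply: ereal_inf_lbound; exists [set p]; last by rewrite esum_set1// box_vol_ge0.
  split; first exact: countable1.
  by move=> _ ->; exists p => // i; rewrite /= !mxE oppr_lt0 e'0 lexx.
rewrite lee_fin /box_vol (eq_bigr (fun=> e')); last first.
  by move=> i _; rewrite /= !mxE sub0r opprK max_r// ltW.
rewrite prodr_const card_ord; case: N N0 => // n _; rewrite exprS.
apply: (@le_trans _ _ e'); last by rewrite ge_min lexx orbT.
by rewrite ler_piMr ?(ltW e'0)// exprn_ile1 ?(ltW e'0)// ge_min lexx.
Qed.

(** A lower limit above l provides a constant c > l and a punctured neighbourhood
    where r^2 nu r >= c.  The origin joins the exceptional null set. *)
Lemma potential_singular (l : R) (nu : R -> R) (V : 'rV[R]_N -> R) :
  (l%:E < limf_einf (fun r : R => (r ^+ 2 * nu r)%:E) 0^'+)%E ->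
  {ae lebesgue_measureRn R N, forall x, nu (euclid_norm x) <= V x} ->
  exists c r0 Z, [/\ l < c, 0 < r0, lebesgue_outer Z = 0%E &
    forall y : 'rV[R]_N, ~ Z y -> 0 < normsq y /\ (normsq y < r0 ^+ 2 -> c <= normsq y * V y)].
Proof.
rewrite limf_einfE => /ereal_sup_gt[_ [F F0 <-] lF] [A [_ A0 hA]].
have [c lc hc] : exists2 c : R, l < c & forall r, F r -> c <= r ^+ 2 * nu r.
  have h r : F r -> (ereal_inf [set (r ^+ 2 * nu r)%:E | r in F] <= (r ^+ 2 * nu r)%:E)%E.
    by move=> Fr; apply: ereal_inf_lbound; exists r.
  move: lF h; set I := ereal_inf _; case: I => [c| |//] lc h.
    by exists c => // r /h.
  by exists (l + 1); [rewrite ltrDl|move=> r /h; rewrite leye_eq].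
have [r0 /= r00 hr0] : \forall r \near 0, 0 < r -> F r by exact: F0.
exists c, r0, (A `|` [set 0]); split => //.
  apply/eqP; rewrite eq_le lebesgue_outer_ge0 andbT.
  apply: (le_trans (outer_measureU2 (@lebesgue_outer R N) _ _)).
  by rewrite [X in (_ + X)%E]lebesgue_outer_point0 adde0; rewrite -A0.
move=> y /not_orP[nA y0].
have q0 : 0 < normsq y.
  rewrite lt_neqAle normsq_ge0 andbT eq_sym; apply: contra_notN y0 => /eqP h.
  apply/rowP => i; rewrite mxE; apply/eqP; rewrite -sqrf_eq0 eq_le sqr_ge0 andbT.
  by rewrite -h coord_sqr_le_normsq.
split => // yr.
have hV : nu (euclid_norm y) <= V y by apply: contrapT => h; apply: nA; exact: hA.
have e0 : 0 < euclid_norm y by rewrite sqrtr_gt0.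
have e2 : euclid_norm y ^+ 2 = normsq y by rewrite sqr_sqrtr// ltW.
have er : euclid_norm y < r0.
  by rewrite -(@ltr_pXn2r _ 2) ?nnegrE ?e2// ltW.
apply: (@le_trans _ _ (normsq y * nu (euclid_norm y))); last by rewrite ler_wpM2l// ltW.
rewrite -e2; apply: hc; apply: hr0 => //.
by rewrite /ball/= sub0r normrN ger0_norm// ltW.
Qed.

End singularity.

Section explosion.
Variables (R : realType) (N : nat).
Hypothesis hN : (3 <= N)%N.
Context d (Omega : measurableType d).
Variables (P : 'rV[R]_N -> probability Omega R) (B : R -> Omega -> 'rV[R]_N).
Hypothesis hB : forall x, brownian_motion (P x) x B.
Variables (V u0 : 'rV[R]_N -> R).
Hypothesis V_ge0 : forall x, 0 <= V x.
Hypothesis u0_ge0 : forall x, 0 <= u0 x.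
Notation mu := (@lebesgue_measure R).

Let N0 : (0 < N)%N. Proof. exact: leq_trans hN. Qed.

Let truncated_ge0 m y : 0 <= truncated V m y.
Proof. by rewrite /truncated le_min ler0n V_ge0. Qed.

Let truncated_int m t w : (\int[mu]_(s in `[0%R, t]) (truncated V m (B s w))%:E)%E \is a fin_num.
Proof.
rewrite ge0_fin_numE; last by apply: integral_ge0 => s _; rewrite lee_fin truncated_ge0.
apply: (@le_lt_trans _ _ (\int[mu]_(s in `[0%R, t]) (cst (m%:R)%:E s))%E).
  apply: ge0_integral_mono => // s _; rewrite lee_fin ?truncated_ge0//.
  by rewrite /truncated ge_min lexx.
rewrite integral_cst//= lebesgue_measure_itv/=; case: ifP => _; last by rewrite mule0.
by rewrite -EFinB -EFinM ltry.
Qed.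

(** Only the time interval [t / 3, 2 t / 3] and the event E are kept. *)
Lemma feynman_kac_lower (t : R) (x : 'rV[R]_N) (m : nat) (E : set Omega) (b eta : R) : 0 < t ->
  0 <= b -> 0 <= eta -> measurable E ->
  {ae P x, forall w, E w -> eta <= u0 (B t w) /\
     mu.-negligible [set s | t / 3 <= s <= 2 * t / 3 /\ ~ (b <= truncated V m (B s w))]} ->
  ((eta * expR (b * (t / 3)))%:E * P x E <= feynman_kac P B V u0 m t x)%E.
Proof.
move=> t0 b0 eta0 mE [A [mA A0 hA]].
rewrite /feynman_kac unlock; apply: ge0_integral_ge => //.
- by rewrite mulr_ge0// expR_ge0.
- by move=> w _; rewrite lee_fin mulr_ge0// expR_ge0.
exists A; split => // w /= [Ew hw]; apply: hA => /= /(_ Ew)[h1 h2]; apply: hw.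
rewrite lee_fin; apply: ler_pM; rewrite ?expR_ge0// ler_expR -lee_fin.
rewrite /Rintegral fineK; last exact: truncated_int.
pose I : set (measurableTypeR R) := `[t / 3, 2 * t / 3]%classic.
have mI : measurable I by exact: measurable_itv.
have -> : (b * (t / 3))%:E = (b%:E * mu I)%E.
  rewrite /I lebesgue_measure_itv/= lte_fin ifT; last by lra.
  by rewrite -EFinB -EFinM; congr (_%:E); field.
apply: ge0_integral_ge => //.
- move=> s; rewrite /I /= !in_itv/= => /andP[h3 h4].
  rewrite (le_trans _ h3) ?divr_ge0 ?(ltW t0)//= (le_trans h4)//; lra.
- by move=> s _; rewrite lee_fin truncated_ge0.
Qed.

Lemma feynman_kac_full_ge (t : R) (x : 'rV[R]_N) (m : nat) :
  (feynman_kac P B V u0 m t x <= feynman_kac_full P B V u0 t x)%E.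
Proof.
rewrite /feynman_kac unlock /feynman_kac_full; apply: ge0_integral_mono => // w _.
- by rewrite lee_fin mulr_ge0// expR_ge0.
- by rewrite mule_ge0 ?expeR_ge0// lee_fin.
rewrite EFinM lee_wpmul2l ?lee_fin//.
set I := (\int[mu]_(s in `[0%R, t]) truncated V m (B s w))%R.
rewrite (_ : (expR I)%:E = expeR I%:E)//; rewrite lee_expeR /I /Rintegral.
rewrite fineK; last exact: truncated_int.
apply: ge0_integral_mono => // s _; rewrite lee_fin ?truncated_ge0//.
by rewrite /truncated ge_min lexx orbT.
Qed.

Variables (c r0 : R) (Z : set 'rV[R]_N).
Hypothesis jc : bessel_j1 ((N%:R - 2) / 2) ^+ 2 / 2 < c.
Hypothesis r00 : 0 < r0.
Hypothesis Z0 : lebesgue_outer Z = 0%E.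
Hypothesis hV : forall y : 'rV[R]_N, ~ Z y ->
  0 < normsq y /\ (normsq y < r0 ^+ 2 -> c <= normsq y * V y).
Hypothesis u0_cont : continuous u0.
Hypothesis u0_neq0 : exists x, u0 x != 0.

(** The value M is exceeded as soon as the radius r is small enough, in
    particular at most L / (|M| + 1), and the truncation level exceeds c / r^2: expanding the exponential up to
    the order N turns C r^N exp (g / r^2) into a multiple of r^(- N). *)
Lemma feynman_kac_explosion (t : R) (x : 'rV[R]_N) : 0 < t ->
  feynman_kac P B V u0 m t x @[m --> \oo] --> +oo%E.
Proof.
move=> t0; apply/cvgeyPge => M.
have [y0 y00] := u0_neq0.
have [eta [e [eta0 e0 hu0]]] : exists eta e, [/\ 0 < eta, 0 < e &
    forall y : 'rV[R]_N, (forall i, `|y ord0 i - y0 ord0 i| <= e) -> eta <= u0 y].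
  have u00 : 0 < u0 y0 by rewrite lt_neqAle eq_sym y00 u0_ge0.
  have u02 : u0 y0 / 2 < u0 y0 by rewrite ltr_pdivrMr// ltr_pMr// ltr1n.
  have /u0_cont /nbhs_ballP[e /= e0 he] : nbhs (u0 y0) [set z | u0 y0 / 2 < z] by exact: lt_nbhsr.
  exists (u0 y0 / 2), (e / 2); split; [by rewrite divr_gt0|by rewrite divr_gt0|].
  move=> y hy; apply/ltW/he; split => // i j; rewrite /ball/= (ord1 i) distrC.
  by apply: (le_lt_trans (hy j)); rewrite ltr_pdivrMr// ltr_pMr// ltr1n.
pose j2 := bessel_j1 ((N%:R - 2) / 2 : R) ^+ 2; pose rho := (j2 + 2 * c) / 2.
have jc' : j2 / 2 < c by exact: jc.
have rhoj : j2 < rho by rewrite /rho; lra.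
have [C [r1 [C0 r10 hconf]]] := brownian_confined hN y0 (hB x) t0 rhoj e0.
have c0 : 0 < c by apply: le_lt_trans jc; rewrite divr_ge0// sqr_ge0.
(* The net exponential rate. *)
pose g := (c - rho / 2) * (t / 3).
have g0 : 0 < g by rewrite mulr_gt0 ?divr_gt0// subr_gt0 /rho; lra.
pose L := eta * C * (g ^+ N / N`!%:R).
have L0 : 0 < L by rewrite !mulr_gt0 ?exprn_gt0// invr_gt0 ltr0n fact_gt0.
have M1 : 0 < `|M| + 1 by rewrite ltr_wpDl.
pose r := Num.min (Num.min 1 (Num.min r0 r1)) (L / (`|M| + 1)) / 2.
have rm0 : 0 < Num.min (Num.min 1 (Num.min r0 r1)) (L / (`|M| + 1)).
  by rewrite !lt_min ltr01 r00 r10 divr_gt0.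
have rr0 : 0 < r by rewrite divr_gt0.
have : r < Num.min (Num.min 1 (Num.min r0 r1)) (L / (`|M| + 1)).
  by rewrite ltr_pdivrMr// ltr_pMr// ltr1n.
rewrite !lt_min => /andP[/and3P[rl1 rr0' rr1] rL].
clearbody r.
have r20 : 0 < r ^+ 2 by rewrite exprn_gt0.
have [E [mE PE hE]] := hconf r rr0 rr1.
exists (Num.bound (c / r ^+ 2)) => // m /= hm.
have cr0 : 0 <= c / r ^+ 2 by rewrite divr_ge0// ltW.
have cm : c / r ^+ 2 <= m%:R.
  by apply: (le_trans (ltW (archi_boundP cr0))); rewrite ler_nat.
have [A [mA PA hA]] : (P x).-negligible (~` [set w | B 0 w = x /\
    {within `[0, +oo[, continuous (fun s => B s w)}]).
  by apply: filterS2 (bm_start (hB x)) (bm_continuous (hB x)) => w h1 h2; split.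
have GG w : (~` A) w -> B 0 w = x /\ {within `[0, +oo[, continuous (fun s => B s w)}.
  by move=> nA; apply: contrapT => h; apply: nA; exact: hA.
have occ := occupation_null (hB x) t0 (measurableC mA) (fun w Gw => (GG w Gw).2) N0 Z0
  _ (fun w Gw => (GG w Gw).1).
have {}occ := occ (etrans (congr1 (P x) (setCK A)) PA).
have aeG : {ae P x, forall w, (~` A) w} by exists A; split => //; rewrite setCK.
have key : ((eta * expR (c / r ^+ 2 * (t / 3)))%:E * P x E <= feynman_kac P B V u0 m t x)%E.
  apply: (feynman_kac_lower t0 cr0 (ltW eta0) mE).
  apply: filterS2 aeG occ => w Gw negl Ew; have [B0w cB] := GG w Gw.
  have [conf fin] := hE w Ew B0w cB; split; first exact: hu0.
  apply: negligibleS negl => s /= [hs hb]; split => //; apply: contrapT => nZ; apply: hb.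
  have [q0 hq] := hV nZ; rewrite /truncated le_min cm /=.
  have qr := conf s hs.
  have {}hq : c <= normsq (B s w) * V (B s w).
    apply: hq; apply: (le_lt_trans qr).
    by rewrite ltr_pXn2r// nnegrE ltW.
  rewrite ler_pdivrMr// mulrC; apply: (le_trans hq).
  by rewrite ler_wpM2r.
apply: le_trans key; rewrite -[X in (_ <= _ * X)%E]fineK ?fin_num_measure// -EFinM lee_fin.
have h1 : g / r ^+ 2 = c / r ^+ 2 * (t / 3) + - (rho * (t / 3) / (2 * r ^+ 2)).
  by rewrite /g; field; rewrite lt0r_neq0.
apply: (@le_trans _ _ (eta * (C * r ^+ N * expR (g / r ^+ 2)))); last first.
  rewrite h1 expRD -[leRHS]mulrA ler_wpM2l ?(ltW eta0)//.
  by rewrite mulrCA ler_wpM2l ?expR_ge0.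
have h2 : (g / r ^+ 2) ^+ N / N`!%:R <= expR (g / r ^+ 2).
  have gr0 : 0 <= g / r ^+ 2 by rewrite divr_ge0// ltW.
  have := expR_ge1Dxn N.-1 gr0; rewrite prednK//; lra.
apply: (@le_trans _ _ (eta * (C * r ^+ N * ((g / r ^+ 2) ^+ N / N`!%:R)))); last first.
  by rewrite ler_wpM2l ?(ltW eta0)// ler_wpM2l// mulr_ge0 ?exprn_ge0// ltW.
rewrite (_ : eta * _ = L / r ^+ N); last first.
  have rN0 : r ^+ N != 0 by rewrite expf_neq0// lt0r_neq0.
  have f0 : N`!%:R != 0 :> R by rewrite pnatr_eq0 -lt0n fact_gt0.
  rewrite /L exprMn exprVn exprAC; move: rN0 f0.
  by move: (r ^+ N) (g ^+ N) (N`!%:R) => a b f a0 f0; field; rewrite a0 f0.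
apply: (le_trans (ler_norm M)); rewrite ler_pdivlMr ?exprn_gt0//.
apply: (@le_trans _ _ ((`|M| + 1) * r)); last first.
  by rewrite mulrC -ler_pdivlMr// ltW.
rewrite -(prednK N0) exprS mulrA; apply: (@le_trans _ _ (`|M| * r)).
  by rewrite ler_piMr ?mulr_ge0 ?(ltW rr0)// exprn_ile1 ?(ltW rr0) ?(ltW rl1).
by rewrite ler_wpM2r ?(ltW rr0)// lerDl.
Qed.

End explosion.

Theorem theorem2p1 (R : realType) (N : nat) (hN : (3 <= N)%N)
  (d : measure_display) (Omega : measurableType d)
  (P : 'rV[R]_N -> probability Omega R) (B : R -> Omega -> 'rV[R]_N)
  (hB : forall x, brownian_motion (P x) x B)
  (nu : R -> R) (nu_ge0 : forall r : R, 0 < r -> 0 <= nu r)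
  (nu_meas : measurable_fun (`]0, +oo[ : set (lebesgueR R)) nu)
  (nu_noninc : nonincreasing_near_origin nu)
  (V : 'rV[R]_N -> R) (V_ge0 : forall x, 0 <= V x)
  (V_meas : measurable_fun [set: lebesgueRn R N] V)
  (nu_liminf : ((bessel_j1 ((N%:R - 2) / 2) ^+ 2 / 2)%:E <
     limf_einf (fun r : R => (r ^+ 2 * nu r)%:E) 0^'+)%E)
  (nu_le_V : {ae lebesgue_measureRn R N, forall x, nu (euclid_norm x) <= V x})
  (u0 : 'rV[R]_N -> R) (u0_C0 : continuous_compact_support u0)
  (u0_ge0 : forall x, 0 <= u0 x) (u0_neq0 : exists x, u0 x != 0) :
  no_solution P B V u0 /\
  (forall (t : R) (x : 'rV[R]_N), 0 < t -> feynman_kac_full P B V u0 t x = +oo%E).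
Proof.
have N0 : (0 < N)%N by exact: leq_trans hN.
have [c [r0 [Z [jc r00 Z0 hV]]]] := potential_singular N0 nu_liminf nu_le_V.
have [u0c _] := u0_C0.
have explode : no_solution P B V u0.
  by move=> t x t0; exact: (feynman_kac_explosion hN hB V_ge0 u0_ge0 jc r00 Z0 hV u0c u0_neq0).
split => // t x t0; apply/eqP; rewrite -leye_eq.
apply: cvge_le (explode t x t0); apply: nearW => m.
exact: feynman_kac_full_ge.
Qed.
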